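(* Let $n\ge1$ be an integer, $0<\sigma<n/2$ and $A>0$. There exists a constant $C>0$ depending only on $n$, $\sigma$ and $A$ such that the following holds. Let $R>0$, let $h\in C^1(B_{3R})$ be a positive function with $$R^{\frac{n-2\sigma}{2}}\|h\|_{L^\infty(B_{5R/2})}+R\,\|\nabla\ln h\|_{L^\infty(B_{5R/2})}\le A,$$ and let $u\in C(B_{3R})$ be a positive solution of $$u(x)=\int_{B_{3R}}\frac{u(y)^{\frac{n+2\sigma}{n-2\sigma}}}{|x-y|^{n-2\sigma}}\,dy+h(x),\qquad x\in B_{3R}.$$ Then $$\sup_{B_R}u\cdot\inf_{B_{2R}}u\le C R^{2\sigma-n}.$$
   Context: $B_r\subset\mathbb{R}^n$ denotes the open ball of radius $r$ centered at the origin. *)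

(* Defs.v *)
From HB Require Import structures.
From mathcomp Require Import all_boot all_order all_algebra.
From mathcomp Require Import all_classical all_reals all_analysis.

Set Implicit Arguments.
Unset Strict Implicit.
Unset Printing Implicit Defensive.

Import Order.TTheory GRing.Theory Num.Theory.
Import numFieldNormedType.Exports.

Local Open Scope classical_set_scope.
Local Open Scope ring_scope.

(* The Borel sigma-algebra on R^n, as the product sigma-algebra: the smallest
   one making all coordinate functions measurable. *)
Section measurable_rV.
Context {R : realType} (n : nat).

Let coor : 'I_n -> 'rV[R]_n -> R := fun i x => x ord0 i.

Let rV_set0 : g_sigma_preimage coor set0.
Proof. exact: sigma_algebra0. Qed.

Let rV_setC A : g_sigma_preimage coor A -> g_sigma_preimage coor (~` A).
Proof. exact: sigma_algebraC. Qed.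

Let rV_bigcup (F : (set 'rV[R]_n)^nat) :
  (forall i, g_sigma_preimage coor (F i)) ->
  g_sigma_preimage coor (\bigcup_i (F i)).
Proof. exact: sigma_algebra_bigcup. Qed.

HB.instance Definition _ := @isMeasurable.Build default_measure_display
  'rV[R]_n (g_sigma_preimage coor) rV_set0 rV_setC rV_bigcup.

End measurable_rV.

Section lebesgue_rV.
Context {R : realType}.

Definition cons_rV n (z : measurableTypeR R * 'rV[R]_n) : 'rV[R]_n.+1 :=
  \row_i (if unlift ord0 i is Some j then z.2 ord0 j else z.1).

Lemma measurable_coor n (i : 'I_n) :
  measurable_fun [set: 'rV[R]_n] (fun x => x ord0 i).
Proof.
move=> _ Y mY; rewrite setTI; apply: sub_sigma_algebra => /=.
rewrite -bigcup_seq/=; exists i => /=; first by rewrite mem_index_enum.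
by exists Y => //; rewrite setTI.
Qed.

Lemma measurable_fun_rVP d (T : measurableType d) n (f : T -> 'rV[R]_n) :
  measurable_fun [set: T] f <->
  forall i, measurable_fun [set: T] (fun x => f x ord0 i).
Proof.
split=> [mf i|mf].
  exact: (measurableT_comp (measurable_coor i) mf).
suff : (g_sigma_preimage (fun i (x : 'rV[R]_n) => x ord0 i : R)) `<=`
    [set A | measurable (f @^-1` A)].
  by move=> H _ A mA; rewrite setTI; exact: H.
apply: smallest_sub.
  split => /=.
  - by rewrite preimage_set0.
  - by move=> A mA; rewrite setTD preimage_setC; exact: measurableC.
  - by move=> F mF; rewrite preimage_bigcup; exact: bigcup_measurable.
move=> A; rewrite -bigcup_seq => -[i _ [B mB <-]] /=.
by rewrite setTI; have := mf i measurableT B mB; rewrite setTI.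
Qed.

Lemma measurable_cons_rV n : measurable_fun [set: _] (@cons_rV n).
Proof.
apply/measurable_fun_rVP => i.
under eq_fun do rewrite mxE.
case: unliftP => [j _|_]; last exact: measurable_fst.
exact: (measurableT_comp (measurable_coor j) measurable_snd).
Qed.

Lemma measurable_uncons_rV n :
  measurable_fun [set: 'rV[R]_n.+1]
    (fun x => (x ord0 ord0, \row_j x ord0 (lift ord0 j)) :
       measurableTypeR R * 'rV[R]_n).
Proof.
apply/measurable_fun_pair; first exact: measurable_coor.
apply/measurable_fun_rVP => i.
under eq_fun do rewrite mxE.
exact: measurable_coor.
Qed.

Lemma uncons_rVK n (x : 'rV[R]_n.+1) :
  cons_rV (x ord0 ord0, \row_j x ord0 (lift ord0 j)) = x.
Proof.
apply/rowP => i; rewrite mxE; case: unliftP => [j ->|->] //=.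
by rewrite mxE.
Qed.

Lemma cons_rVK n (z : measurableTypeR R * 'rV[R]_n) :
  (cons_rV z ord0 ord0, \row_j cons_rV z ord0 (lift ord0 j)) = z.
Proof.
case: z => a v; congr (_, _); first by rewrite mxE unlift_none.
by apply/rowP => j; rewrite !mxE liftK.
Qed.

Section step.
Context n (mu : {sigma_finite_measure set 'rV[R]_n -> \bar R}).
Local Open Scope ereal_scope.

Definition lebesgue_rVS : set 'rV[R]_n.+1 -> \bar R :=
  pushforward (lebesgue_measure \x mu) (@cons_rV n).

Let lebesgue_rVS0 : lebesgue_rVS set0 = 0.
Proof. by rewrite /lebesgue_rVS /pushforward preimage_set0 measure0. Qed.

Let lebesgue_rVS_ge0 A : 0 <= lebesgue_rVS A.
Proof. by rewrite /lebesgue_rVS /pushforward; exact: measure_ge0. Qed.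

Let lebesgue_rVS_sigma_additive : semi_sigma_additive lebesgue_rVS.
Proof.
apply: measure_semi_sigma_additive; exact: measurable_cons_rV.
Qed.

HB.instance Definition _ := isMeasure.Build _ _ _ lebesgue_rVS
  lebesgue_rVS0 lebesgue_rVS_ge0 lebesgue_rVS_sigma_additive.

Let lebesgue_rVS_sigma_finite : sigma_finite setT lebesgue_rVS.
Proof.
have /sigma_finiteP[F [TF ndF Foo]] :=
  @sigma_finiteT _ _ _ (@lebesgue_measure R).
have /sigma_finiteP[G [TG ndG Goo]] := sigma_finiteT mu.
pose g (x : 'rV[R]_n.+1) : measurableTypeR R * 'rV[R]_n :=
  (x ord0 ord0, \row_j x ord0 (lift ord0 j)).
exists (fun k => g @^-1` (F k `*` G k)).
  apply/esym; rewrite -subTset => x _.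
  have [k _ Fk] : (\bigcup_k F k) (g x).1 by rewrite -TF.
  have [l _ Gl] : (\bigcup_k G k) (g x).2 by rewrite -TG.
  exists (maxn k l) => //; split.
  - by move: Fk; exact/subsetPset/ndF/leq_maxl.
  - by move: Gl; exact/subsetPset/ndG/leq_maxr.
move=> k; have [mF Fkoo] := Foo k; have [mG Gkoo] := Goo k; split.
  rewrite -[X in measurable X]setTI.
  by apply: measurable_uncons_rV => //; exact: measurableX.
rewrite /lebesgue_rVS /pushforward -comp_preimage.
rewrite (_ : g \o _ = id); last by apply/funext => z; exact: cons_rVK.
by rewrite preimage_id product_measure1E// lte_mul_pinfty// ge0_fin_numE.
Qed.

HB.instance Definition _ := Measure_isSigmaFinite.Build _ _ _ lebesgue_rVS
  lebesgue_rVS_sigma_finite.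

End step.

(* Lebesgue measure on R^n: the n-fold product of the one-dimensional one,
   starting from the Dirac mass on the one-point space R^0. *)
Fixpoint lebesgue_rV n : {sigma_finite_measure set 'rV[R]_n -> \bar R} :=
  match n with
  | 0 => \d_(0 : 'rV[R]_0)
  | m.+1 => lebesgue_rVS (lebesgue_rV m)
  end.

(* The normalization which characterizes it. *)
Lemma lebesgue_rV_box n (A : 'I_n -> set (measurableTypeR R)) :
  (forall i, measurable (A i)) ->
  lebesgue_rV n [set x | forall i, A i (x ord0 i)] =
  (\prod_(i < n) lebesgue_measure (A i))%E.
Proof.
elim: n => [|n IH] in A * => mA.
  rewrite big_ord0 /= diracE mem_set// => -[].
  by [].
pose B := [set x : 'rV[R]_n | forall i, A (lift ord0 i) (x ord0 i)].
have mB : measurable B.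
  have -> : B = \bigcap_(i in [set: 'I_n])
      ((fun x : 'rV[R]_n => x ord0 i) @^-1` A (lift ord0 i)).
    by apply/seteqP; split => x /= => [H i _|H i]; exact: H.
  apply: fin_bigcap_measurable => // i _.
  by rewrite -[X in measurable X]setTI; apply: measurable_coor => //; exact: mA.
rewrite big_ord_recl -IH//= /lebesgue_rVS /pushforward -product_measure1E//.
congr (_ _); rewrite -/B.
apply/seteqP; split => [[a v] /= H|[a v] /= [Ha Hv] i].
  split; first by have := H ord0; rewrite mxE unlift_none.
  by move=> i; have := H (lift ord0 i); rewrite mxE liftK.
by rewrite mxE; case: unliftP => [j ->|->].
Qed.

End lebesgue_rV.
Arguments lebesgue_rV {R} n.

Section euclidean_analysis.
Context {R : realType} {n : nat}.
Implicit Types (x : 'rV[R]_n) (f : 'rV[R]_n -> R) (D : set 'rV[R]_n).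

(* The library norm `|x| on 'rV_n is the sup norm; it induces the same topology
   and the same notion of differentiability. *)
Definition enorm x : R := Num.sqrt (\sum_i x ord0 i ^+ 2).

Definition eball (r : R) : set 'rV[R]_n := [set x | enorm x < r].

Definition partial (i : 'I_n) f x : R := 'D_('e_i) f x.

Definition grad f x : 'rV[R]_n := \row_i partial i f x.

(* D is meant to be open; nothing is required of f outside D. *)
Definition C1on D f : Prop :=
  (forall x, D x -> differentiable f x) /\
  (forall i, {within D, continuous (partial i f)}).

(* The essential supremum of |f| over D, an extended real. *)
Definition Linfty D f : \bar R := 'N[lebesgue_rV n]_+oo%E[EFin \o (f \_ D)].

End euclidean_analysis.

(* Main.v *)
(* Moving spheres, run directly with explicit constants, without any blow-up
   limit. The critical exponent makes the integral operator invariant under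
   inversions, so that the difference of [u] and its Kelvin transform about a
   sphere is, up to a term in [h], the integral over the exterior of the sphere
   of the difference of the densities against a positive kernel; the bound on
   the gradient of [ln h] makes [h] dominate its own Kelvin transforms at small
   scales. A maximum principle, based on the smallness of the kernel mass of thin
   shells, then lets the sphere grow up to every radius [L] with
   [(L / rho)^m sup_{B_L} u <= eps * inf u]. Applied about all centres close to a
   doubling point [x1], with the sphere reflecting [y] into [x1], this gives
   [u y >= c * u x1] for [|y - x1| <= s]; inserting that into the equation at
   [x1] bounds [u x1 * s^(m/2)], which is the claim for the right [s]. *)
Require Import Defs.
From mathcomp Require Import all_boot all_order all_algebra.
From mathcomp Require Import all_classical all_reals all_analysis.
From mathcomp Require Import measurable_realfun ess_sup_inf ring lra.
Import Order.TTheory GRing.Theory Num.Theory.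
Import numFieldNormedType.Exports.
Local Open Scope classical_set_scope.
Local Open Scope ring_scope.

(** * Lebesgue measure and inversions *)

(** The equation is known only in a ball, so nothing can be compared at infinity: for
    [enorm z > rho] the reflected density must be paid for by what [u] contributes in the annulus
    between [rho] and [4 * rho]. Hence the hypothesis [(L / rho)^m * M <= eps * a]: it makes the
    reflected function there a small multiple of the lower bound [a]. The kernel bounds on both
    sides carry the factor [1 - (l / enorm y)^2], so the comparison stays uniform as [y] approaches
    the sphere, and half of the annulus integral is left over; this surplus gives strict
    inequalities and replaces a strong maximum principle. Spheres can thus grow only to radii of
    order [rho * (a / M)^(1/m)], and the doubling point makes [M] comparable to [u x1]. The
    inversion formula for integrals is derived from scaling and Tonelli instead of a Jacobian
    determinant. *)

Section measurability.
Context {R : realType}.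

(** The sigma-algebra is generated by the coordinates, so [U] is written as the union of the boxes
    with rational centre and radius that it contains; there are countably many. *)
Lemma open_measurable_rV n (U : set 'rV[R]_n) : open U -> measurable U.
Proof.
move=> oU.
pose box (qe : 'rV[rat]_n * rat) := [set x : 'rV[R]_n |
  forall i, `|x ord0 i - ratr (qe.1 ord0 i)| < ratr qe.2].
have mbox qe : measurable (box qe).
  have -> : box qe = \bigcap_(i in [set: 'I_n])
      ((fun x : 'rV[R]_n => x ord0 i) @^-1`
        [set t | `|t - ratr (qe.1 ord0 i)| < ratr qe.2]).
    by apply/seteqP; split => x /= => [H i _|H i]; exact: H.
  apply: fin_bigcap_measurable => // i _.
  rewrite -[X in measurable X]setTI; apply: measurable_coor => //.
  rewrite (_ : [set _ | _] = `](ratr (qe.1 ord0 i) - ratr qe.2),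
      (ratr (qe.1 ord0 i) + ratr qe.2)[%classic); first exact: measurable_itv.
  by apply/seteqP; split => t /=; rewrite in_itv/= ltr_distl.
have -> : U = \bigcup_(qe in [set qe | box qe `<=` U]) box qe.
  apply/seteqP; split => [x Ux|x [qe /= + ?]]; last exact.
  have /nbhs_ballP[e /= e0 eU] : nbhs x U by exact: open_nbhs_nbhs.
  have [d] : exists d : rat, ratr d \in `]0, (e / 2)[%R.
    by apply: rat_in_itvoo; rewrite divr_gt0.
  rewrite in_itv/= => /andP[d0 de].
  have /choice[q Hq] (i : 'I_n) : exists q : rat,
      ratr q \in `](x ord0 i - ratr d), (x ord0 i + ratr d)[%R.
    by apply: rat_in_itvoo; rewrite ltrBlDr -addrA ltrDl addr_gt0.
  have xq i : `|x ord0 i - ratr (q i)| < ratr d.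
    by have := Hq i; rewrite in_itv/= ltr_distlC => /andP[? ?]; apply/andP; split; lra.
  exists (\row_i q i, d) => /=; last by move=> i; rewrite mxE.
  move=> y /= Hy; apply: eU.
  rewrite -ball_normE /= [X in X < _]mx_normrE; apply: (le_lt_trans (y := ratr d + ratr d)); last lra.
  apply: bigmax_le => [|[i j] _ /=]; first lra.
  rewrite !mxE ord1 (le_trans (ler_distD (ratr (q j)) _ _))// lerD//.
    exact/ltW.
  by have := Hy j; rewrite mxE distrC => /ltW.
rewrite bigcup_mkcond.
apply: countable_bigcupT_measurable => [|qe]; first exact: countableP.
by case: ifPn.
Qed.

Lemma continuous_measurable_rV n (D : set 'rV[R]_n) (f : 'rV[R]_n -> R) :
  open D -> {within D, continuous f} -> measurable_fun D f.
Proof.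
move=> oD /continuousP cf.
apply: (measurability _ (RGenOpens.measurableE R)).
move=> _ [_ [a [b ->] <-]].
have /open_subspaceP[V oV VD] := cf _ (@interval_open R (BRight a) (BLeft b) isT isT).
by rewrite setIC -VD; apply: measurableI; exact: open_measurable_rV.
Qed.

Lemma measurable_enorm n : measurable_fun [set: 'rV[R]_n] (@enorm R n).
Proof.
apply: (@measurableT_comp _ _ _ _ _ _ (@Num.sqrt R)).
  exact: continuous_measurable_fun (@sqrt_continuous R).
apply: measurable_sum => i; apply: measurable_funX.
exact: measurable_coor.
Qed.

Lemma measurable_addv n (b : 'rV[R]_n) : measurable_fun [set: 'rV[R]_n] (+%R b).
Proof.
apply/measurable_fun_rVP => i; under eq_fun do rewrite mxE.
by apply: measurable_funD => //; exact: measurable_coor.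
Qed.

Lemma measurable_scalev n : measurable_fun [set: measurableTypeR R * 'rV[R]_n]
  (fun z => z.1 *: z.2).
Proof.
apply/measurable_fun_rVP => i; under eq_fun do rewrite mxE.
apply: measurable_funM; first exact: measurable_fst.
exact: (measurableT_comp (measurable_coor i) measurable_snd).
Qed.

End measurability.

(** * Affine changes of variables *)

Section affine.
Context {R : realType}.
Local Open Scope ereal_scope.

(** The image of the measure under the affine map, multiplied by [a], gives each half-open interval
    its length; uniqueness identifies it with Lebesgue measure. *)
Lemma lebesgue_affine (a b : R) (g : R -> \bar R) : (0 < a)%R ->
  measurable_fun setT g -> (forall x, 0 <= g x) ->
  a%:E * \int[lebesgue_measure]_x g (a * x + b)%R = \int[lebesgue_measure]_x g x.
Proof.
move=> a0 mg g0.
pose phi (x : measurableTypeR R) : measurableTypeR R := (a * x + b)%R.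
have mphi : measurable_fun setT phi.
  by apply: measurable_funD => //; exact: measurable_funM.
pose nu := mscale (NngNum (ltW a0))
  (measure_function_pushforward__canonical__measure_function_Measure
     lebesgue_measure mphi).
have nuE (A : set (measurableTypeR R)) : measurable A -> lebesgue_measure A = nu A.
  move=> mA; apply: (lebesgue_measure_unique (mu := nu)) mA => /= _ [[c d]] _ <- /=.
  rewrite /nu /mscale /= /pushforward.
  have -> : phi @^-1` `]c, d]%classic = `]((c - b) / a)%R, ((d - b) / a)%R]%classic.
    apply/seteqP; split => x /=;
      by rewrite /phi !in_itv/= ltr_pdivrMr// ler_pdivlMr// ltrBlDr lerBrDr mulrC.
  rewrite !lebesgue_measure_itv/= !lte_fin ltr_pM2r ?invr_gt0// ltrD2r.
  case: ifPn => _; last by rewrite mule0.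
  rewrite -EFinD -EFinM; congr (_%:E); field; exact: lt0r_neq0.
rewrite [RHS](eq_measure_integral nu) => [|A mA _]; last exact: nuE.
rewrite ge0_integral_mscale// ge0_integral_pushforward//.
Qed.

Lemma integral_lebesgue_rVS n (g : 'rV[R]_n.+1 -> \bar R) :
  measurable_fun setT g -> (forall x, 0 <= g x) ->
  \int[lebesgue_rV n.+1]_x g x =
  \int[lebesgue_measure]_t \int[lebesgue_rV n]_v g (cons_rV (t, v)).
Proof.
move=> mg g0.
rewrite [LHS]ge0_integral_pushforward//; last exact: measurable_cons_rV.
rewrite preimage_setT.
rewrite (fubini_tonelli1 (g \o @cons_rV R n))//.
  exact: (measurableT_comp mg (@measurable_cons_rV R n)).
by move=> z; exact: g0.
Qed.

Lemma lebesgue_rV_affine n (a : R) (b : 'rV[R]_n) (g : 'rV[R]_n -> \bar R) :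
  (0 < a)%R -> measurable_fun setT g -> (forall x, 0 <= g x) ->
  (a ^+ n)%:E * \int[lebesgue_rV n]_x g (a *: x + b)%R = \int[lebesgue_rV n]_x g x.
Proof.
move=> a0; elim: n => [|n IH] in b g * => mg g0.
  rewrite expr0 mul1e; apply: eq_integral => x _.
  by congr g; apply/rowP => -[].
have maff (c : R) m (d : 'rV[R]_m) : measurable_fun setT (fun x : 'rV[R]_m => c *: x + d)%R.
  apply/measurable_fun_rVP => i; under eq_fun do rewrite !mxE.
  by apply: measurable_funD => //; apply: measurable_funM => //; exact: measurable_coor.
rewrite integral_lebesgue_rVS//; last exact: (measurableT_comp mg (maff _ _ _)).
rewrite integral_lebesgue_rVS//.
pose b' := (\row_j b ord0 (lift ord0 j))%R.
pose b0 := b ord0 ord0.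
have E t v : (a *: cons_rV (t, v) + b = cons_rV (a * t + b0, a *: v + b'))%R.
  apply/rowP => i; rewrite !mxE; case: unliftP => [j|] -> /=; by rewrite ?mxE.
under eq_integral do under eq_integral do rewrite E.
have mgc := measurableT_comp mg (@measurable_cons_rV R n).
pose G t := \int[lebesgue_rV n]_v g (cons_rV (t, v)).
have mG : measurable_fun setT G.
  exact: (measurable_fun_fubini_tonelli_F (m2 := lebesgue_rV n) (g \o @cons_rV R n) mgc (fun z => g0 _)).
have G0 t : 0 <= G t by exact: integral_ge0.
rewrite -(lebesgue_affine a b0 _ a0 mG G0).
pose phi (z : measurableTypeR R * 'rV[R]_n) : measurableTypeR R * 'rV[R]_n :=
  ((a * z.1 + b0)%R, (a *: z.2 + b')%R).
have mphi : measurable_fun setT phi.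
  apply/measurable_fun_pair => /=.
    by apply: measurable_funD => //; exact: measurable_funM.
  exact: (measurableT_comp (maff a n b') measurable_snd).
have mH := measurableT_comp mgc mphi.
rewrite exprS EFinM -muleA -ge0_integralZl//; last 3 first.
- exact: (measurable_fun_fubini_tonelli_F (m2 := lebesgue_rV n) _ mH
    (fun z => g0 _)).
- by move=> t _; exact: integral_ge0.
- by rewrite lee_fin exprn_ge0// ltW.
congr (_ * _); apply: eq_integral => t _.
rewrite (IH b' (fun v => g (cons_rV ((a * t + b0)%R, v))))//.
exact: (measurableT_comp mgc (measurable_pair1 _)).
Qed.

Lemma lebesgue_rV_translate n (b : 'rV[R]_n) (g : 'rV[R]_n -> \bar R) :
  measurable_fun setT g -> (forall x, 0 <= g x) ->
  \int[lebesgue_rV n]_x g (x + b)%R = \int[lebesgue_rV n]_x g x.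
Proof.
move=> mg g0; rewrite -(lebesgue_rV_affine n 1 b g)// expr1n mul1e.
by apply: eq_integral => x _; rewrite scale1r.
Qed.

Lemma lebesgue_rV_scale n (a : R) (g : 'rV[R]_n -> \bar R) : (0 < a)%R ->
  measurable_fun setT g -> (forall x, 0 <= g x) ->
  (a ^+ n)%:E * \int[lebesgue_rV n]_x g (a *: x)%R = \int[lebesgue_rV n]_x g x.
Proof.
move=> a0 mg g0; rewrite -(lebesgue_rV_affine n a 0 g)//.
by congr (_ * _); apply: eq_integral => x _; rewrite addr0.
Qed.

(** [R^0] carries a Dirac mass, hence [0 < n]. Null points are what makes the default values of
    inverses at [0], and at the pole of a kernel, harmless. *)
Lemma lebesgue_rV_set1 n (x : 'rV[R]_n) : (0 < n)%N -> lebesgue_rV n [set x] = 0.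
Proof.
move=> n0.
have -> : [set x] = [set y | forall i, [set x ord0 i] (y ord0 i)].
  apply/seteqP; split => y /= => [->//|H]; apply/rowP => i; exact: H.
rewrite (@lebesgue_rV_box _ _ (fun i => [set x ord0 i]))//.
by rewrite (bigD1 (Ordinal n0))//= lebesgue_measure_set1 mul0e.
Qed.

End affine.

(** * Euclidean norm and inversions in spheres *)

Section euclidean.
Context {R : realType} {n : nat}.
Implicit Types (x y z : 'rV[R]_n) (a l : R).

Definition dotv x y : R := \sum_i x ord0 i * y ord0 i.

Lemma dotvC x y : dotv x y = dotv y x.
Proof. by apply: eq_bigr => i _; rewrite mulrC. Qed.

Lemma dotvDl x y z : dotv (x + y) z = dotv x z + dotv y z.
Proof. by rewrite -big_split; apply: eq_bigr => i _; rewrite !mxE mulrDl. Qed.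

Lemma dotvZl a x y : dotv (a *: x) y = a * dotv x y.
Proof. by rewrite mulr_sumr; apply: eq_bigr => i _; rewrite !mxE mulrA. Qed.

Lemma dotvDr x y z : dotv x (y + z) = dotv x y + dotv x z.
Proof. by rewrite dotvC dotvDl !(dotvC x). Qed.

Lemma dotvZr a x y : dotv x (a *: y) = a * dotv x y.
Proof. by rewrite dotvC dotvZl dotvC. Qed.

Lemma enorm_ge0 x : 0 <= enorm x.
Proof. exact: sqrtr_ge0. Qed.

Lemma sqr_enorm x : enorm x ^+ 2 = dotv x x.
Proof.
rewrite /enorm sqr_sqrtr; last by apply: sumr_ge0 => i _; exact: sqr_ge0.
by apply: eq_bigr => i _; rewrite expr2.
Qed.

Lemma enorm_eq0 x : (enorm x == 0) = (x == 0).
Proof.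
apply/idP/eqP => [|->]; last first.
  by rewrite -sqrf_eq0 sqr_enorm /dotv big1// => i _; rewrite mxE mul0r.
rewrite -sqrf_eq0 sqr_enorm psumr_eq0; last by move=> i _; rewrite -expr2 sqr_ge0.
move=> /allP/(_ _ (mem_index_enum _)) H; apply/rowP => i.
by have := H i; rewrite -expr2 sqrf_eq0 mxE => /eqP.
Qed.

Lemma enorm0 : enorm (0 : 'rV[R]_n) = 0.
Proof. by apply/eqP; rewrite enorm_eq0. Qed.

Lemma enorm_gt0 x : (0 < enorm x) = (x != 0).
Proof. by rewrite lt0r enorm_eq0 enorm_ge0 andbT. Qed.

Lemma enormZ a x : enorm (a *: x) = `|a| * enorm x.
Proof.
apply/eqP; rewrite -(@eqrXn2 _ 2)// ?mulr_ge0 ?enorm_ge0//.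
by rewrite exprMn !sqr_enorm dotvZl dotvZr mulrA -expr2 real_normK// num_real.
Qed.

Lemma enormN x : enorm (- x) = enorm x.
Proof. by rewrite -scaleN1r enormZ normrN1 mul1r. Qed.

Lemma enormBC x y : enorm (x - y) = enorm (y - x).
Proof. by rewrite -enormN opprB. Qed.

Lemma sqr_enormB x y : enorm (x - y) ^+ 2 =
  enorm x ^+ 2 - 2 * dotv x y + enorm y ^+ 2.
Proof.
rewrite !sqr_enorm -scaleN1r dotvDl !dotvDr !dotvZl !dotvZr (dotvC y x); ring.
Qed.

Lemma cauchy_schwarz x y : dotv x y <= enorm x * enorm y.
Proof.
have [->|y0] := eqVneq y 0.
  by rewrite enorm0 mulr0 /dotv big1// => i _; rewrite mxE mulr0.
have [->|x0] := eqVneq x 0.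
  by rewrite enorm0 mul0r /dotv big1// => i _; rewrite mxE mul0r.
have yp : 0 < enorm y by rewrite enorm_gt0.
have xp : 0 < enorm x by rewrite enorm_gt0.
have := sqr_ge0 (enorm (enorm y *: x - enorm x *: y)).
rewrite sqr_enormB !enormZ dotvZl dotvZr !ger0_norm ?enorm_ge0// => H.
rewrite -(ler_pM2l (mulr_gt0 xp yp)); lra.
Qed.

Lemma enormD x y : enorm (x + y) <= enorm x + enorm y.
Proof.
rewrite -(@ler_pXn2r _ 2)// ?nnegrE ?addr_ge0 ?enorm_ge0//.
have := sqr_enormB x (- y); rewrite opprK enormN => ->.
rewrite -(scaleN1r y) dotvZr; have := cauchy_schwarz x y; lra.
Qed.

Lemma enorm_leB x y : enorm x - enorm y <= enorm (x - y).
Proof. by rewrite lerBlDr (le_trans _ (enormD _ _))// subrK. Qed.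

Lemma enormB_leD x y : enorm (x - y) <= enorm x + enorm y.
Proof. by rewrite (le_trans (enormD _ _))// enormN. Qed.

Lemma normr_coor_le_enorm x i : `|x ord0 i| <= enorm x.
Proof.
rewrite -(@ler_pXn2r _ 2)// ?nnegrE ?enorm_ge0//.
rewrite sqr_enorm /dotv (bigD1 i)//= real_normK ?num_real// expr2 lerDl.
by apply: sumr_ge0 => j _; rewrite -expr2 sqr_ge0.
Qed.

Lemma continuous_enorm : continuous (@enorm R n).
Proof.
move=> x; apply: (@continuous_comp _ _ _ (fun x : 'rV[R]_n => \sum_i x ord0 i ^+ 2)
  (@Num.sqrt R)); last exact: sqrt_continuous.
move: x; apply: continuous_big => [|i _ x]; first exact: add_continuous.
apply: (@continuous_comp _ _ _ (fun x : 'rV[R]_n => x ord0 i) (fun t : R => t ^+ 2)).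
  exact: coord_continuous.
exact: exprn_continuous.
Qed.

Lemma continuous_subv (c : 'rV[R]_n) : continuous (fun x : 'rV[R]_n => x - c).
Proof.
move=> x; have FF : Filter (nbhs x) := @nbhs_filter 'rV[R]_n x.
apply/(@cvg_ballP _ 'rV[R]_n) => e e0.
apply: (@filterS _ _ FF (ball (x : 'rV[R]_n) e)); last exact: nbhsx_ballx.
by move=> y; rewrite -!ball_normE /= opprB addrA subrK.
Qed.

Lemma compact_enorm_ball (c : 'rV[R]_n) (r : R) : compact [set x | enorm (x - c) <= r].
Proof.
apply: bounded_closed_compact.
  exists (enorm c + r); split; first exact: num_real.
  move=> M Mr x /= xr; rewrite [leLHS]mx_normrE.
  apply: bigmax_le => [|[i j] _ /=].
    have := enorm_ge0 c; have := enorm_ge0 (x - c); lra.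
  rewrite ord1 (le_trans (normr_coor_le_enorm _ _))//.
  have := enorm_leB x c; lra.
rewrite [X in closed X](_ : _ = (fun x => enorm (x - c)) @^-1` [set t | t <= r])//.
apply: closed_comp; last exact: closed_le.
move=> x _; apply: (@continuous_comp _ _ _ (fun x => x - c) (@enorm R n)).
  exact: continuous_subv.
exact: continuous_enorm.
Qed.

Lemma open_enorm_ball (c : 'rV[R]_n) (r : R) : open [set x | enorm (x - c) < r].
Proof.
rewrite [X in open X](_ : _ = (fun x => enorm (x - c)) @^-1` [set t | t < r])//.
apply: open_comp; last exact: open_lt.
move=> x _; apply: (@continuous_comp _ _ _ (fun x => x - c) (@enorm R n)).
  exact: continuous_subv.
exact: continuous_enorm.
Qed.

(** The origin is sent to itself, because [l / 0 = 0]. Spheres with another centre are treated by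
    translating the functions. *)
Definition inversion l x : 'rV[R]_n := (l / enorm x) ^+ 2 *: x.

Lemma enorm_inversion l x : enorm (inversion l x) = l ^+ 2 / enorm x.
Proof.
rewrite enormZ ger0_norm ?sqr_ge0//.
have [->|x0] := eqVneq x 0; first by rewrite enorm0 mulr0 invr0 mulr0.
by field; rewrite enorm_eq0.
Qed.

Lemma enorm_inversionB l x y : 0 <= l -> x != 0 -> y != 0 ->
  enorm (inversion l x - inversion l y) =
  l ^+ 2 * enorm (x - y) / (enorm x * enorm y).
Proof.
move=> l0 x0 y0.
have xp : enorm x != 0 by rewrite enorm_eq0.
have yp : enorm y != 0 by rewrite enorm_eq0.
apply/eqP; rewrite -(@eqrXn2 _ 2)// ?divr_ge0 ?mulr_ge0 ?enorm_ge0 ?sqr_ge0//.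
rewrite sqr_enormB !enorm_inversion dotvZl dotvZr.
rewrite [eqbRHS]exprMn [X in _ == X * _]exprMn sqr_enormB; apply/eqP.
by field; rewrite xp yp.
Qed.

End euclidean.

Section inversion_measure.
Context {R : realType}.

(** The real power with exponent [-1] is the inverse on nonnegative numbers, [0] included since both
    conventions return [0] there; oddness does the rest. *)
Lemma measurable_invr : measurable_fun [set: R] (@GRing.inv R).
Proof.
rewrite (_ : @GRing.inv R = fun x => if 0 <= x then x `^ (-1) else - ((- x) `^ (-1))).
  apply: measurable_fun_ifT.
  - exact: measurable_fun_ler.
  - exact: measurable_powR.
  - apply: measurableT_comp => //.
    by apply: (measurableT_comp (measurable_powR (-1))).
apply/funext => x; case: ifPn => [x0|]; first by rewrite powR_inv1.
rewrite -ltNge => x0; rewrite powR_inv1 ?oppr_ge0 ?ltW//.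
by rewrite invrN opprK.
Qed.

Lemma measurable_inversion n (l : R) : measurable_fun [set: 'rV[R]_n] (inversion l).
Proof.
apply/measurable_fun_rVP => i; under eq_fun do rewrite mxE.
apply: measurable_funM; last exact: measurable_coor.
apply: measurable_funX; apply: measurable_funM => //.
exact: (measurableT_comp measurable_invr (measurable_enorm n)).
Qed.

Lemma measurable_set1_rV n (x : 'rV[R]_n) : measurable [set x].
Proof.
have -> : [set x] = \bigcap_(i in [set: 'I_n])
    ((fun y : 'rV[R]_n => y ord0 i) @^-1` [set x ord0 i]).
  by apply/seteqP; split => y /= => [-> i _//|H]; apply/rowP => i; exact: H.
apply: fin_bigcap_measurable => // i _.
by rewrite -[X in measurable X]setTI; exact: measurable_coor.
Qed.

(** Serves the identities that fail at one point, where a division by zero sets in. *)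
Lemma eq_integral_off_point n (a : 'rV[R]_n) (D : set 'rV[R]_n) (f g : 'rV[R]_n -> \bar R) :
  (0 < n)%N -> measurable D -> measurable_fun D f -> measurable_fun D g ->
  (forall x, D x -> (0 <= f x)%E) -> (forall x, D x -> (0 <= g x)%E) ->
  (forall x, D x -> x != a -> f x = g x) ->
  (\int[lebesgue_rV n]_(x in D) f x = \int[lebesgue_rV n]_(x in D) g x)%E.
Proof.
move=> n0 mD mf mg f0 g0 fg.
rewrite (ge0_negligible_integral (measurable_set1_rV _ a) mD mf f0 (lebesgue_rV_set1 _ _ n0)).
rewrite (ge0_negligible_integral (measurable_set1_rV _ a) mD mg g0 (lebesgue_rV_set1 _ _ n0)).
by apply: eq_integral => x; rewrite inE => -[Dx /eqP xa]; exact: fg.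
Qed.

End inversion_measure.

(** * Change of variables under an inversion *)

Section inversion_formula.
Context {R : realType} {n : nat}.
Hypothesis n0 : (0 < n)%N.
Local Notation mu := (lebesgue_rV n).
Local Notation leb := (@lebesgue_measure R).

(** Density of the dilation-invariant measure [ds / s] on the positive half-line, extended by
    zero. *)
Local Definition wgt (s : R) : R := if 0 < s then s^-1 else 0.
(** What matters is the invariance under [s -> 1/s] and a finite positive mass for [ds / s]. *)
Local Definition bump (s : R) : R := \1_(`[2^-1, 2]%classic : set R) s.

Let wgt_ge0 s : 0 <= wgt s.
Proof. by rewrite /wgt; case: ifPn => // s0; rewrite invr_ge0 ltW. Qed.

Let bump_ge0 s : 0 <= bump s.
Proof. by rewrite /bump indicE. Qed.

Let bumpV s : bump s^-1 = bump s.
Proof.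
rewrite /bump !indicE; congr (_%:R); congr nat_of_bool.
have e1 : 0 < s -> (2^-1 <= s^-1) = (s <= 2) by move=> s0; rewrite lef_pV2 ?posrE.
have e2 : 0 < s -> (s^-1 <= 2) = (2^-1 <= s) by move=> s0; rewrite invf_ple ?posrE.
have h0 : 0 < 2^-1 :> R by rewrite invr_gt0.
apply/idP/idP; rewrite !inE/= !in_itv/= => /andP[h1 h2].
  have s0 : 0 < s by rewrite -invr_gt0 (lt_le_trans h0).
  by rewrite -e1// -e2// h1 h2.
have s0 : 0 < s by rewrite (lt_le_trans h0).
by rewrite e1// e2// h1 h2.
Qed.

Let mwgt : measurable_fun [set: R] wgt.
Proof.
apply: measurable_fun_ifT => //; first exact: measurable_fun_ltr.
exact: measurable_invr.
Qed.

Let mbump : measurable_fun [set: R] bump.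
Proof. exact: measurable_indic. Qed.

Local Open Scope ereal_scope.

Let wgt_scale (a : R) (chi : R -> \bar R) : (0 < a)%R -> measurable_fun setT chi ->
  (forall s, 0 <= chi s) ->
  \int[leb]_s ((wgt s)%:E * chi (s * a)%R) = \int[leb]_s ((wgt s)%:E * chi s).
Proof.
move=> a0 mchi chi0.
rewrite -(lebesgue_affine _ 0 (fun s => (wgt s)%:E * chi s) a0); last 2 first.
- by apply: emeasurable_funM => //; exact/measurable_EFinP.
- by move=> s; rewrite mule_ge0// lee_fin.
rewrite -ge0_integralZl//; last 3 first.
- have maff : measurable_fun [set: R] (fun x : R => a * x + 0)%R.
    by apply: measurable_funD => //; exact: measurable_funM.
  apply: emeasurable_funM; last exact: (measurableT_comp mchi maff).
  by apply/measurable_EFinP; exact: (measurableT_comp mwgt maff).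
- by move=> s _; rewrite mule_ge0// lee_fin.
- by rewrite lee_fin ltW.
apply: eq_integral => s _; rewrite addr0 (mulrC a) muleA -EFinM; congr (_%:E * _).
rewrite /wgt pmulr_lgt0//; case: ifPn => s0; last by rewrite mulr0.
by field; rewrite !lt0r_neq0.
Qed.

(** The value is [ln 4], but the averaging argument asks only that it can be cancelled, hence
    positivity and finiteness below. *)
Let c := \int[leb]_s (wgt s * bump s)%:E.

Let c_gt0 : 0 < c.
Proof.
have -> : c = \int[leb]_(s in `[(2^-1)%R, 2%R]) (s^-1)%:E.
  rewrite integral_mkcond; apply: eq_integral => s _.
  rewrite /bump indicE patchE; case: ifPn => si; last by rewrite mulr0.
  rewrite mulr1 /wgt ifT//; move: si; rewrite inE/= in_itv/= => /andP[h1 _].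
  by rewrite (lt_le_trans _ h1)// invr_gt0.
apply: (@lt_le_trans _ _ (\int[leb]_(s in `[(2^-1)%R, 2%R]) cst (2^-1)%:E s)).
  rewrite integral_cst//= lebesgue_measure_itv/= lte_fin.
  have -> : (2^-1 < 2 :> R)%R by lra.
  by rewrite -EFinD -EFinM lte_fin; lra.
apply: ge0_le_integral => //.
- by move=> s _; rewrite lee_fin.
- by apply/measurable_EFinP; apply: measurable_funS measurable_invr.
- move=> s /=; rewrite in_itv/= => /andP[h1 h2]; rewrite lee_fin.
  by rewrite lef_pV2 ?posrE//; lra.
Qed.

Let c_fin : c \is a fin_num.
Proof.
rewrite ge0_fin_numE; last by rewrite ltW// c_gt0.
apply: (@le_lt_trans _ _ (\int[leb]_(s in `[(2^-1)%R, 2%R]) cst 2%:E s)); last first.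
  rewrite integral_cst//= lebesgue_measure_itv/=; case: ifPn => _.
    by rewrite -EFinD -EFinM ltry.
  by rewrite mule0 ltry.
rewrite [leRHS]integral_mkcond; apply: ge0_le_integral => //.
- by move=> s _; rewrite lee_fin mulr_ge0.
- by apply/measurable_EFinP; exact: measurable_funM.
- by apply/(measurable_restrictT _ _).1.
- move=> s _; rewrite /bump indicE patchE; case: ifPn => si; last by rewrite mulr0.
  rewrite mulr1 lee_fin /wgt; case: ifPn => // s0.
  move: si; rewrite inE/= in_itv/= => /andP[h1 h2].
  by rewrite invf_ple ?posrE.
Qed.

Let measurable_enormXn : measurable_fun [set: 'rV[R]_n] (fun x => (enorm x ^- n)%:E).
Proof.
apply/measurable_EFinP; apply: (measurableT_comp measurable_invr).
apply: measurable_funX; exact: measurable_enorm.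
Qed.

Let haar_scale (a : R) (phi : 'rV[R]_n -> \bar R) : (0 < a)%R ->
  measurable_fun setT phi -> (forall x, 0 <= phi x) ->
  \int[mu]_x ((enorm x ^- n)%:E * phi (a *: x)%R) =
  \int[mu]_x ((enorm x ^- n)%:E * phi x).
Proof.
move=> a0 mphi phi0.
have q0 (x : 'rV[R]_n) : 0 <= (enorm x ^- n)%:E.
  by rewrite lee_fin invr_ge0 exprn_ge0// enorm_ge0.
have mZ : measurable_fun setT (fun x : 'rV[R]_n => a *: x)%R.
  apply/measurable_fun_rVP => i; under eq_fun do rewrite mxE.
  by apply: measurable_funM => //; exact: measurable_coor.
rewrite -(lebesgue_rV_scale _ a (fun x => (enorm x ^- n)%:E * phi x) a0); last 2 first.
- exact: emeasurable_funM.
- by move=> x; rewrite mule_ge0.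
rewrite -ge0_integralZl//; last 3 first.
- apply: emeasurable_funM; last exact: (measurableT_comp mphi mZ).
  exact: (measurableT_comp measurable_enormXn mZ).
- by move=> x _; rewrite mule_ge0.
- by rewrite lee_fin exprn_ge0// ltW.
apply: eq_integral => x _; rewrite muleA -EFinM; congr (_%:E * _).
rewrite enormZ gtr0_norm// exprMn invfM mulrA divff ?mul1r//.
by rewrite expf_neq0// lt0r_neq0.
Qed.

(* Averaging over dilations: the measure [|x|^-n dx] is dilation invariant, and
   inserting [\int bump (s|x|) ds/s], which is independent of [x], symmetrizes
   the integrand along rays; the inversion then becomes [s |-> 1/s]. *)
Let haar_inversion (phi : 'rV[R]_n -> \bar R) :
  measurable_fun setT phi -> (forall x, 0 <= phi x) ->
  \int[mu]_x ((enorm x ^- n)%:E * phi (inversion 1 x)) =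
  \int[mu]_x ((enorm x ^- n)%:E * phi x).
Proof.
move=> mphi phi0.
pose q (x : 'rV[R]_n) := (enorm x ^- n)%:E.
have q0 x : 0 <= q x by rewrite lee_fin invr_ge0 exprn_ge0// enorm_ge0.
have mq1 : measurable_fun setT q by [].
pose T := (measurableTypeR R * 'rV[R]_n)%type.
have mq : measurable_fun [set: T] (fun z => q z.2).
  exact: (measurableT_comp measurable_enormXn measurable_snd).
have mw : measurable_fun [set: T] (fun z => (wgt z.1)%:E).
  by apply/measurable_EFinP; exact: (measurableT_comp mwgt measurable_fst).
have me : measurable_fun [set: T] (fun z => enorm z.2).
  exact: (measurableT_comp (measurable_enorm n) measurable_snd).
have mb (f : T -> R) : measurable_fun setT f -> measurable_fun setT (fun z => (bump (f z))%:E).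
  by move=> mf; apply/measurable_EFinP; exact: (measurableT_comp mbump mf).
have mV : measurable_fun [set: T] (fun z => z.1^-1)%R.
  exact: (measurableT_comp measurable_invr measurable_fst).
have mbE f : measurable_fun setT f ->
    measurable_fun [set: T] (fun z => q z.2 * f z.2).
  by move=> mf; apply: emeasurable_funM => //; exact: (measurableT_comp mf measurable_snd).
(* At fixed [x] the mean of [bump (g s (enorm x))] against [ds / s] is the constant [c], so Tonelli
   can insert it. The point [x = 0] contributes nothing, [q 0] being [0] by the convention on
   inverses. *)
have E0 (f : 'rV[R]_n -> \bar R) (g : R -> R -> R) :
    measurable_fun setT f -> (forall x, 0 <= f x) ->
    measurable_fun [set: T] (fun z => g z.1 (enorm z.2)) ->
    (forall r, (0 < r)%R -> \int[leb]_s ((wgt s)%:E * (bump (g s r))%:E) = c) ->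
    c * \int[mu]_x (q x * f x) =
    \int[leb]_s ((wgt s)%:E * \int[mu]_x (q x * (f x * (bump (g s (enorm x)))%:E))).
  move=> mf f0 mg gE.
  have mgb := mb _ mg.
  have -> : \int[leb]_s ((wgt s)%:E * \int[mu]_x (q x * (f x * (bump (g s (enorm x)))%:E)))
     = \int[leb]_s (\int[mu]_x ((wgt s)%:E * (q x * (f x * (bump (g s (enorm x)))%:E)))).
    apply: eq_integral => s _; rewrite ge0_integralZl//.
    - apply: emeasurable_funM => //; apply: emeasurable_funM => //.
      exact: (measurableT_comp mgb (measurable_pair1 s)).
    - by move=> x _; rewrite mule_ge0// mule_ge0// lee_fin.
    - by rewrite lee_fin.
  rewrite (fubini_tonelli (m1 := leb) (m2 := mu)
    (fun z => (wgt z.1)%:E * (q z.2 * (f z.2 * (bump (g z.1 (enorm z.2)))%:E)))); last 2 first.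
  - apply: emeasurable_funM => //; apply: emeasurable_funM => //.
    apply: emeasurable_funM => //; exact: (measurableT_comp mf measurable_snd).
  - by move=> z; rewrite mule_ge0 ?lee_fin// mule_ge0// mule_ge0// lee_fin.
  rewrite -ge0_integralZl//; last 3 first.
  - by apply: emeasurable_funM.
  - by move=> x _; rewrite mule_ge0.
  - by rewrite ltW// c_gt0.
  apply: eq_integral => x _ /=.
  have [->|x0] := eqVneq x 0%R.
    have -> : q 0%R = 0 by rewrite /q enorm0 expr0n gtn_eqF// invr0.
    rewrite mul0e mule0; apply/esym/integral0_eq => s _; by rewrite !mul0e mule0.
  rewrite -(gE (enorm x)) ?enorm_gt0//.
  rewrite muleC -ge0_integralZl//; last 3 first.
  - apply: emeasurable_funM; first exact/measurable_EFinP.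
    exact: (measurableT_comp mgb (measurable_pair2 x)).
  - by move=> s _; rewrite mule_ge0 ?lee_fin.
  - by rewrite mule_ge0.
  by apply: eq_integral => s _; rewrite muleA [RHS]muleA [in RHS]muleA (muleC _ (wgt s)%:E) !muleA.
have bump_mul r : (0 < r)%R -> \int[leb]_s ((wgt s)%:E * (bump (s * r))%:E) = c.
  move=> r0; rewrite (wgt_scale r (fun s => (bump s)%:E))//.
  exact/measurable_EFinP.
have bump_div r : (0 < r)%R -> \int[leb]_s ((wgt s)%:E * (bump (s^-1 * r))%:E) = c.
  move=> r0; rewrite -(bump_mul r^-1%R) ?invr_gt0//.
  by apply: eq_integral => s _; rewrite -bumpV invfM invrK.
have swap (f g : R -> 'rV[R]_n -> \bar R) :
    measurable_fun [set: T] (fun z => f z.1 z.2) ->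
    measurable_fun [set: T] (fun z => g z.1 z.2) ->
    (forall s x, 0 <= f s x) -> (forall s x, 0 <= g s x) ->
    (forall x, x != 0%R -> \int[leb]_s ((wgt s)%:E * f s x) =
        \int[leb]_s ((wgt s)%:E * g s x)) ->
    \int[leb]_s ((wgt s)%:E * \int[mu]_x (q x * (f s x * (bump (enorm x))%:E))) =
    \int[leb]_s ((wgt s)%:E * \int[mu]_x (q x * (g s x * (bump (enorm x))%:E))).
  have E1 (f' : R -> 'rV[R]_n -> \bar R) :
    measurable_fun [set: T] (fun z => f' z.1 z.2) ->
    (forall s x, 0 <= f' s x) ->
    \int[leb]_s ((wgt s)%:E * \int[mu]_x (q x * (f' s x * (bump (enorm x))%:E))) =
    \int[mu]_x (q x * (bump (enorm x))%:E * \int[leb]_s ((wgt s)%:E * f' s x)).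
    move=> mf f0.
    have mgb := mb _ me.
    have mbe : measurable_fun [set: 'rV[R]_n] (fun x => (bump (enorm x))%:E).
      apply/measurable_EFinP; exact: (measurableT_comp mbump (measurable_enorm n)).
    have -> : \int[leb]_s ((wgt s)%:E * \int[mu]_x (q x * (f' s x * (bump (enorm x))%:E)))
      = \int[leb]_s (\int[mu]_x ((wgt s)%:E * (q x * (f' s x * (bump (enorm x))%:E)))).
      apply: eq_integral => s _; rewrite ge0_integralZl//.
      - apply: emeasurable_funM => //; apply: emeasurable_funM => //.
        exact: (measurableT_comp mf (measurable_pair1 s)).
      - by move=> x _; rewrite mule_ge0// mule_ge0// lee_fin.
      - by rewrite lee_fin.
    rewrite (fubini_tonelli (m1 := leb) (m2 := mu)
      (fun z => (wgt z.1)%:E * (q z.2 * (f' z.1 z.2 * (bump (enorm z.2))%:E)))); last 2 first.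
    - apply: emeasurable_funM => //; apply: emeasurable_funM => //.
      exact: emeasurable_funM.
    - by move=> z; rewrite mule_ge0 ?lee_fin// mule_ge0// mule_ge0// lee_fin.
    apply: eq_integral => x _ /=.
    rewrite -ge0_integralZl//; last 3 first.
    - apply: emeasurable_funM; first exact/measurable_EFinP.
      exact: (measurableT_comp mf (measurable_pair2 x)).
    - by move=> s _; rewrite mule_ge0 ?lee_fin.
    - by rewrite mule_ge0// lee_fin.
    apply: eq_integral => s _.
    by rewrite [in RHS]muleC -[RHS]muleA; congr (_ * _); rewrite [RHS]muleC -muleA [in RHS](muleC _ (f' s x)).
  move=> mf mg f0 g0 fg; rewrite (E1 f mf f0) (E1 g mg g0); apply: eq_integral => x _.
  have [->|x0] := eqVneq x 0%R; last by rewrite fg.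
  have -> : q 0%R = 0 by rewrite /q enorm0 expr0n gtn_eqF// invr0.
  by rewrite !mul0e.
have minv := measurableT_comp mphi (measurable_inversion n 1).
have cc : c * \int[mu]_x (q x * phi (inversion 1 x)) = c * \int[mu]_x (q x * phi x).
  have mdiv : measurable_fun [set: T] (fun z => z.1^-1 * enorm z.2)%R.
    exact: measurable_funM.
  have mmul : measurable_fun [set: T] (fun z => z.1 * enorm z.2)%R.
    by apply: measurable_funM => //; exact: measurable_fst.
  (* The bump takes [s^-1] on one side and [s] on the other, so that the substitutions [x -> s *: x]
     and [x -> s^-1 *: x] leave the same factor [bump (enorm x)] on both. *)
  have e1 := E0 (phi \o inversion 1) (fun s r => s^-1 * r)%R minv (fun x => phi0 _)
    mdiv bump_div.
  have e2 := E0 phi (fun s r => s * r)%R mphi phi0 mmul bump_mul.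
  apply: (etrans e1); apply/esym/(etrans e2)/esym.
  transitivity (\int[leb]_s ((wgt s)%:E * \int[mu]_x
      (q x * (phi (inversion 1 (s *: x)) * (bump (enorm x))%:E)))).
    apply: eq_integral => s _; have [s0|s0] := ltP 0%R s; last first.
      by rewrite /wgt ltNge s0 !mul0e.
    congr (_ * _); rewrite -(haar_scale s (fun x => phi (inversion 1 x) * _)) //.
    - apply: eq_integral => x _; congr (_ * (_ * (bump _)%:E)).
      by rewrite enormZ gtr0_norm// mulrA mulVf ?mul1r// lt0r_neq0.
    - apply: emeasurable_funM => //; apply/measurable_EFinP; apply: (measurableT_comp mbump).
      by apply: measurable_funM => //; exact: measurable_enorm.
    - by move=> x; rewrite mule_ge0// lee_fin.
  transitivity (\int[leb]_s ((wgt s)%:E * \int[mu]_x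
      (q x * (phi (s^-1 *: x) * (bump (enorm x))%:E)))); last first.
    apply: eq_integral => s _; have [s0|s0] := ltP 0%R s; last first.
      by rewrite /wgt ltNge s0 !mul0e.
    congr (_ * _); rewrite -(haar_scale s^-1 (fun x => phi x * _)) ?invr_gt0//.
    - apply: eq_integral => x _; congr (_ * (_ * (bump _)%:E)).
      by rewrite enormZ gtr0_norm ?invr_gt0// mulrA mulfV ?mul1r// lt0r_neq0.
    - apply: emeasurable_funM => //; apply/measurable_EFinP; apply: (measurableT_comp mbump).
      by apply: measurable_funM => //; exact: measurable_enorm.
    - by move=> x; rewrite mule_ge0// lee_fin.
  have mZV : measurable_fun [set: T] (fun z => z.1^-1 *: z.2)%R.
    have mp : measurable_fun [set: T] (fun z : T => ((z.1^-1)%R, z.2) : T).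
      by apply/measurable_fun_pair => //; exact: measurable_snd.
    exact: (measurableT_comp (measurable_scalev n) mp).
  apply: swap => //.
  - exact: (measurableT_comp minv (measurable_scalev n)).
  - exact: (measurableT_comp mphi mZV).
  - move=> x x0.
    have ex : (0 < enorm x ^+ 2)%R by rewrite exprn_gt0// enorm_gt0.
    (* Since [inversion 1 (s *: x) = (s * enorm x ^+ 2)^-1 *: x], the substitution
       [s -> s * enorm x ^+ 2] identifies the two integrals. *)
    rewrite -[RHS](wgt_scale (enorm x ^+ 2) (fun s => phi (s^-1 *: x)%R))//.
      apply: eq_integral => s _; have [s0|s0] := ltP 0%R s; last first.
        by rewrite /wgt ltNge s0 !mul0e.
      congr (_ * phi _); rewrite /inversion enormZ scalerA gtr0_norm//; congr (_ *: _)%R.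
      by field; rewrite enorm_eq0 x0 lt0r_neq0.
    exact: (measurableT_comp mphi (measurableT_comp mZV (measurable_pair2 x))).
move: cc; rewrite -(fineK c_fin) => /(congr1 (fun z => (fine c)^-1%:E * z)).
have fc0 : fine c != 0%R by rewrite gt_eqF// fine_gt0// c_gt0 -ge0_fin_numE// ltW.
by rewrite !muleA -!EFinM mulVf// !mul1e.
Qed.

(** Writing [dx] as [|x|^n] times the inversion-invariant measure [|x|^-n dx] handles radius [1],
    where [|x|^n] turns into [|x|^-n]; a dilation by [l ^+ 2] gives radius [l]. *)
Theorem lebesgue_rV_inversion (l : R) (g : 'rV[R]_n -> \bar R) : (0 < l)%R ->
  measurable_fun setT g -> (forall x, 0 <= g x) ->
  \int[mu]_x g x =
  \int[mu]_x (((l / enorm x) ^+ (2 * n))%:E * g (inversion l x)).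
Proof.
move=> l0 mg g0.
have mZ : measurable_fun setT (fun x : 'rV[R]_n => l ^+ 2 *: x)%R.
  apply/measurable_fun_rVP => i; under eq_fun do rewrite mxE.
  by apply: measurable_funM => //; exact: measurable_coor.
pose g' x := g (l ^+ 2 *: x)%R.
have mg' : measurable_fun setT g' by exact: (measurableT_comp mg mZ).
have me (k : nat) : measurable_fun [set: 'rV[R]_n] (fun x => (enorm x ^+ k)%:E).
  by apply/measurable_EFinP; apply: measurable_funX; exact: measurable_enorm.
have e0 (k : nat) (x : 'rV[R]_n) : 0 <= (enorm x ^+ k)%:E.
  by rewrite lee_fin exprn_ge0// enorm_ge0.
rewrite -(lebesgue_rV_scale _ (l ^+ 2) g) ?exprn_gt0// -exprM.
have -> : \int[mu]_x g (l ^+ 2 *: x)%R =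
    \int[mu]_x ((enorm x ^- n)%:E * ((enorm x ^+ n)%:E * g' x)).
  apply: (@eq_integral_off_point _ _ 0%R) => //.
  - by apply: emeasurable_funM => //; exact: emeasurable_funM.
  - by move=> x _; rewrite mule_ge0 ?lee_fin ?invr_ge0 ?exprn_ge0 ?enorm_ge0// mule_ge0// g0.
  - move=> x _ x0; rewrite muleA -EFinM mulVf ?mul1e//.
    by rewrite expf_neq0// enorm_eq0.
rewrite -(haar_inversion (fun x => (enorm x ^+ n)%:E * g' x)); last 2 first.
- exact: emeasurable_funM.
- by move=> x; rewrite mule_ge0// g0.
rewrite -ge0_integralZl//; last 3 first.
- apply: emeasurable_funM => //.
  exact: (measurableT_comp (emeasurable_funM (me n) mg') (measurable_inversion n 1)).
- by move=> x _; rewrite mule_ge0 ?lee_fin ?invr_ge0 ?exprn_ge0 ?enorm_ge0// mule_ge0// g0.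
- by rewrite lee_fin exprn_ge0// ltW.
apply: eq_integral => x _; rewrite !muleA -!EFinM /g'.
have -> : (l ^+ 2 *: inversion 1 x = inversion l x)%R.
  by rewrite /inversion scalerA -exprMn mulrA mulr1.
congr (_%:E * _).
by rewrite enorm_inversion !expr_div_n !expr1n mul1r -mulrA -invfM -exprD addnn mul2n.
Qed.

End inversion_formula.

(** * The kernel and Kelvin transforms *)

Set Implicit Arguments.
Unset Strict Implicit.

Section kernel.
Context {R : realType} {n : nat}.
Implicit Types (y z : 'rV[R]_n) (l : R).

(* [rdist l y z] is the distance from [z] to the inverse of [y], normalized so
   as to be symmetric in [y] and [z]. *)
Definition rdist l y z : R := enorm y / l * enorm (inversion l y - z).

Lemma rdist_ge0 l y z : 0 <= l -> 0 <= rdist l y z.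
Proof. by move=> l0; rewrite mulr_ge0 ?divr_ge0 ?enorm_ge0. Qed.

(** The correction is the product of the powers of [y] and [z] with respect to the sphere, over
    [l ^+ 2]. It yields both the symmetry of [rdist] and its comparison with the distance when both
    points lie outside. *)
Lemma sqr_rdist l y z : 0 < l -> y != 0 -> rdist l y z ^+ 2 =
  enorm (y - z) ^+ 2 + (enorm y ^+ 2 - l ^+ 2) * (enorm z ^+ 2 - l ^+ 2) / l ^+ 2.
Proof.
move=> l0 y0; rewrite /rdist exprMn !sqr_enormB enorm_inversion dotvZl.
by field; rewrite enorm_eq0 y0 lt0r_neq0.
Qed.

Lemma rdistC l y z : 0 < l -> y != 0 -> z != 0 -> rdist l y z = rdist l z y.
Proof.
move=> l0 y0 z0; apply/eqP; rewrite -(@eqrXn2 _ 2)// ?rdist_ge0 ?ltW//.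
by rewrite !sqr_rdist// enormBC [X in _ + X / _]mulrC.
Qed.

Lemma le_enorm_rdist l y z : 0 < l -> l <= enorm y -> l <= enorm z ->
  enorm (y - z) <= rdist l y z.
Proof.
move=> l0 ly lz; have y0 : y != 0 by rewrite -enorm_gt0 (lt_le_trans l0).
rewrite -(@ler_pXn2r _ 2)// ?nnegrE ?enorm_ge0//; last exact: rdist_ge0 (ltW l0).
rewrite sqr_rdist// lerDl divr_ge0 ?sqr_ge0// mulr_ge0// subr_ge0.
  by rewrite ler_pXn2r// ?nnegrE ?enorm_ge0 ?ltW.
by rewrite ler_pXn2r// ?nnegrE ?enorm_ge0 ?ltW.
Qed.

Lemma enorm_sub_inversion l y z : 0 < l -> y != 0 -> z != 0 ->
  enorm (y - inversion l z) = l / enorm z * rdist l y z.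
Proof.
move=> l0 y0 z0; rewrite rdistC// /rdist enormBC mulrA.
rewrite [X in X * _](_ : _ = 1) ?mul1r//.
by field; rewrite enorm_eq0 z0 lt0r_neq0.
Qed.

Lemma rdist_inversion l y z : 0 < l -> y != 0 -> z != 0 ->
  rdist l y (inversion l z) = l / enorm z * enorm (y - z).
Proof.
move=> l0 y0 z0; rewrite /rdist enorm_inversionB ?ltW//.
by field; rewrite !enorm_eq0 y0 z0 lt0r_neq0.
Qed.

Lemma powR_div (a b r : R) : 0 <= a -> 0 <= b -> (a / b) `^ r = a `^ r / b `^ r.
Proof.
move=> a0 b0; rewrite powRM ?invr_ge0//; congr (_ * _).
by rewrite -(powR_inv1 b0) -powRrM mulN1r powRN.
Qed.

Lemma powR_le (a b r : R) : 0 <= r -> 0 <= a -> a <= b -> a `^ r <= b `^ r.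
Proof. by move=> r0 a0 ab; rewrite ge0_ler_powR ?nnegrE// (le_trans a0). Qed.

(** For [s > 1/2] this is [exp t >= 1 + t] with [- ln s <= 1/s - 1 <= 2 (1 - s)]; for [s <= 1/2] the
    right side is at least [1]. With its counterpart below it makes [1 - s^q] comparable to
    [1 - s]. *)
Lemma one_sub_powR_le (q s : R) : 0 < q -> 0 <= s -> s <= 1 ->
  1 - s `^ q <= 2 * (1 + q) * (1 - s).
Proof.
move=> q0 s0 s1; have [s2|s2] := leP s 2^-1.
  have := powR_ge0 s q; nra.
have sp : 0 < s by apply: lt_trans s2; rewrite invr_gt0.
rewrite /powR gt_eqF//.
have h1 := expR_ge1Dx (q * ln s).
have h3 : s * s^-1 = 1 by rewrite mulfV// gt_eqF.
have h4 : 0 < s^-1 by rewrite invr_gt0.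
have h5 : - ln s <= s^-1 - 1 by have := @le_ln1Dx R (s^-1 - 1); rewrite subrKC lnV ?posrE//; apply; lra.
have h6 : s^-1 - 1 <= 2 * (1 - s).
  have h7 : s^-1 <= 2 by rewrite invf_ple ?posrE// ltW.
  have -> : s^-1 - 1 = s^-1 * (1 - s) by rewrite mulrBr mulr1 mulrC h3.
  by rewrite ler_wpM2r// subr_ge0.
have h8 : q * (- ln s) <= q * (2 * (1 - s)).
  by rewrite ler_pM2l//; lra.
lra.
Qed.

(** The bound [exp t >= 1 + t], now applied to [s^-q], gives [s^q (1 + q (1 - s)) <= 1]. *)
Lemma one_sub_powR_ge (q s : R) : 0 < q -> 0 <= s -> s <= 1 ->
  q / (1 + q) * (1 - s) <= 1 - s `^ q.
Proof.
move=> q0 s0 s1.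
have H : s `^ q * (1 + q * (1 - s)) <= 1.
  have [->|sn0] := eqVneq s 0; first by rewrite powR0 ?gt_eqF// mul0r.
  have sp : 0 < s by rewrite lt0r sn0.
  rewrite /powR gt_eqF//.
  have h5 : ln s <= s - 1 by have := @le_ln1Dx R (s - 1); rewrite subrKC; apply; lra.
  have h1 := expR_ge1Dx (- (q * ln s)).
  have h2 : expR (q * ln s) * expR (- (q * ln s)) = 1 by rewrite -expRD subrr expR0.
  have h3 := expR_gt0 (q * ln s).
  rewrite -[leRHS]h2 ler_pM2l// (le_trans _ h1)// -mulrN lerD2l ler_pM2l//; lra.
have h := powR_ge0 s q.
rewrite mulrAC ler_pdivrMr; last lra.
have P1 : s `^ q <= 1.
  by rewrite (le_trans _ H)// ler_peMr// lerDl mulr_ge0 ?subr_ge0// ltW.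
have : 0 <= (1 - s `^ q) * (q * s) by rewrite !mulr_ge0 ?subr_ge0// ltW.
lra.
Qed.

Variable m : R.
Hypothesis m0 : 0 < m.

Definition ker1 y z : R := (enorm (y - z) `^ m)^-1.
Definition ker2 l y z : R := (rdist l y z `^ m)^-1.
(** Truncation at [0] keeps every integral nonnegative. When [y] and [z] are outside the sphere
    nothing is cut off, except at [z = y], where [ker1] is [0] by convention. *)
Definition kerd l y z : R := Num.max 0 (ker1 y z - ker2 l y z).

Lemma ker1_ge0 y z : 0 <= ker1 y z.
Proof. by rewrite invr_ge0 powR_ge0. Qed.

Lemma ker2_ge0 l y z : 0 <= ker2 l y z.
Proof. by rewrite invr_ge0 powR_ge0. Qed.

Lemma kerd_ge0 l y z : 0 <= kerd l y z.
Proof. by rewrite le_max lexx. Qed.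

Lemma kerd_le_ker1 l y z : kerd l y z <= ker1 y z.
Proof. by rewrite ge_max ker1_ge0 lerBlDr lerDl ker2_ge0. Qed.

Lemma ker1E l y z : 0 < l -> l <= enorm y -> l <= enorm z -> z != y ->
  ker1 y z = ker2 l y z + kerd l y z.
Proof.
move=> l0 ly lz zy.
rewrite /kerd max_r ?subrKC// ?[X in X + _]addrC ?subrK//.
have yz : 0 < enorm (y - z) by rewrite enorm_gt0 subr_eq0 eq_sym.
have yr := le_enorm_rdist l0 ly lz.
rewrite subr_ge0 lef_pV2 ?posrE ?powR_gt0 ?(lt_le_trans yz)//.
exact: (powR_le (ltW m0) (ltW yz)).
Qed.

Lemma scale_ker1_inversion l y z : 0 < l -> y != 0 ->
  (l / enorm y) `^ m * ker1 (inversion l y) z = ker2 l y z.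
Proof.
move=> l0 y0; rewrite /ker1 /ker2 /rdist.
rewrite [in RHS]powRM ?divr_ge0 ?enorm_ge0 ?(ltW l0)// invfM; congr (_ * _); rewrite -powRN; apply/eqP.
by rewrite -{1}[l / enorm y]invf_div -(powR_inv1 (divr_ge0 (enorm_ge0 y) (ltW l0))) -powRrM mulN1r.
Qed.

(** Inverting the integration variable exchanges [ker1] and [ker2]; this lemma and the next are the
    two directions. Hence integrals over the inside of the sphere can be moved to the outside. *)
Lemma ker1_inversion l y z : 0 < l -> y != 0 -> z != 0 ->
  (l / enorm z) `^ m * ker1 y (inversion l z) = ker2 l y z.
Proof.
move=> l0 y0 z0; have d0 : 0 <= l / enorm z by rewrite divr_ge0 ?enorm_ge0 ?(ltW l0).
rewrite /ker1 /ker2 enorm_sub_inversion// (powRM _ d0); last exact: rdist_ge0 (ltW l0).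
rewrite invfM mulrA mulfV ?mul1r// gt_eqF// powR_gt0// divr_gt0// enorm_gt0//.
Qed.

Lemma ker2_inversion l y z : 0 < l -> y != 0 -> z != 0 ->
  (l / enorm z) `^ m * ker2 l y (inversion l z) = ker1 y z.
Proof.
move=> l0 y0 z0; have d0 : 0 <= l / enorm z by rewrite divr_ge0 ?enorm_ge0 ?(ltW l0).
rewrite /ker1 /ker2 rdist_inversion// (powRM _ d0) ?enorm_ge0//.
rewrite invfM mulrA mulfV ?mul1r// gt_eqF// powR_gt0// divr_gt0// enorm_gt0//.
Qed.

Lemma measurable_ker1 y : measurable_fun [set: 'rV[R]_n] (ker1 y).
Proof.
apply: (measurableT_comp measurable_invr).
apply: (measurableT_comp (measurable_powR m)).
rewrite (_ : (fun z => enorm (y - z)) = (fun z => enorm (- y + z))).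
  exact: (measurableT_comp (measurable_enorm n) (measurable_addv n (- y))).
by apply/funext => z; rewrite enormBC addrC.
Qed.

Lemma measurable_ker2 l y : measurable_fun [set: 'rV[R]_n] (ker2 l y).
Proof.
apply: (measurableT_comp measurable_invr).
apply: (measurableT_comp (measurable_powR m)).
apply: measurable_funM => //.
rewrite (_ : (fun z => enorm (inversion l y - z)) = (fun z => enorm (- inversion l y + z))).
  exact: (measurableT_comp (measurable_enorm n) (measurable_addv n _)).
by apply/funext => z; rewrite enormBC addrC.
Qed.

Lemma measurable_kerd l y : measurable_fun [set: 'rV[R]_n] (kerd l y).
Proof.
apply: measurable_maxr => //; apply: measurable_funB.
  exact: measurable_ker1.
exact: measurable_ker2.
Qed.

Let q := m / 2.
Let q0 : 0 < q. Proof. by rewrite divr_gt0. Qed.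

(** This constant and the next have three factors: from comparing [enorm (y - z)] with [enorm z],
    from comparing [1 - s^q] with [1 - s] for [q = m / 2], and from the bounds [1/3] and [4] on the
    ratio that multiplies [1 - (l / enorm y) ^+ 2]. *)
Definition kerd_lb : R := (3 / 2) `^ (- m) * (q / (1 + q)) / 3.
Definition kerd_ub : R := (1 / 2) `^ (- m) * (2 * (1 + q)) * 4.

Lemma kerd_lb_gt0 : 0 < kerd_lb.
Proof.
by rewrite divr_gt0// mulr_gt0// ?powR_gt0// ?divr_gt0// addr_gt0.
Qed.

Lemma kerd_ub_gt0 : 0 < kerd_ub.
Proof.
by rewrite mulr_gt0// mulr_gt0// ?powR_gt0// ?mulr_gt0// ?addr_gt0// invr_gt0.
Qed.

(* Far from [y] the kernel decays like [|z|^-m], with the factor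
   [1 - (l/|y|)^2] describing its vanishing on the sphere [|y| = l]. *)
Lemma kerd_bounds l y z : 0 < l -> l <= enorm y -> 2 * enorm y <= enorm z ->
  kerd_lb * (1 - (l / enorm y) ^+ 2) * enorm z `^ (- m) <= kerd l y z /\
  kerd l y z <= kerd_ub * (1 - (l / enorm y) ^+ 2) * enorm z `^ (- m).
Proof.
move=> l0 ly yz.
have yp : 0 < enorm y by apply: lt_le_trans ly.
have y0 : y != 0 by rewrite -enorm_gt0.
have zp : 0 < enorm z by lra.
have lz : l <= enorm z by lra.
have zy : z != y by apply: contraTneq yz => ->; rewrite -ltNge; lra.
have a1 : enorm z / 2 <= enorm (y - z).
  by have := enorm_leB z y; rewrite enormBC; lra.
have a2 : enorm (y - z) <= 3 / 2 * enorm z by have := enormB_leD y z; lra.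
have ly2 : l ^+ 2 / enorm y <= l by rewrite ler_pdivrMr// expr2 ler_pM2l.
have b1 : enorm z / 2 <= enorm (inversion l y - z).
  have := enorm_leB z (inversion l y); rewrite enormBC enorm_inversion; lra.
have b2 : enorm (inversion l y - z) <= 3 / 2 * enorm z.
  have := enormB_leD (inversion l y) z; rewrite enorm_inversion; lra.
set k := 1 - (l / enorm y) ^+ 2.
have k0 : 0 <= k.
  have t1 : l / enorm y <= 1 by rewrite ler_pdivrMr// mul1r.
  have t0 : 0 <= l / enorm y by rewrite divr_ge0// ltW.
  rewrite subr_ge0; nra.
have dp : 0 < enorm (y - z) by lra.
have dr := le_enorm_rdist l0 ly lz.
have rp : 0 < rdist l y z by lra.
(* Squaring the ratio makes [1 - th] an exact multiple of [k] by [sqr_rdist]; the kernel difference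
   is then [ker1 y z * (1 - th^(m/2))]. *)
pose th := (enorm (y - z) / rdist l y z) ^+ 2.
have th0 : 0 <= th by exact: sqr_ge0.
have th1 : th <= 1.
  have t1 : enorm (y - z) / rdist l y z <= 1 by rewrite ler_pdivrMr// mul1r.
  have t0 : 0 <= enorm (y - z) / rdist l y z by rewrite divr_ge0// ltW.
  rewrite /th; nra.
have thE : 1 - th = k * ((enorm z ^+ 2 - l ^+ 2) / enorm (inversion l y - z) ^+ 2).
  have E : enorm (y - z) ^+ 2 = rdist l y z ^+ 2 -
     (enorm y ^+ 2 - l ^+ 2) * (enorm z ^+ 2 - l ^+ 2) / l ^+ 2.
    by rewrite sqr_rdist// addrK.
  rewrite /th expr_div_n E /k /rdist; field.
  by rewrite (lt0r_neq0 l0) (lt0r_neq0 yp) lt0r_neq0//; lra.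
(* From [l <= enorm z / 2] the numerator is at least [3/4] of [enorm z ^+ 2], and the denominator
   lies between [1/4] and [9/4] of it. *)
have t3 : 3^-1 <= (enorm z ^+ 2 - l ^+ 2) / enorm (inversion l y - z) ^+ 2.
  rewrite ler_pdivlMr ?exprn_gt0//; last lra.
  nra.
have t4 : (enorm z ^+ 2 - l ^+ 2) / enorm (inversion l y - z) ^+ 2 <= 4.
  rewrite ler_pdivrMr ?exprn_gt0//; last lra.
  nra.
have thm : th `^ q = (enorm (y - z) `^ m) / rdist l y z `^ m.
  have t0 : 0 <= enorm (y - z) / rdist l y z by rewrite divr_ge0// ltW.
  rewrite /th -powR_mulrn// -powRrM (_ : _ * q = m); last by rewrite /q mulrC divfK.
  by rewrite powR_div// ltW.
have K : kerd l y z = ker1 y z * (1 - th `^ q).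
  rewrite -[kerd l y z](addKr (ker2 l y z)) -ker1E// thm mulrBr mulr1 addrC.
  by congr (_ - _); rewrite /ker1 mulrA mulVf ?mul1r// gt_eqF// powR_gt0.
have u1 := one_sub_powR_le q0 th0 th1.
have u2 := one_sub_powR_ge q0 th0 th1.
have k1l : (3 / 2) `^ (- m) * enorm z `^ (- m) <= ker1 y z.
  rewrite -powRM ?enorm_ge0// powRN lef_pV2 ?posrE ?powR_gt0 ?mulr_gt0//.
  by rewrite (powR_le (ltW m0) (ltW dp)).
have k1u : ker1 y z <= (1 / 2) `^ (- m) * enorm z `^ (- m).
  rewrite -powRM ?enorm_ge0// powRN lef_pV2 ?posrE ?powR_gt0 ?mulr_gt0//.
  by apply: powR_le; [exact: ltW|rewrite mulr_ge0// enorm_ge0|lra].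
have zm := powR_ge0 (enorm z) (- m).
have c0 : 0 <= q / (1 + q) by rewrite divr_ge0 ?addr_ge0 ?ltW.
rewrite K; split.
- apply: (@le_trans _ _ ((3 / 2) `^ (- m) * enorm z `^ (- m) * (q / (1 + q) * (k / 3)))).
    by rewrite le_eqVlt; apply/orP; left; apply/eqP; rewrite /kerd_lb; ring.
  apply: ler_pM => //; first by rewrite mulr_ge0// powR_ge0.
    by rewrite mulr_ge0// divr_ge0.
  rewrite (le_trans _ u2)// ler_wpM2l// thE ler_wpM2l//.
- apply: (@le_trans _ _ ((1 / 2) `^ (- m) * enorm z `^ (- m) * (2 * (1 + q) * (k * 4)))); last first.
    by rewrite le_eqVlt; apply/orP; left; apply/eqP; rewrite /kerd_ub; ring.
  apply: ler_pM => //; first exact: ker1_ge0.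
    by rewrite (le_trans _ u2)// mulr_ge0// subr_ge0.
  rewrite (le_trans u1)// ler_wpM2l//; first by rewrite mulr_ge0// addr_ge0// ltW.
  by rewrite thE ler_wpM2l.
Qed.

End kernel.

(** * Volumes of balls *)

Section ball_volume.
Context {R : realType} {n : nat}.
Local Notation mu := (@lebesgue_rV R n).

Lemma measurable_enorm_lt (r : R) : measurable [set x : 'rV[R]_n | enorm x < r].
Proof.
rewrite -[X in measurable X]setTI.
rewrite (_ : [set x | _] = enorm @^-1` `]-oo, r[%classic).
  by apply: measurable_enorm => //; exact: measurable_itv.
by apply/seteqP; split => x /=; rewrite in_itv.
Qed.

Lemma measurable_enorm_le (r : R) : measurable [set x : 'rV[R]_n | enorm x <= r].
Proof.
rewrite -[X in measurable X]setTI.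
rewrite (_ : [set x | _] = enorm @^-1` `]-oo, r]%classic).
  by apply: measurable_enorm => //; exact: measurable_itv.
by apply/seteqP; split => x /=; rewrite in_itv.
Qed.

Lemma measurable_enorm_gt (r : R) : measurable [set x : 'rV[R]_n | r < enorm x].
Proof.
rewrite (_ : [set _ | _] = ~` [set x | enorm x <= r]).
  by apply: measurableC; exact: measurable_enorm_le.
by apply/seteqP; split => x /=; rewrite ltNge => /negP.
Qed.

Lemma measurable_enorm_ge (r : R) : measurable [set x : 'rV[R]_n | r <= enorm x].
Proof.
rewrite (_ : [set _ | _] = ~` [set x | enorm x < r]).
  by apply: measurableC; exact: measurable_enorm_lt.
by apply/seteqP; split => x /=; rewrite leNgt => /negP.
Qed.

Lemma measurable_enorm_ball (w : 'rV[R]_n) (r : R) :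
  measurable [set x : 'rV[R]_n | enorm (x - w) < r].
Proof. by apply: open_measurable_rV; exact: open_enorm_ball. Qed.

Lemma enorm_le_sum (x : 'rV[R]_n) : enorm x <= \sum_i `|x ord0 i|.
Proof.
have s0 : 0 <= \sum_i `|x ord0 i| by apply: sumr_ge0.
rewrite -(@ler_pXn2r _ 2)// ?nnegrE ?enorm_ge0// sqr_enorm expr2 mulr_suml.
apply: ler_sum => i _; rewrite -expr2 -real_normK ?num_real// expr2.
by rewrite ler_wpM2l// (bigD1 i)//= lerDl sumr_ge0.
Qed.

(** The cube of half-side [1 / (n + 1)] fits inside, since the absolute values of [n] such
    coordinates sum to less than [1]. *)
Lemma lebesgue_unit_ball_gt0 : (0 < mu [set x | (enorm x < 1)%R])%E.
Proof.
pose b : R := n.+1%:R^-1.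
have b0 : 0 < b by rewrite invr_gt0.
pose A (i : 'I_n) : set (measurableTypeR R) := `](- b), b[%classic.
have mA i : measurable (A i) by exact: measurable_itv.
have mB : measurable [set x : 'rV[R]_n | forall i, A i (x ord0 i)].
  rewrite (_ : [set _ | _] = \bigcap_(i in [set: 'I_n])
      ((fun x : 'rV[R]_n => x ord0 i) @^-1` A i)).
    apply: fin_bigcap_measurable => // i _.
    by rewrite -[X in measurable X]setTI; apply: measurable_coor => //; exact: mA.
  by apply/seteqP; split => x /= => [H i _|H i]; exact: H.
apply: (@lt_le_trans _ _ (mu [set x | forall i, A i (x ord0 i)])).
  rewrite lebesgue_rV_box// (eq_bigr (fun=> (b + b)%:E)); last first.
    by move=> i _; rewrite lebesgue_measure_itv/= lte_fin gtrN// -EFinD opprK.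
  by rewrite prodEFin lte_fin prodr_gt0// => i _; rewrite addr_gt0.
apply: le_measure; rewrite ?inE//; first exact: measurable_enorm_lt.
move=> x /= xA; apply: le_lt_trans (enorm_le_sum x) _.
apply: (@le_lt_trans _ _ (\sum_(i < n) b)).
  apply: ler_sum => i _; have := xA i; rewrite /A/= in_itv/= => /andP[h1 h2].
  by rewrite ler_norml !ltW.
rewrite sumr_const card_ord -mulr_natl /b ltr_pdivrMr// mul1r.
by rewrite ltr_nat.
Qed.

Lemma lebesgue_unit_ball_fin_num : mu [set x | enorm x < 1%R] \is a fin_num.
Proof.
rewrite ge0_fin_numE//.
pose A (i : 'I_n) : set (measurableTypeR R) := `]-1, 1[%classic.
have mA i : measurable (A i) by exact: measurable_itv.
have mB : measurable [set x : 'rV[R]_n | forall i, A i (x ord0 i)].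
  rewrite (_ : [set _ | _] = \bigcap_(i in [set: 'I_n])
      ((fun x : 'rV[R]_n => x ord0 i) @^-1` A i)).
    apply: fin_bigcap_measurable => // i _.
    by rewrite -[X in measurable X]setTI; apply: measurable_coor => //; exact: mA.
  by apply/seteqP; split => x /= => [H i _|H i]; exact: H.
apply: (@le_lt_trans _ _ (mu [set x | forall i, A i (x ord0 i)])).
  apply: le_measure; rewrite ?inE//; first exact: measurable_enorm_lt.
  move=> x /= x1 i; rewrite /A/= in_itv/= -ltr_norml.
  exact: le_lt_trans (normr_coor_le_enorm x i) x1.
rewrite lebesgue_rV_box//.
suff : (\prod_(i < n) lebesgue_measure (A i))%E \is a fin_num by rewrite fin_numElt => /andP[].
apply: prode_fin_num => i _; rewrite lebesgue_measure_itv/=.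
by case: ifPn => _ //; rewrite -EFinD.
Qed.

Definition ball_vol (r : R) : R := r ^+ n * fine (mu [set x | enorm x < 1%R]).

Lemma ball_vol_gt0 (r : R) : 0 < r -> 0 < ball_vol r.
Proof.
move=> r0; rewrite mulr_gt0 ?exprn_gt0// fine_gt0// lebesgue_unit_ball_gt0/=.
by rewrite -ge0_fin_numE// lebesgue_unit_ball_fin_num.
Qed.

Lemma lebesgue_ball (w : 'rV[R]_n) (r : R) : 0 < r ->
  mu [set x | enorm (x - w) < r] = (ball_vol r)%:E.
Proof.
move=> r0; rewrite EFinM fineK ?lebesgue_unit_ball_fin_num//.
have mi (r' : R) : measurable_fun setT (fun x : 'rV[R]_n => (\1_[set x | enorm x < r'] x)%:E : \bar R).
  by apply/measurable_EFinP/measurable_indic; exact: measurable_enorm_lt.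
have E (A : set 'rV[R]_n) : measurable A -> mu A = (\int[mu]_x (\1_A x)%:E)%E.
  by move=> mA; rewrite integral_indic// setIT.
rewrite [LHS]E ?[in RHS]E; [|exact: measurable_enorm_lt|exact: measurable_enorm_ball].
transitivity (\int[mu]_x (\1_[set x : 'rV[R]_n | enorm x < r] x)%:E)%E.
  rewrite -(lebesgue_rV_translate _ w)//; last first.
    by apply/measurable_EFinP/measurable_indic; exact: measurable_enorm_ball.
  apply: eq_integral => x _; rewrite !indicE; congr (_%:R%:E).
  by congr nat_of_bool; apply/idP/idP; rewrite !inE/= addrK.
rewrite -(lebesgue_rV_scale _ r)//.
congr (_ * _)%E; apply: eq_integral => x _; rewrite !indicE.
suff -> : (r *: x \in [set x0 | enorm x0 < r]) = (x \in [set x0 : 'rV[R]_n | enorm x0 < 1]) by [].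
apply/idP/idP; rewrite !inE/= enormZ gtr0_norm//.
  by rewrite -{2}[r]mulr1 ltr_pM2l.
by move=> x1; rewrite -{2}[r]mulr1 ltr_pM2l.
Qed.

End ball_volume.

Lemma enorm_inversion_le {R : realType} {n : nat} (l : R) (y : 'rV[R]_n) :
  0 < l -> l <= enorm y -> enorm (inversion l y) <= l.
Proof.
move=> l0 ly; have y0 : 0 < enorm y by apply: lt_le_trans ly.
by rewrite enorm_inversion ler_pdivrMr// expr2 ler_pM2l.
Qed.

Section ge0_real_integral.
Context {R : realType} {n : nat}.
Local Notation mu := (@lebesgue_rV R n).
Implicit Types (D : set 'rV[R]_n) (g : 'rV[R]_n -> R).

Let mE D g : measurable_fun setT g -> measurable_fun D (fun z => (g z)%:E : \bar R).
Proof. by move=> mg; apply: measurable_funTS; exact/measurable_EFinP. Qed.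

Lemma integralZl_real D g (c : R) :
  measurable D -> measurable_fun setT g -> (forall z, 0 <= g z) -> 0 <= c ->
  (\int[mu]_(z in D) (c * g z)%:E = c%:E * \int[mu]_(z in D) (g z)%:E)%E.
Proof.
move=> mD mg g0 c0; rewrite -ge0_integralZl ?lee_fin//; first exact: mE.
by move=> z _; rewrite lee_fin.
Qed.

Lemma integralD_real D g1 g2 : measurable D ->
  measurable_fun setT g1 -> measurable_fun setT g2 ->
  (forall z, 0 <= g1 z) -> (forall z, 0 <= g2 z) ->
  (\int[mu]_(z in D) (g1 z + g2 z)%:E =
   \int[mu]_(z in D) (g1 z)%:E + \int[mu]_(z in D) (g2 z)%:E)%E.
Proof.
move=> mD m1 m2 g10 g20; rewrite -ge0_integralD//.
- by move=> z _; rewrite lee_fin.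
- exact: mE.
- by move=> z _; rewrite lee_fin.
- exact: mE.
Qed.

Lemma le_integral_real D g1 g2 : measurable D ->
  measurable_fun setT g1 -> measurable_fun setT g2 ->
  (forall z, 0 <= g1 z) -> (forall z, D z -> g1 z <= g2 z) ->
  (\int[mu]_(z in D) (g1 z)%:E <= \int[mu]_(z in D) (g2 z)%:E)%E.
Proof.
move=> mD m1 m2 g10 g12; apply: ge0_le_integral => //.
- by move=> z _; rewrite lee_fin.
- exact: mE.
- exact: mE.
Qed.

Lemma subset_integral_real D1 D2 g : measurable D1 -> measurable D2 ->
  measurable_fun setT g -> (forall z, 0 <= g z) -> D1 `<=` D2 ->
  (\int[mu]_(z in D1) (g z)%:E <= \int[mu]_(z in D2) (g z)%:E)%E.
Proof.
move=> mD1 mD2 mg g0 D12; apply: ge0_subset_integral => //; first exact: mE.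
by move=> z _; rewrite lee_fin.
Qed.

Lemma integral_setU_real D1 D2 g : measurable D1 -> measurable D2 ->
  measurable_fun setT g -> (forall z, 0 <= g z) -> (forall z, D1 z -> ~ D2 z) ->
  (\int[mu]_(z in D1 `|` D2) (g z)%:E =
   \int[mu]_(z in D1) (g z)%:E + \int[mu]_(z in D2) (g z)%:E)%E.
Proof.
move=> mD1 mD2 mg g0 D12; rewrite ge0_integral_setU//; first exact: mE.
- by move=> z _; rewrite lee_fin.
- by apply/disj_setPS => z [/D12].
Qed.

Lemma integral_real_ge0 D g : (forall z, 0 <= g z) ->
  (0 <= \int[mu]_(z in D) (g z)%:E)%E.
Proof. by move=> g0; apply: integral_ge0 => z _; rewrite lee_fin. Qed.

End ge0_real_integral.

(** Finite totals force the four nonnegative terms to be finite, so that the shared part [a + b] can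
    be cancelled in the reals. *)
Lemma ereal_sum_cancel {R : realType} (a b i j : \bar R) (P Q : R) :
  (0 <= a)%E -> (0 <= b)%E -> (0 <= i)%E -> (0 <= j)%E ->
  (b + (a + j) = P%:E)%E -> (b + i + a = Q%:E)%E ->
  exists I J : R, [/\ i = I%:E, j = J%:E & Q - P = I - J].
Proof.
case: a => [a| |]//; case: b => [b| |]//; case: i => [i| |]//; case: j => [j| |]// _ _ _ _.
by rewrite -!EFinD => -[e1] [e2]; exists i, j; split => //; lra.
Qed.

(* The exponents for which the nonlinearity is invariant under inversions. *)
Definition critical_exponents {R : realType} (n : nat) (m p : R) : Prop :=
  m * p + m = (2 * n)%:R.

(** * The difference between a solution and its Kelvin transform *)

Section kelvin.
Context {R : realType} {n : nat}.
Hypothesis n0 : (0 < n)%N.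
Local Notation mu := (@lebesgue_rV R n).
Variables (m p : R).
Hypothesis m0 : 0 < m.
Hypothesis mp : critical_exponents n m p.
Variables (f : 'rV[R]_n -> R).
Hypothesis f0 : forall x, 0 <= f x.
Hypothesis mf : measurable_fun setT f.

(** The weight exponent is a parameter: [u] and [h] take [m], the density takes [m * p], so that the
    transform of [u^p] is the [p]-th power of the transform of [u]. *)
Definition kelvin (q l : R) (g : 'rV[R]_n -> R) (z : 'rV[R]_n) : R :=
  (l / enorm z) `^ q * g (inversion l z).

Lemma kelvin_ge0 q l z : 0 <= kelvin q l f z.
Proof. by rewrite mulr_ge0 ?powR_ge0. Qed.

Lemma measurable_kelvin q l : measurable_fun setT (kelvin q l f).
Proof.
apply: measurable_funM; last exact: (measurableT_comp mf (measurable_inversion n l)).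
apply: (measurableT_comp (measurable_powR q)); apply: measurable_funM => //.
exact: (measurableT_comp measurable_invr (measurable_enorm n)).
Qed.

(** Criticality enters here: the Jacobian exponent [2 n] splits as [m * p + m], the first share
    going to the density and the second to the kernel. *)
Lemma integral_ball_inversion (l : R) (k k' : 'rV[R]_n -> R) : 0 < l ->
  measurable_fun setT k -> measurable_fun setT k' ->
  (forall z, 0 <= k z) -> (forall z, 0 <= k' z) ->
  (forall z, z != 0 -> (l / enorm z) `^ m * k (inversion l z) = k' z) ->
  (\int[mu]_(z in [set z | (enorm z < l)%R]) (f z * k z)%:E =
   \int[mu]_(z in [set z | (l < enorm z)%R]) (kelvin (m * p) l f z * k' z)%:E)%E.
Proof.
move=> l0 mk mk' k0 k'0 kk'.
have mB := @measurable_enorm_lt R n l.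
rewrite integral_mkcond [RHS]integral_mkcond.
rewrite (lebesgue_rV_inversion n0 _ _ l0); last 2 first.
- apply/(measurable_restrictT _ _).1 => //; apply: measurable_funTS.
  by apply/measurable_EFinP; exact: measurable_funM.
- by move=> x; rewrite patchE; case: ifPn => // _; rewrite lee_fin mulr_ge0.
apply: eq_integral => z _; rewrite !patchE.
have [->|z0] := eqVneq z 0.
  rewrite enorm0 invr0 mulr0 expr0n muln_eq0/= gtn_eqF// mul0e ifF//.
  by apply/negbTE; rewrite notin_setE/= enorm0; apply/negP; rewrite -leNgt ltW.
have ez : 0 < enorm z by rewrite enorm_gt0.
have -> : (inversion l z \in [set z0 | enorm z0 < l]) = (z \in [set z0 : 'rV[R]_n | l < enorm z0]).
  apply/idP/idP; rewrite !inE/= enorm_inversion ltr_pdivrMr// expr2 ltr_pM2l//.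
case: ifPn => _; last by rewrite mule0.
rewrite -EFinM; congr (_%:E); rewrite /kelvin -kk'//.
have -> : (l / enorm z) ^+ (2 * n) = (l / enorm z) `^ (m * p) * (l / enorm z) `^ m.
  rewrite -powRD; last by apply/implyP => _; rewrite gt_eqF// divr_gt0.
  by rewrite mp powR_mulrn// divr_ge0// ltW.
by rewrite !mulrA; congr (_ * _); rewrite -!mulrA; congr (_ * _); rewrite mulrC.
Qed.

Variables (u h : 'rV[R]_n -> R) (rho : R).
Hypothesis equ : forall y, enorm y < 4 * rho ->
  ((u y)%:E = \int[mu]_z (f z * ker1 m y z)%:E + (h y)%:E)%E.

Let mfk (k : 'rV[R]_n -> R) : measurable_fun setT k -> measurable_fun setT (fun z => (f z * k z)%:E : \bar R).
Proof. by move=> mk; apply/measurable_EFinP; exact: measurable_funM. Qed.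

Lemma potentialE y : enorm y < 4 * rho ->
  (\int[mu]_z (f z * ker1 m y z)%:E = (u y - h y)%:E)%E.
Proof.
move=> /equ; case: (\int[mu]_z _)%E => [r| |]//; rewrite -EFinD => -[->].
by rewrite addrK.
Qed.

Lemma scaled_potentialE (l : R) (y : 'rV[R]_n) :
  0 < l -> l <= enorm y -> enorm y < 4 * rho ->
  (\int[mu]_z (f z * ker2 m l y z)%:E =
   ((l / enorm y) `^ m * (u (inversion l y) - h (inversion l y)))%:E)%E.
Proof.
move=> l0 ly yr.
have y0 : y != 0 by rewrite -enorm_gt0 (lt_le_trans l0 ly).
have yl := le_lt_trans (enorm_inversion_le l0 ly) (le_lt_trans ly yr).
rewrite EFinM -(potentialE yl) -integralZl_real ?powR_ge0//.
- apply: eq_integral => z _; congr (_%:E).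
  by rewrite mulrCA scale_ker1_inversion.
- by apply: measurable_funM => //; exact: measurable_ker1.
- by move=> z; rewrite mulr_ge0// ker1_ge0.
Qed.

Let integral_split_ball (l : R) (k : 'rV[R]_n -> R) : measurable_fun setT k ->
  (forall z, 0 <= k z) ->
  (\int[mu]_z (f z * k z)%:E =
    \int[mu]_(z in [set z | (enorm z < l)%R]) (f z * k z)%:E +
    \int[mu]_(z in [set z | (l <= enorm z)%R]) (f z * k z)%:E)%E.
Proof.
move=> mk k0.
rewrite -integral_setU_real.
- congr (integral _ _ _); apply/seteqP; split => z //= _.
  by case: ltP; [left|right].
- exact: measurable_enorm_lt.
- exact: measurable_enorm_ge.
- exact: measurable_funM.
- by move=> z; rewrite mulr_ge0.
- by move=> z /= zl; rewrite leNgt zl.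
Qed.

Let integral_ker1_split (D : set 'rV[R]_n) (g : 'rV[R]_n -> R) (l : R) y :
  measurable D -> measurable_fun setT g -> (forall z, 0 <= g z) ->
  0 < l -> l <= enorm y -> (forall z, D z -> l <= enorm z) ->
  (\int[mu]_(z in D) (g z * ker1 m y z)%:E = \int[mu]_(z in D) (g z * ker2 m l y z)%:E +
     \int[mu]_(z in D) (g z * kerd m l y z)%:E)%E.
Proof.
move=> mD mg g0 l0 ly Dl.
have mgk (k : 'rV[R]_n -> R) : measurable_fun setT k ->
    measurable_fun setT (fun z => g z * k z).
  by move=> mk; exact: measurable_funM.
rewrite -integralD_real//.
- apply: (@eq_integral_off_point _ _ y) => //.
  + apply: measurable_funTS; apply/measurable_EFinP; apply: mgk; exact: measurable_ker1.
  + apply: measurable_funTS; apply/measurable_EFinP; apply: measurable_funD; apply: mgk.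
      exact: measurable_ker2.
    exact: measurable_kerd.
  + by move=> z _; rewrite lee_fin mulr_ge0// ker1_ge0.
  + by move=> z _; rewrite lee_fin addr_ge0// mulr_ge0// ?ker2_ge0// kerd_ge0.
  + by move=> z Dz zy; rewrite -mulrDr (ker1E m0 l0 ly (Dl _ Dz) zy).
- by apply: mgk; exact: measurable_ker2.
- by apply: mgk; exact: measurable_kerd.
- by move=> z; rewrite mulr_ge0// ker2_ge0.
- by move=> z; rewrite mulr_ge0// kerd_ge0.
Qed.

(** The potentials at [y] and at its reflection are split at the sphere and their inner parts moved
    outside by the inversion. With [ker1 = ker2 + kerd], the [ker2] integrals of [f] and of its
    transform occur in both and cancel. The sphere itself is counted with [f] alone, in accordance
    with the open ball. *)
Lemma kelvin_difference (l : R) (y : 'rV[R]_n) :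
  0 < l -> l <= enorm y -> enorm y < 4 * rho ->
  exists I1 I2 : R,
   [/\ (\int[mu]_(z in [set z | (l < enorm z)%R]) (kelvin (m * p) l f z * kerd m l y z)%:E = I1%:E)%E,
   (\int[mu]_(z in [set z | (l <= enorm z)%R]) (f z * kerd m l y z)%:E = I2%:E)%E &
   kelvin m l u y - u y = I1 - I2 + (kelvin m l h y - h y)].
Proof.
move=> l0 ly yr.
have yp : 0 < enorm y by apply: lt_le_trans ly.
have y0 : y != 0 by rewrite -enorm_gt0.
set fl := kelvin (m * p) l f.
have fl0 z : 0 <= fl z by exact: kelvin_ge0.
have mfl : measurable_fun setT fl by exact: measurable_kelvin.
have mB := @measurable_enorm_lt R n l.
have mG := @measurable_enorm_ge R n l.
have mX := @measurable_enorm_gt R n l.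
pose k1 := ker1 m y; pose k2 := ker2 m l y; pose K := kerd m l y.
have mk1 : measurable_fun setT k1 by exact: measurable_ker1.
have mk2 : measurable_fun setT k2 by exact: measurable_ker2.
have mK : measurable_fun setT K by exact: measurable_kerd.
have k10 z : 0 <= k1 z by exact: ker1_ge0.
have k20 z : 0 <= k2 z by exact: ker2_ge0.
have K0 z : 0 <= K z by exact: kerd_ge0.
have i1 := integral_ball_inversion l0 mk1 mk2 k10 k20 (fun z z0 => ker1_inversion m l0 y0 z0).
have i2 := integral_ball_inversion l0 mk2 mk1 k20 k10 (fun z z0 => ker2_inversion m l0 y0 z0).
have p1 := potentialE yr.
have p2 := scaled_potentialE l0 ly yr.
move: p1 p2; rewrite (integral_split_ball l mk1 k10) (integral_split_ball l mk2 k20) i1 i2.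
rewrite (integral_ker1_split mG mf f0 l0 ly (fun z => id)).
rewrite (integral_ker1_split mX mfl fl0 l0 ly (fun z => @ltW _ _ _ _)).
have mul0 (g k : 'rV[R]_n -> R) : (forall z, 0 <= g z) -> (forall z, 0 <= k z) ->
    forall z, 0 <= g z * k z.
  by move=> g0 k0 z; rewrite mulr_ge0.
move=> p1 p2.
have [I1 [I2 [e1 e2 e3]]] := ereal_sum_cancel
  (integral_real_ge0 [set z | l <= enorm z] (mul0 _ _ f0 k20))
  (integral_real_ge0 [set z | l < enorm z] (mul0 _ _ fl0 k20))
  (integral_real_ge0 [set z | l < enorm z] (mul0 _ _ fl0 K0))
  (integral_real_ge0 [set z | l <= enorm z] (mul0 _ _ f0 K0)) p1 p2.
exists I1, I2; split; [exact: e1|exact: e2|].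
rewrite /kelvin -e3; ring.
Qed.

End kelvin.

(** Young's inequality for [t] and [1], with [p] and its conjugate exponent. *)
Lemma powR_bernoulli {R : realType} (p t : R) : 1 < p -> 0 <= t -> 1 - p * (1 - t) <= t `^ p.
Proof.
move=> p1 t0; have p0 : 0 < p by lra.
have q0 : 0 < 1 - p^-1 by rewrite subr_gt0 invf_lt1.
have := @conjugate_powR R t 1 p (1 - p^-1)^-1 t0 ler01 p0.
rewrite invr_gt0 invrK subrKC powR1 mulr1 mul1r => /(_ q0 erefl) H.
have : p * t <= p * (t `^ p / p + (1 - p^-1)) by rewrite ler_pM2l.
have -> : p * (t `^ p / p + (1 - p^-1)) = t `^ p + p - 1 by field; rewrite gt_eqF.
lra.
Qed.

(** Dividing by [x^p] reduces this to Bernoulli at [y / x]; the case [x <= 0] forces [x = y]. *)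
Lemma powR_sub_le {R : realType} (p x y M : R) : 1 < p -> 0 <= y -> y <= x -> x <= M ->
  x `^ p - y `^ p <= p * M `^ (p - 1) * (x - y).
Proof.
move=> p1 y0 yx xM; have p0 : 0 < p by lra.
have [x0|x0] := leP x 0.
  have -> : x = y by lra.
  by rewrite !subrr mulr0.
have xM' : x `^ (p - 1) <= M `^ (p - 1) by apply: powR_le => //; lra.
apply: (@le_trans _ _ (p * x `^ (p - 1) * (x - y))); last first.
  by rewrite ler_wpM2r ?subr_ge0// ler_pM2l.
have t0 : 0 <= y / x by rewrite divr_ge0// ltW.
have yE : y `^ p = (y / x) `^ p * x `^ p.
  by rewrite -powRM ?(ltW x0)// divfK// gt_eqF.
have xE : x `^ p = x * x `^ (p - 1) by rewrite mulr_powRB1// ltW.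
have H := powR_bernoulli p1 t0.
rewrite yE -{1}[x `^ p]mul1r -mulrBl xE.
have -> : p * x `^ (p - 1) * (x - y) = p * (1 - y / x) * (x * x `^ (p - 1)).
  by field; rewrite gt_eqF.
rewrite ler_wpM2r ?mulr_ge0 ?powR_ge0 ?(ltW x0)//; lra.
Qed.

(** * Kernel mass of sets of small measure *)

Section smallness.
Context {R : realType} {n : nat}.
Hypothesis n0 : (0 < n)%N.
Local Notation mu := (@lebesgue_rV R n).
Variables (m d : R).
Hypothesis m0 : 0 < m.
Hypothesis mn : m < n%:R.
Hypothesis d0 : 0 < d.
Hypothesis fin : ((\int[mu]_(z in [set z | (enorm z < d)%R]) (ker1 m 0 z)%:E) < +oo)%E.

Let mker y : measurable_fun [set: 'rV[R]_n] (ker1 m y).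
Proof. exact: measurable_ker1. Qed.

Lemma integral_ker1_ball (y : 'rV[R]_n) (s : R) : 0 < s ->
  (\int[mu]_(z in [set z | (enorm (z - y) < s * d)%R]) (ker1 m y z)%:E =
   (s `^ (n%:R - m))%:E * \int[mu]_(z in [set z | (enorm z < d)%R]) (ker1 m 0 z)%:E)%E.
Proof.
move=> s0.
have sE : s `^ (n%:R - m) = s ^+ n * (s `^ m)^-1.
  rewrite powRB; last by rewrite gt_eqF ?implybT.
  by rewrite powR_mulrn// ltW.
have h1 := @measurable_enorm_lt R n d.
have h2 : 0 <= (s `^ m)^-1 by rewrite invr_ge0 powR_ge0.
have E : (\int[mu]_x ((fun z => (ker1 m y z)%:E) \_ [set x | (enorm (x - y) < s * d)%R]) (s *: x + y)%R =
   ((s `^ m)^-1)%:E * \int[mu]_(z in [set z | (enorm z < d)%R]) (ker1 m 0 z)%:E)%E.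
  rewrite -integralZl_real//; last by move=> z; exact: ker1_ge0.
  rewrite [RHS]integral_mkcond.
  apply: eq_integral => z _; rewrite !patchE.
  have -> : (s *: z + y \in [set z0 | enorm (z0 - y) < s * d]) = (z \in [set z0 : 'rV[R]_n | enorm z0 < d]).
    by apply/idP/idP; rewrite !inE/= addrK enormZ gtr0_norm// ltr_pM2l.
  case: ifPn => _ //; congr (_%:E); rewrite /ker1 sub0r enormN -invfM.
  rewrite -powRM ?enorm_ge0 ?(ltW s0)//.
  by rewrite enormBC addrK enormZ gtr0_norm.
rewrite integral_mkcond sE EFinM -muleA -E.
have mr (D : set 'rV[R]_n) y' : measurable D ->
    measurable_fun setT ((fun z => (ker1 m y' z)%:E) \_ D).
  by move=> mD; apply/(measurable_restrictT _ _).1 => //; apply: measurable_funTS; apply/measurable_EFinP.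
have r0 (D : set 'rV[R]_n) y' z : (0 <= ((fun z => (ker1 m y' z)%:E) \_ D) z)%E.
  by rewrite patchE; case: ifPn => // _; rewrite lee_fin ker1_ge0.
have mD := mr _ y (measurable_enorm_ball y (s * d)).
exact/esym/(lebesgue_rV_affine n s y _ s0 mD (r0 _ y)).
Qed.

(** Uniform in [y]: within distance [t] of [y] the mass is small by scaling, as [n - m > 0], and
    farther away the kernel is at most [t^-m], so a small measure suffices. *)
Lemma integral_ker1_small (e : R) : 0 < e -> exists2 del : R, 0 < del &
  forall (N : set 'rV[R]_n) y, measurable N -> (mu N <= del%:E)%E ->
  (\int[mu]_(z in N) (ker1 m y z)%:E <= e%:E)%E.
Proof.
move=> e0.
have [j j0 jE] : exists2 j : R, 0 <= j &
    (\int[mu]_(z in [set z | (enorm z < d)%R]) (ker1 m 0 z)%:E = j%:E)%E.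
  move: fin (integral_real_ge0 [set z : 'rV[R]_n | enorm z < d] (ker1_ge0 m 0)).
  by case: (\int[mu]_(z in _) _)%E => [j| |]// _ j0; exists j.
(* Makes the near part equal to [e * j / (2 (j + 1)) <= e / 2]; the shift by one covers [j = 0]. *)
pose s := (e / (2 * (j + 1))) `^ (n%:R - m)^-1.
have q0 : 0 < e / (2 * (j + 1)) by rewrite divr_gt0//; lra.
have s0 : 0 < s by rewrite powR_gt0.
have sE : s `^ (n%:R - m) = e / (2 * (j + 1)).
  by rewrite /s -powRrM mulVf ?powRr1 ?(ltW q0)// gt_eqF// subr_gt0.
pose t := s * d; have t0 : 0 < t by rewrite mulr_gt0.
have tm : 0 < t `^ m by rewrite powR_gt0.
exists (t `^ m * (e / 2)); first by rewrite mulr_gt0// divr_gt0.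
move=> N y mN muN.
pose B := [set z : 'rV[R]_n | enorm (z - y) < t].
have mB : measurable B by exact: measurable_enorm_ball.
have -> : N = (N `&` B) `|` (N `\` B) by rewrite setUIDK.
rewrite integral_setU_real//; last 4 first.
- exact: measurableI.
- exact: measurableD.
- by move=> z; exact: ker1_ge0.
- by move=> z [_ zB] [_].
rewrite [e in leRHS]splitr EFinD; apply: leeD.
  apply: (@le_trans _ _ (\int[mu]_(z in B) (ker1 m y z)%:E)%E).
    apply: subset_integral_real => //; first exact: measurableI.
    by move=> z; exact: ker1_ge0.
  rewrite /B /t integral_ker1_ball// jE sE -EFinM lee_fin.
  rewrite mulrAC ler_pdivrMr; last lra.
  rewrite mulrAC -mulrA [X in _ <= _ * X](_ : _ = j + 1); last by field.
  by rewrite ler_pM2l// lerDl.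
apply: (@le_trans _ _ (\int[mu]_(z in N `\` B) cst ((t `^ m)^-1)%:E z)%E).
  apply: (@le_integral_real _ _ _ _ (fun=> (t `^ m)^-1)) => //; first exact: measurableD.
    by move=> z; exact: ker1_ge0.
  move=> z [_ /= /negP]; rewrite -leNgt enormBC => zB.
  have ep : 0 < enorm (y - z) by apply: lt_le_trans zB.
  by rewrite lef_pV2 ?posrE ?powR_gt0// (powR_le (ltW m0) (ltW t0)).
rewrite integral_cst; last exact: measurableD.
apply: (@le_trans _ _ (((t `^ m)^-1)%:E * (t `^ m * (e / 2))%:E)%E); last first.
  by rewrite -EFinM lee_fin mulKf// gt_eqF.
rewrite lee_pmul2l ?lte_fin ?invr_gt0//.
by apply: le_trans muN; apply: le_measure; rewrite ?inE//; exact: measurableD.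
Qed.

End smallness.

(** * The reflected density far out, against the annulus *)

Section tail.
Context {R : realType} {n : nat}.
Hypothesis n0 : (0 < n)%N.
Local Notation mu := (@lebesgue_rV R n).
Variables (m p : R).
Hypothesis m0 : 0 < m.
Hypothesis p1 : 1 < p.
Hypothesis mp : critical_exponents n m p.

(** The bound [1/4] serves in the annulus from [rho] to [4 * rho], the quotient beyond it; each of
    the two regions then costs a quarter of the annulus integral. *)
Definition sphere_eps : R :=
  Num.min (1 / 4) (kerd_lb m / (4 * kerd_ub m * 4 `^ m)).

Lemma sphere_eps_gt0 : 0 < sphere_eps.
Proof.
rewrite lt_min divr_gt0//= divr_gt0 ?kerd_lb_gt0//.
by rewrite mulr_gt0 ?powR_gt0// mulr_gt0// kerd_ub_gt0.
Qed.

(** The integrand is the Jacobian of the inversion of radius [rho], which maps the domain into the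
    ball of radius [rho]. *)
Lemma integral_exterior_le (rho : R) : 0 < rho ->
  (\int[mu]_(z in [set z | (4 * rho <= enorm z)%R]) ((rho / enorm z) ^+ (2 * n))%:E
   <= (@ball_vol R n rho)%:E)%E.
Proof.
move=> r0.
rewrite -(lebesgue_ball 0 r0).
have mB : measurable [set x : 'rV[R]_n | enorm (x - 0) < rho] by exact: measurable_enorm_ball.
have mq : measurable_fun [set: 'rV[R]_n] (fun z => (rho / enorm z) ^+ (2 * n)).
  apply: measurable_funX; apply: measurable_funM => //.
  exact: (measurableT_comp measurable_invr (measurable_enorm n)).
rewrite -[X in mu X]setIT -integral_indic//.
have m1 : measurable_fun setT (fun x : 'rV[R]_n => (\1_[set x | enorm (x - 0) < rho] x)%:E : \bar R).
  by apply/measurable_EFinP/measurable_indic.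
rewrite (lebesgue_rV_inversion n0 _ _ r0 m1)// integral_mkcond.
apply: ge0_le_integral => //.
- move=> z _; rewrite patchE; case: ifPn => // _.
  by rewrite lee_fin exprn_ge0// divr_ge0 ?enorm_ge0 ?ltW.
- apply/(measurable_restrictT _ _).1; first exact: measurable_enorm_ge.
  by apply: measurable_funTS; apply/measurable_EFinP.
- apply: emeasurable_funM; first exact/measurable_EFinP.
  exact: (measurableT_comp m1 (measurable_inversion n rho)).
move=> z _; rewrite patchE; case: ifPn => zr; last first.
  by rewrite -EFinM lee_fin mulr_ge0// exprn_ge0// divr_ge0 ?enorm_ge0 ?ltW.
rewrite indicE mem_set ?mule1//= subr0 enorm_inversion.
move: zr; rewrite inE/= => zr.
have ez : 0 < enorm z by lra.
by rewrite ltr_pdivrMr// expr2 ltr_pM2l//; lra.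
Qed.

Variables (f u : 'rV[R]_n -> R) (rho a M L : R).
Hypothesis f0 : forall z, 0 <= f z.
Hypothesis mf : measurable_fun setT f.
Hypothesis rho0 : 0 < rho.
Hypothesis a0 : 0 < a.
Hypothesis L0 : 0 < L.
Hypothesis Lrho : L <= rho.
Hypothesis fu : forall z, enorm z < 4 * rho -> f z = u z `^ p.
Hypothesis ua : forall z, enorm z < 4 * rho -> a <= u z.
Hypothesis uM : forall z, enorm z < L -> u z <= M.
Hypothesis small : (L / rho) `^ m * M <= sphere_eps * a.

Let p0 : 0 < p. Proof. exact: lt_trans p1. Qed.

Lemma kelvinE (l : R) (z : 'rV[R]_n) : 0 < l -> l <= L -> l < enorm z ->
  kelvin (m * p) l f z = kelvin m l u z `^ p.
Proof.
move: (rho0) (Lrho) => r0 Lr l0 lL lz; have zi := enorm_inversion_le l0 (ltW lz).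
rewrite /kelvin fu; last by lra.
rewrite powRrM -powRM ?powR_ge0//.
by rewrite (le_trans (ltW a0))// ua//; lra.
Qed.

Lemma kelvin_le (l : R) (z : 'rV[R]_n) : 0 < l -> l <= L -> l < enorm z ->
  kelvin m l u z <= (l / enorm z) `^ m * M.
Proof.
move=> l0 lL lz; rewrite ler_wpM2l ?powR_ge0// uM// (lt_le_trans _ lL)//.
have z0 : 0 < enorm z by apply: lt_trans lz.
by rewrite enorm_inversion ltr_pdivrMr// expr2 ltr_pM2l.
Qed.

Lemma kelvin_u_ge0 (l : R) (z : 'rV[R]_n) : 0 < l -> l <= L -> l < enorm z ->
  0 <= kelvin m l u z.
Proof.
move: (rho0) (Lrho) => r0 Lr l0 lL lz; rewrite mulr_ge0 ?powR_ge0// (le_trans (ltW a0))// ua//.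
by have := enorm_inversion_le l0 (ltW lz); lra.
Qed.

Let M0 : 0 < M.
Proof.
apply: lt_le_trans (uM (z := 0) _); last by rewrite enorm0.
by apply: lt_le_trans (ua _) => //; rewrite enorm0 mulr_gt0.
Qed.

(** Here the Kelvin weight is at most [(L / rho)^m * (rho / enorm z)^m]; the smallness hypothesis
    absorbs the first factor together with [M], leaving a small multiple of [a]. *)
Let kelvin_far (l : R) (z : 'rV[R]_n) : 0 < l -> l <= L -> rho < enorm z ->
  kelvin (m * p) l f z <= sphere_eps * a `^ p * (rho / enorm z) `^ (m * p).
Proof.
move: (rho0) (Lrho) => r0 Lr l0 lL rz; have lz : l < enorm z by lra.
have z0 : 0 < enorm z by lra.
have e0 := sphere_eps_gt0.
have e1 : sphere_eps <= 1 / 4 by rewrite ge_min lexx.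
rewrite kelvinE//.
have h1 : kelvin m l u z <= sphere_eps * a * (rho / enorm z) `^ m.
  apply: le_trans (kelvin_le l0 lL lz) _.
  apply: (@le_trans _ _ ((L / rho) `^ m * M * (rho / enorm z) `^ m)).
    rewrite mulrAC ler_wpM2r ?(ltW M0)//.
    rewrite -powRM ?divr_ge0 ?enorm_ge0 ?(ltW L0) ?(ltW rho0)//.
    rewrite mulrA divfK ?gt_eqF//; apply: powR_le; first exact: ltW.
      by rewrite divr_ge0 ?enorm_ge0// ltW.
    by rewrite ler_pM2r// invr_gt0.
  by rewrite ler_wpM2r// powR_ge0.
apply: le_trans (powR_le (ltW p0) (kelvin_u_ge0 l0 lL lz) h1) _.
rewrite powRM ?powR_ge0 ?mulr_ge0 ?(ltW e0) ?(ltW a0)// -powRrM.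
rewrite ler_wpM2r ?powR_ge0// powRM ?(ltW e0) ?(ltW a0)//.
(* The power [p] of [sphere_eps] is at most [sphere_eps], as the base is at most [1] and [p > 1]. *)
rewrite ler_wpM2r ?powR_ge0//; apply: ge1r_powR; last exact: ltW.
by rewrite e0/= (le_trans e1)//; lra.
Qed.

Let annulus := [set z : 'rV[R]_n | rho < enorm z] `&` [set z | enorm z < 4 * rho].

Let m_annulus : measurable annulus.
Proof. by apply: measurableI; [exact: measurable_enorm_gt|exact: measurable_enorm_lt]. Qed.

Let mfK l y : measurable_fun setT (fun z : 'rV[R]_n => f z * kerd m l y z).
Proof. by apply: measurable_funM => //; exact: measurable_kerd. Qed.

Let mflK l y : measurable_fun setT (fun z : 'rV[R]_n => kelvin (m * p) l f z * kerd m l y z).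
Proof.
by apply: measurable_funM; [exact: measurable_kelvin|exact: measurable_kerd].
Qed.

Let annulus_lower (l : R) (y : 'rV[R]_n) : 0 < l -> l <= L -> l < enorm y -> enorm y <= rho ->
  ((a `^ p * (kerd_lb m * (1 - (l / enorm y) ^+ 2) * (4 * rho) `^ (- m)) * @ball_vol R n rho)%:E
   <= \int[mu]_(z in annulus) (f z * kerd m l y z)%:E)%E.
Proof.
move: (rho0) (Lrho) => r0 Lr l0 lL ly yr.
have yp : 0 < enorm y by apply: lt_trans ly.
(* A ball of radius [rho] centred at norm [3 * rho] stays between the norms [2 * rho] and [4 * rho],
   where [kerd_bounds] applies to every [y] of norm at most [rho]. *)
pose w : 'rV[R]_n := (3 * rho) *: delta_mx ord0 (Ordinal n0).
have ew : enorm w = 3 * rho.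
  rewrite /w enormZ ger0_norm ?mulr_ge0 ?(ltW rho0)//.
  rewrite /enorm (bigD1 (Ordinal n0))//= !mxE !eqxx/= expr1n big1 ?addr0 ?sqrtr1 ?mulr1//.
  by move=> i /negbTE ni; rewrite mxE ni andbF expr0n.
pose B := [set z : 'rV[R]_n | enorm (z - w) < rho].
have mB : measurable B by exact: measurable_enorm_ball.
have Bz z : B z -> 2 * rho < enorm z < 4 * rho.
  rewrite /B/= => zw; apply/andP; split.
    by have := enorm_leB w z; rewrite enormBC ew; lra.
  by have := enorm_leB z w; rewrite ew; lra.
set c := _ * (_ * _ * _).
have k0 : 0 <= 1 - (l / enorm y) ^+ 2.
  have t1 : l / enorm y <= 1 by rewrite ler_pdivrMr// mul1r ltW.
  have t0 : 0 <= l / enorm y by rewrite divr_ge0// ltW.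
  by rewrite subr_ge0; nra.
have c0 : 0 <= c by rewrite mulr_ge0 ?powR_ge0// mulr_ge0 ?powR_ge0// mulr_ge0// ltW// kerd_lb_gt0.
apply: (@le_trans _ _ (\int[mu]_(z in B) (f z * kerd m l y z)%:E)%E); last first.
  apply: subset_integral_real => //.
    by move=> z; rewrite mulr_ge0// kerd_ge0.
  by move=> z /Bz /andP[h1 h2]; split => /=; lra.
rewrite EFinM -(lebesgue_ball w rho0) -integral_cst//.
apply: (@le_integral_real _ _ _ (fun=> c)) => //.
move=> z /Bz /andP[h1 h2].
have yz : 2 * enorm y <= enorm z by lra.
have [hk _] := kerd_bounds m0 l0 (ltW ly) yz.
apply: ler_pM.
- exact: powR_ge0.
- by rewrite mulr_ge0 ?powR_ge0// mulr_ge0// ltW// kerd_lb_gt0.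
- by rewrite fu//; apply: powR_le; [exact: ltW|exact: ltW|exact: ua].
apply: (le_trans _ hk).
apply: ler_wpM2l; first by rewrite mulr_ge0// ltW// kerd_lb_gt0.
rewrite !powRN lef_pV2 ?posrE ?powR_gt0//; [|lra|lra].
by apply: powR_le; [exact: ltW|lra|exact: ltW].
Qed.

Lemma annulus_gt0 (l : R) (y : 'rV[R]_n) : 0 < l -> l <= L -> l < enorm y -> enorm y <= rho ->
  (0 < \int[mu]_(z in annulus) (f z * kerd m l y z)%:E)%E.
Proof.
move: (rho0) (Lrho) => r0 Lr l0 lL ly yr; apply: lt_le_trans (annulus_lower l0 lL ly yr).
have yp : 0 < enorm y by apply: lt_trans ly.
have k0 : 0 < 1 - (l / enorm y) ^+ 2.
  have t1 : l / enorm y < 1 by rewrite ltr_pdivrMr// mul1r.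
  have t0 : 0 <= l / enorm y by rewrite divr_ge0// ltW.
  by rewrite subr_gt0; nra.
rewrite lte_fin mulr_gt0 ?ball_vol_gt0// mulr_gt0 ?powR_gt0//.
by rewrite mulr_gt0 ?powR_gt0 ?(mulr_gt0 _ rho0)// mulr_gt0// kerd_lb_gt0.
Qed.

(** Up to [4 * rho] the densities compare pointwise, since [f = u^p >= a^p] there. Beyond, [f] has
    no positive lower bound, so the integral is compared with [annulus_lower]; the common factor
    [1 - (l / enorm y) ^+ 2] keeps the ratio from degenerating near the sphere. *)
Lemma exterior_le_annulus (l : R) (y : 'rV[R]_n) :
  0 < l -> l <= L -> l < enorm y -> enorm y <= rho ->
  (\int[mu]_(z in [set z | (rho < enorm z)%R]) (kelvin (m * p) l f z * kerd m l y z)%:E <=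
   (1 / 2)%:E * \int[mu]_(z in annulus) (f z * kerd m l y z)%:E)%E.
Proof.
move: (rho0) (Lrho) => r0 Lr l0 lL ly yr.
have yp : 0 < enorm y by apply: lt_trans ly.
have e0 := sphere_eps_gt0.
have e1 : sphere_eps <= 1 / 4 by rewrite ge_min lexx.
have e2 : sphere_eps <= kerd_lb m / (4 * kerd_ub m * 4 `^ m) by rewrite ge_min lexx orbT.
set T := (\int[mu]_(z in annulus) _)%E.
have k0 : 0 <= 1 - (l / enorm y) ^+ 2.
  have t1 : l / enorm y <= 1 by rewrite ler_pdivrMr// mul1r ltW.
  have t0 : 0 <= l / enorm y by rewrite divr_ge0// ltW.
  by rewrite subr_ge0; nra.
have -> : [set z : 'rV[R]_n | rho < enorm z] = annulus `|` [set z | 4 * rho <= enorm z].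
  apply/seteqP; split => z /=; last by case => [[]//|/=]; lra.
  by move=> rz; case: (ltP (enorm z) (4 * rho)) => h; [left|right].
rewrite integral_setU_real//; last 3 first.
- exact: measurable_enorm_ge.
- by move=> z; rewrite mulr_ge0 ?kelvin_ge0// kerd_ge0.
- by move=> z [_ /= h1] h2; lra.
have -> : ((1 / 2)%:E * T = (1 / 4)%:E * T + (1 / 4)%:E * T)%E.
  rewrite -ge0_muleDl ?lee_fin ?divr_ge0// -EFinD; congr (_%:E * _)%E; lra.
apply: leeD.
  rewrite /T -integralZl_real//; last by move=> z; rewrite mulr_ge0// kerd_ge0.
  apply: le_integral_real => //.
  - by apply: measurable_funM => //; exact: measurable_cst.
  - by move=> z; rewrite mulr_ge0 ?kelvin_ge0// kerd_ge0.
  move=> z [/= h1 h2]; rewrite mulrA ler_wpM2r ?kerd_ge0//.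
  apply: le_trans (kelvin_far l0 lL h1) _.
  have t1 : (rho / enorm z) `^ (m * p) <= 1.
    rewrite (le_trans (powR_le (b := 1) _ _ _)) ?powR1//.
    - by rewrite mulr_ge0// ltW.
    - by rewrite divr_ge0 ?enorm_ge0// ltW.
    - by rewrite ler_pdivrMr; lra.
  apply: (@le_trans _ _ (sphere_eps * a `^ p)).
    by rewrite ler_piMr// mulr_ge0 ?powR_ge0// ltW.
  apply: ler_pM => //; [exact: ltW|exact: powR_ge0|].
  by rewrite fu//; apply: powR_le; [exact: ltW|exact: ltW|exact: ua].
pose c := sphere_eps * a `^ p * (kerd_ub m * (1 - (l / enorm y) ^+ 2) * rho `^ (- m)).
have mq : measurable_fun [set: 'rV[R]_n] (fun z => (rho / enorm z) ^+ (2 * n)).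
  apply: measurable_funX; apply: measurable_funM => //.
  exact: (measurableT_comp measurable_invr (measurable_enorm n)).
have q0 (z : 'rV[R]_n) : 0 <= (rho / enorm z) ^+ (2 * n).
  by rewrite exprn_ge0// divr_ge0 ?enorm_ge0// ltW.
have c0 : 0 <= c.
  rewrite mulr_ge0//; first by rewrite mulr_ge0 ?powR_ge0// ltW.
  by rewrite mulr_ge0 ?powR_ge0// mulr_ge0// ltW// kerd_ub_gt0.
apply: (@le_trans _ _ (\int[mu]_(z in [set z | (4 * rho <= enorm z)%R])
    (c * (rho / enorm z) ^+ (2 * n))%:E)%E).
  apply: le_integral_real => //.
  - exact: measurable_enorm_ge.
  - exact: measurable_funM.
  - by move=> z; rewrite mulr_ge0 ?kelvin_ge0// kerd_ge0.
  move=> z /= zr; have rz : rho < enorm z by lra.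
  have zp : 0 < enorm z by lra.
  have yz : 2 * enorm y <= enorm z by lra.
  have [_ hk] := kerd_bounds m0 l0 (ltW ly) yz.
  apply: le_trans (ler_pM (kelvin_ge0 _ _ _ _) (kerd_ge0 _ _ _ _) (kelvin_far l0 lL rz) hk) _ => //.
  have -> : (rho / enorm z) ^+ (2 * n) =
      (rho / enorm z) `^ (m * p) * (rho `^ m / enorm z `^ m).
    rewrite -powR_div ?(ltW rho0) ?(ltW zp)// -powRD; last first.
      by apply/implyP => _; rewrite gt_eqF// divr_gt0.
    by rewrite (mp : _ + _ = _) powR_mulrn// divr_ge0// ltW.
  rewrite /c !powRN.
  rewrite le_eqVlt; apply/orP; left; apply/eqP.
  by field; rewrite !gt_eqF// powR_gt0.
rewrite integralZl_real//; last exact: measurable_enorm_ge.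
apply: (@le_trans _ _ (c%:E * (@ball_vol R n rho)%:E)%E).
  by rewrite lee_wpmul2l// ?lee_fin//; exact: integral_exterior_le.
apply: (@le_trans _ _ ((1 / 4)%:E * (a `^ p * (kerd_lb m * (1 - (l / enorm y) ^+ 2) * (4 * rho) `^ (- m)) * @ball_vol R n rho)%:E)%E); last first.
  by rewrite lee_wpmul2l ?lee_fin ?divr_ge0//; exact: annulus_lower.
rewrite -!EFinM lee_fin [leRHS]mulrA ler_wpM2r ?(ltW (ball_vol_gt0 rho0))//.
have e3 : sphere_eps * kerd_ub m <= kerd_lb m / 4 * 4 `^ (- m).
  rewrite powRN.
  have h : sphere_eps * (4 * kerd_ub m * 4 `^ m) <= kerd_lb m.
    by rewrite -ler_pdivlMr// mulr_gt0 ?powR_gt0// mulr_gt0// kerd_ub_gt0.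
  rewrite ler_pdivlMr ?powR_gt0// ler_pdivlMr//; lra.
rewrite powRM ?(ltW rho0)//.
have X0 : 0 <= a `^ p * (1 - (l / enorm y) ^+ 2) * rho `^ (- m).
  by rewrite !mulr_ge0 ?powR_ge0.
have := ler_wpM2r X0 e3; rewrite /c; lra.
Qed.

End tail.

(** * Moving spheres *)

Lemma powR_le1 {R : realType} (a r : R) : 0 <= r -> 0 <= a -> a <= 1 -> a `^ r <= 1.
Proof. by move=> r0 a0 a1; rewrite (le_trans (powR_le r0 a0 a1))// powR1. Qed.

Lemma continuous_powR {R : realType} (x q : R) : 0 < x -> {for x, continuous (fun t : R => t `^ q)}.
Proof.
move=> x0; apply: differentiable_continuous; apply/derivable1_diffP.
by apply: derivable_powR; rewrite in_itv/= andbT.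
Qed.

Lemma cvg_kelvin {R : realType} {n : nat} (T : Type) (F : set_system T) {FF : Filter F}
    (q : R) (u : 'rV[R]_n -> R) (l : R) (y : 'rV[R]_n) (g1 : T -> R) (g2 : T -> 'rV[R]_n) :
  0 < l -> y != 0 -> {for inversion l y, continuous u} ->
  g1 @ F --> l -> g2 @ F --> y ->
  (fun t => kelvin q (g1 t) u (g2 t)) @ F --> kelvin q l u y.
Proof.
move=> l0 y0 uc c1 c2.
have ey : enorm y != 0 by rewrite enorm_eq0.
have c3 : (fun t => g1 t / enorm (g2 t)) @ F --> l / enorm y.
  apply: cvgM => //; apply: cvgV => //.
  exact: (cvg_comp _ _ c2 (@continuous_enorm R n y)).
apply: cvgM.
  have lp : 0 < l / enorm y by rewrite divr_gt0// enorm_gt0.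
  exact: (cvg_comp _ (fun t : R => t `^ q) c3 (continuous_powR lp)).
apply: (cvg_comp (fun t => inversion (g1 t) (g2 t)) u _ uc).
apply: cvgZ => //; rewrite expr2.
exact: (cvgM c3 c3).
Qed.

Section moving_spheres.
Context {R : realType} {n : nat}.
Hypothesis n0 : (0 < n)%N.
Local Notation mu := (@lebesgue_rV R n).
Variables (m p : R).
Hypothesis m0 : 0 < m.
Hypothesis p1 : 1 < p.
Hypothesis mp : critical_exponents n m p.
Variables (f u h : 'rV[R]_n -> R) (rho a M L : R).
Hypothesis f0 : forall z, 0 <= f z.
Hypothesis mf : measurable_fun setT f.
Hypothesis rho0 : 0 < rho.
Hypothesis a0 : 0 < a.
Hypothesis L0 : 0 < L.
Hypothesis Lrho : L <= rho.
Hypothesis fu : forall z, enorm z < 4 * rho -> f z = u z `^ p.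
Hypothesis ua : forall z, enorm z < 4 * rho -> a <= u z.
Hypothesis uM : forall z, enorm z < L -> u z <= M.
Hypothesis small : (L / rho) `^ m * M <= sphere_eps m * a.
Hypothesis equ : forall y, enorm y < 4 * rho ->
  ((u y)%:E = \int[mu]_z (f z * ker1 m y z)%:E + (h y)%:E)%E.
Hypothesis hh : forall l y, 0 < l -> l <= L -> l <= enorm y -> enorm y <= rho ->
  kelvin m l h y <= h y.
Hypothesis uc : forall y, enorm y < 4 * rho -> {for y, continuous u}.

Let p0 : 0 < p. Proof. exact: lt_trans p1. Qed.

Let M0 : 0 < M.
Proof.
apply: lt_le_trans (uM (z := 0) _); last by rewrite enorm0.
by apply: lt_le_trans (ua _) => //; rewrite enorm0 mulr_gt0.
Qed.

Let u0 y : enorm y <= rho -> 0 < u y.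
Proof. by move: (rho0) => r0 yr; apply: lt_le_trans (ua _) => //; lra. Qed.

Let good l := forall y, l <= enorm y -> enorm y <= rho -> kelvin m l u y <= u y.

(** A Lipschitz constant of [t -> t^p] on the interval from [0] to [M]. *)
Let cM := p * M `^ (p - 1).

Let cM0 : 0 < cM. Proof. by rewrite mulr_gt0// powR_gt0. Qed.

(** Half of [T] is spent above while all of it is available below, and [T > 0] makes the conclusion
    strict; since [I2] is real, [X] and [T] are finite. *)
Lemma ereal_gap (X T : \bar R) (I1 I2 e : R) : (0 <= X)%E -> (0 < T)%E ->
  (I1%:E <= X + e%:E + (1 / 2)%:E * T)%E -> (X + T <= I2%:E)%E -> I1 - I2 < e.
Proof.
case: X => [x| |]//; case: T => [t| |]//.
by rewrite -!EFinM -!EFinD !lee_fin lte_fin => x0 t0 h1 h2; lra.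
Qed.

(* One step of the maximum principle: the positive part of [kelvin m l u - u] lives
   on the set [N] of small kernel mass, and the integral equation halves it. *)
Lemma gap_estimate (l s : R) (N : set 'rV[R]_n) (y : 'rV[R]_n) :
  0 < l -> l <= L -> 0 <= s -> measurable N ->
  (cM%:E * \int[mu]_(z in N) (ker1 m y z)%:E <= (1 / 2)%:E)%E ->
  (forall z, l < enorm z -> enorm z <= rho -> ~ N z -> kelvin m l u z <= u z) ->
  (forall z, l < enorm z -> enorm z <= rho -> kelvin m l u z - u z <= s) ->
  l < enorm y -> enorm y <= rho -> kelvin m l u y - u y < s / 2.
Proof.
move: (rho0) (Lrho) => r0 Lr l0 lL s0 mN Nsmall NC le_s ly yr.
have y4 : enorm y < 4 * rho by lra.
have [I1 [I2 [e1 e2 e3]]] := kelvin_difference n0 m0 mp f0 mf equ l0 (ltW ly) y4.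
have hy := hh l0 lL (ltW ly) yr.
pose A := [set z : 'rV[R]_n | l < enorm z] `&` [set z | enorm z <= rho].
pose B := [set z : 'rV[R]_n | rho < enorm z] `&` [set z | enorm z < 4 * rho].
have mA : measurable A.
  by apply: measurableI; [exact: measurable_enorm_gt|exact: measurable_enorm_le].
have mB : measurable B.
  by apply: measurableI; [exact: measurable_enorm_gt|exact: measurable_enorm_lt].
pose fK z := f z * kerd m l y z.
pose flK z := kelvin (m * p) l f z * kerd m l y z.
have mK := measurable_kerd (n := n) m l y.
have mk1 := measurable_ker1 (n := n) m y.
have mfK : measurable_fun setT fK by exact: measurable_funM.
have mflK : measurable_fun setT flK.
  by apply: measurable_funM => //; exact: measurable_kelvin.
have fK0 z : 0 <= fK z by rewrite mulr_ge0 ?kerd_ge0.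
have flK0 z : 0 <= flK z by rewrite mulr_ge0 ?kerd_ge0 ?kelvin_ge0.
pose k z := \1_N z * ker1 m y z.
have mk : measurable_fun setT k by apply: measurable_funM => //; exact: measurable_indic.
have k0 z : 0 <= k z by rewrite mulr_ge0// ?ker1_ge0// indicE.
have kN : (\int[mu]_(z in A) (k z)%:E <= \int[mu]_(z in N) (ker1 m y z)%:E)%E.
  apply: (@le_trans _ _ (\int[mu]_z (k z)%:E)%E).
    by apply: subset_integral_real.
  rewrite [leRHS]integral_mkcond le_eqVlt; apply/orP; left; apply/eqP.
  apply: eq_integral => z _; rewrite patchE /k indicE.
  by case: ifPn => _; rewrite ?mul1r ?mul0r.
have I1E : (I1%:E <= \int[mu]_(z in A) (fK z)%:E + (s / 2)%:E +
    (1 / 2)%:E * \int[mu]_(z in B) (fK z)%:E)%E.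
  rewrite -e1 (_ : [set z | l < enorm z] = A `|` [set z | rho < enorm z]); last first.
    apply/seteqP; split => z /=; last by case => [[]//|]; lra.
    by move=> lz; case: (leP (enorm z) rho) => zr; [left|right].
  rewrite integral_setU_real//; last 2 first.
  - exact: measurable_enorm_gt.
  - by move=> z [_ /= h1] h2; lra.
  apply: leeD; last exact: (exterior_le_annulus n0 m0 p1 mp f0 mf rho0 a0 L0 Lrho fu ua uM small).
  (* The transformed density exceeds [f] only on [N], by at most [cM * s], and [kerd <= ker1]; the
     smallness of [N] turns this excess into [s / 2]. *)
  apply: (@le_trans _ _ (\int[mu]_(z in A) (fK z + (s * cM) * k z)%:E)%E).
    apply: le_integral_real => //.
      by apply: measurable_funD => //; exact: measurable_funM.
    move=> z [/= lz zr].
    have kp : 0 <= kelvin m l u z by exact: (kelvin_u_ge0 m rho0 a0 Lrho ua l0 lL lz).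
    have kM : kelvin m l u z <= M.
      apply: le_trans (kelvin_le m uM l0 lL lz) _.
      rewrite ler_piMl ?(ltW M0)// //; apply: powR_le1; first exact: ltW.
        by rewrite divr_ge0 ?enorm_ge0// ltW.
      by rewrite ler_pdivrMr ?mul1r ?ltW//; lra.
    have up := u0 zr.
    have fzE : f z = u z `^ p by rewrite fu//; lra.
    rewrite /flK /fK (kelvinE m rho0 a0 Lrho fu ua l0 lL lz) fzE.
    have [ku|uk] := leP (kelvin m l u z) (u z).
      apply: (@le_trans _ _ (u z `^ p * kerd m l y z)).
        by rewrite ler_wpM2r ?kerd_ge0//; apply: powR_le => //; exact: ltW.
      by rewrite lerDl mulr_ge0// mulr_ge0// ltW.
    have Nz : N z by apply: contrapT => /(NC _ lz zr); rewrite leNgt uk.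
    rewrite /k indicE mem_set// mul1r.
    have h1 := powR_sub_le p1 (ltW up) (ltW uk) kM; rewrite -/cM in h1.
    have h2 := le_s _ lz zr.
    have h3 : cM * (kelvin m l u z - u z) <= cM * s by rewrite ler_pM2l.
    have h4 := kerd_le_ker1 m l y z.
    have h5 := kerd_ge0 m l y z.
    rewrite -lerBlDl -mulrBl; apply: (@le_trans _ _ (cM * s * kerd m l y z)).
      by rewrite ler_wpM2r//; lra.
    by rewrite (mulrC s) ler_wpM2l// mulr_ge0// ltW.
  have sc : 0 <= s * cM by rewrite mulr_ge0// ltW.
  rewrite integralD_real//; last 2 first.
  - by apply: measurable_funM.
  - by move=> z; rewrite mulr_ge0.
  apply: leeD => //; rewrite integralZl_real// EFinM -muleA.
  apply: (@le_trans _ _ (s%:E * (1 / 2)%:E)%E); last by rewrite -EFinM lee_fin; lra.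
  rewrite lee_wpmul2l ?lee_fin//; apply: le_trans Nsmall.
  by rewrite lee_wpmul2l ?lee_fin// ltW.
have I2E : (\int[mu]_(z in A) (fK z)%:E + \int[mu]_(z in B) (fK z)%:E <= I2%:E)%E.
  rewrite -e2 -integral_setU_real//; last by move=> z [_ /= h1] [/= h2]; lra.
  apply: subset_integral_real => //.
  - exact: measurableU.
  - exact: measurable_enorm_ge.
  - by move=> z [[/= h1 _]|[/= h1 _]]; lra.
have T0 : (0 < \int[mu]_(z in B) (fK z)%:E)%E.
  exact: (annulus_gt0 n0 m0 p1 f0 mf rho0 a0 Lrho fu ua l0 lL ly yr).
have := ereal_gap (integral_real_ge0 A fK0) T0 I1E I2E.
lra.
Qed.

Lemma good_sphere l y : 0 < l -> enorm y = l -> kelvin m l u y = u y.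
Proof.
move=> l0 yl; rewrite /kelvin /inversion yl divff ?gt_eqF// powR1 mul1r.
by rewrite expr1n scale1r.
Qed.

(* The narrow domain principle: iterating [gap_estimate]. *)
Lemma narrow_region (l : R) (N : set 'rV[R]_n) : 0 < l -> l <= L -> measurable N ->
  (forall y, (cM%:E * \int[mu]_(z in N) (ker1 m y z)%:E <= (1 / 2)%:E)%E) ->
  (forall z, l < enorm z -> enorm z <= rho -> ~ N z -> kelvin m l u z <= u z) ->
  good l.
Proof.
move=> l0 lL mN Nsmall NC.
(* The transform is at most [M] to start with, and each round halves the gap, so no maximum has to
   be attained. *)
have H (k : nat) z : l < enorm z -> enorm z <= rho -> kelvin m l u z - u z <= M / 2 ^+ k.
  elim: k z => [|k IH] z lz zr.
    rewrite expr0 divr1 lerBlDr (le_trans (kelvin_le m uM l0 lL lz))//.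
    apply: (@le_trans _ _ M); last by rewrite lerDl ltW// u0.
    have z0 : 0 < enorm z by apply: lt_trans lz.
    rewrite ler_piMl ?(ltW M0)// //; apply: powR_le1; first exact: ltW.
      by rewrite divr_ge0 ?enorm_ge0// ltW.
    by rewrite ler_pdivrMr ?mul1r ?ltW.
  rewrite exprSr invfM mulrA; apply/ltW.
  apply: (@gap_estimate l (M / 2 ^+ k) N) => //.
  by rewrite divr_ge0 ?exprn_ge0// ltW.
move=> y; rewrite le_eqVlt => /predU1P[yl|ly] yr; first by rewrite (good_sphere l0).
rewrite leNgt; apply/negP => uk.
have d0 : 0 < kelvin m l u y - u y by rewrite subr_gt0.
pose k := Num.bound (M / (kelvin m l u y - u y)).
have Hk := H k y ly yr.
have : M / (kelvin m l u y - u y) < k%:R.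
  by rewrite archi_boundP// divr_ge0 ?ltW.
rewrite ltr_pdivrMr// => h1.
have h2 : (k%:R : R) <= 2 ^+ k by rewrite -natrX ler_nat ltnW// ltn_expl.
move: Hk; rewrite ler_pdivlMr ?exprn_gt0// => h3.
suff /(lt_le_trans h1) : k%:R * (kelvin m l u y - u y) <= M by rewrite ltxx.
apply: le_trans h3.
by rewrite mulrC ler_pM2l.
Qed.

(** The gap estimate with [s = 0] and the empty set; strictness comes from the positive annulus
    integral. *)
Lemma good_strict l y : 0 < l -> l <= L -> good l -> l < enorm y -> enorm y <= rho ->
  kelvin m l u y < u y.
Proof.
move=> l0 lL gl ly yr.
have := @gap_estimate l 0 set0 y l0 lL (lexx 0) measurable0.
rewrite integral_set0 mule0 lee_fin divr_ge0// mul0r subr_lt0; apply => //.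
- by move=> z lz zr _; exact: gl (ltW lz) zr.
- by move=> z lz zr; rewrite subr_le0; exact: gl (ltW lz) zr.
Qed.

Lemma kernel_mass_small : exists2 del : R, 0 < del &
  forall (N : set 'rV[R]_n), measurable N -> (mu N <= del%:E)%E ->
  forall y, (cM%:E * \int[mu]_(z in N) (ker1 m y z)%:E <= (1 / 2)%:E)%E.
Proof.
have rr : 0 < 4 * rho by rewrite mulr_gt0.
have mn : m < n%:R.
  have H : m * 1 < m * p by rewrite ltr_pM2l.
  have : m + m < (2 * n)%:R by rewrite -(mp : _ + _ = _) ltrD2r -{1}[m]mulr1.
  by rewrite natrM -mulr2n -[m *+ 2]mulr_natl ltr_pM2l.
(* Local integrability of the kernel is read off the equation at the origin, where the potential is
   finite and [f >= a^p] nearby. *)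
have fin : (\int[mu]_(z in [set z | (enorm z < 4 * rho)%R]) (ker1 m 0 z)%:E < +oo)%E.
  have ap : 0 < a `^ p by rewrite powR_gt0.
  have H : ((a `^ p)%:E * \int[mu]_(z in [set z | (enorm z < 4 * rho)%R]) (ker1 m 0 z)%:E
      <= (u 0 - h 0)%:E)%E.
    rewrite -(potentialE equ); last by rewrite enorm0.
    have mk1 := measurable_ker1 (n := n) m 0.
    have mD := @measurable_enorm_lt R n (4 * rho).
    have mfk : measurable_fun setT (fun z => f z * ker1 m 0 z) by exact: measurable_funM.
    rewrite -integralZl_real ?(ltW ap)//; last by move=> z; exact: ker1_ge0.
    apply: (@le_trans _ _ (\int[mu]_(z in [set z | (enorm z < 4 * rho)%R]) (f z * ker1 m 0 z)%:E)%E).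
      apply: le_integral_real => //.
      - exact: measurable_funM.
      - by move=> z; rewrite mulr_ge0 ?ker1_ge0// ltW.
      move=> z /= zr; rewrite ler_wpM2r ?ker1_ge0// fu//.
      by apply: powR_le; [exact: ltW|exact: ltW|exact: ua].
    by apply: subset_integral_real => // z; rewrite mulr_ge0 ?ker1_ge0.
  move: H; case: (\int[mu]_(z in _) _)%E => [r| |]//.
    by rewrite ltry.
  by rewrite gt0_muley ?lte_fin.
have e0 : 0 < 1 / (2 * cM) by rewrite divr_gt0// mulr_gt0.
have [del d0 H] := integral_ker1_small m0 mn rr fin e0.
exists del => // N mN muN y.
apply: (@le_trans _ _ (cM%:E * (1 / (2 * cM))%:E)%E).
  by rewrite lee_wpmul2l ?lee_fin ?(ltW cM0)//; exact: H.
by rewrite -EFinM lee_fin le_eqVlt; apply/orP; left; apply/eqP; field; rewrite gt_eqF.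
Qed.

(** At norms beyond [l * (M / a)^(1/m)] the transform is at most [a], hence at most [u]; the ball
    that remains has small volume for small [l] and falls to [narrow_region]. *)
Lemma good_start : exists2 l : R, 0 < l <= L & good l.
Proof.
have [del d0 H] := kernel_mass_small.
pose ka := (M / a) `^ m^-1.
have ka0 : 0 < ka by rewrite powR_gt0// divr_gt0.
pose V := @ball_vol R n 1.
have V0 : 0 < V by exact: ball_vol_gt0.
(* Capping [l * ka] by [1] gives [(l * ka)^n <= l * ka], so the bound by [del / V] controls the
   volume. *)
pose l := Num.min L (Num.min 1 (del / V) / ka).
have l0 : 0 < l by rewrite lt_min L0/= divr_gt0// lt_min ltr01 divr_gt0.
have lL : l <= L by rewrite ge_min lexx.
have lk : l * ka <= Num.min 1 (del / V).
  by rewrite -ler_pdivlMr// ge_min lexx orbT.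
have lk1 : l * ka <= 1 by rewrite (le_trans lk)// ge_min lexx.
have lk2 : l * ka <= del / V by rewrite (le_trans lk)// ge_min lexx orbT.
have lk0 : 0 < l * ka by rewrite mulr_gt0.
exists l; first by rewrite l0.
pose N := [set z : 'rV[R]_n | enorm (z - 0) < l * ka].
have mN : measurable N by exact: measurable_enorm_ball.
apply: (@narrow_region l N) => //.
  apply: H => //; rewrite /N lebesgue_ball// lee_fin.
  have -> : @ball_vol R n (l * ka) = (l * ka) ^+ n * V.
    by rewrite /V /ball_vol expr1n mul1r.
  rewrite -ler_pdivlMr// (le_trans _ lk2)// -[leRHS]expr1.
  by rewrite ler_wiXn2l ?(ltW lk0).
move=> z lz zr; rewrite /N/= subr0 => /negP; rewrite -leNgt => kz.
have z0 : 0 < enorm z by apply: lt_trans lz.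
apply: le_trans (kelvin_le m uM l0 lL lz) _.
move: (rho0) => r0; apply: le_trans (ua _); last lra.
rewrite -ler_pdivlMr//.
have -> : a / M = (ka^-1) `^ m.
  rewrite -(powR_inv1 (ltW ka0)) -powRrM mulN1r powRN /ka -powRrM mulVf ?gt_eqF//.
  by rewrite powRr1 ?invf_div// divr_ge0 ?(ltW M0)// ltW.
apply: powR_le; [exact: ltW|by rewrite divr_ge0 ?enorm_ge0// ltW|].
by rewrite ler_pdivrMr// mulrC ler_pdivlMr.
Qed.

(** A thin shell outside radius [l] is left to [narrow_region]; on the compact rest the inequality
    at [l] is strict, hence holds for all nearby radii at once. *)
Lemma good_step l : 0 < l -> l < L -> good l -> exists2 l', l < l' <= L & good l'.
Proof.
move=> l0 lL gl.
have [del d0 H] := kernel_mass_small.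
pose V := @ball_vol R n 1.
have V0 : 0 < V by exact: ball_vol_gt0.
have vE r : @ball_vol R n r = r ^+ n * V by rewrite /V /ball_vol expr1n mul1r.
have [e e0 He] : exists2 e : R, 0 < e & (l + e) ^+ n - l ^+ n <= del / V.
  have /cvgrPdist_lt/(_ (del / V)) := @exprn_continuous R n l.
  rewrite divr_gt0// => /(_ isT)/nbhs_ballP[e /= e0 He].
  exists (e / 2); first by rewrite divr_gt0.
  have := He (l + e / 2); rewrite /ball/= opprD addrA subrr sub0r normrN.
  rewrite gtr0_norm ?divr_gt0// ltr_pdivrMr// ltr_pMr// ltrDl ltr01 => /(_ isT).
  by rewrite distrC => /ltW; apply: le_trans; exact: ler_norm.
pose N := [set z : 'rV[R]_n | enorm (z - 0) < l + e] `\` [set z | enorm (z - 0) < l].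
have mN : measurable N by apply: measurableD; exact: measurable_enorm_ball.
have le0 : 0 < l + e by rewrite addr_gt0.
have muN : (mu N <= del%:E)%E.
  rewrite /N measureD; [|exact: measurable_enorm_ball|exact: measurable_enorm_ball|].
    rewrite setIidr; last by move=> z /=; lra.
    rewrite [X in (X - _ <= _)%E](_ : _ = (ball_vol (n := n) (l + e))%:E); last exact: lebesgue_ball.
    rewrite [X in (_ - X <= _)%E](_ : _ = (ball_vol (n := n) l)%:E); last exact: lebesgue_ball.
    by rewrite -EFinB lee_fin !vE -mulrBl -ler_pdivlMr.
  by rewrite [X in (X < _)%E](_ : _ = (ball_vol (n := n) (l + e))%:E) ?ltry//; exact: lebesgue_ball.
pose C := [set y : 'rV[R]_n | l + e <= enorm y] `&` [set y | enorm (y - 0) <= rho].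
have cC : compact C.
  rewrite /C setIC; apply: compact_closedI; first exact: compact_enorm_ball.
  rewrite [X in closed X](_ : _ = @enorm R n @^-1` [set t | l + e <= t])//.
  by apply: closed_comp; [move=> y _; exact: continuous_enorm|exact: closed_ge].
have nC : \forall l' \near l, C `<=` [set y | kelvin m l' u y < u y].
  have /compact_near_coveringP/(_ R (nbhs l) (fun l' y => kelvin m l' u y < u y)) := cC.
  apply => y [/= ly]; rewrite subr0 => yr.
  have ly' : l < enorm y by lra.
  have y0 : y != 0 by rewrite -enorm_gt0 (lt_trans l0).
  have st := good_strict l0 (ltW lL) gl ly' yr.
  have y4 : enorm y < 4 * rho by move: (rho0) => r0; lra.
  have i4 : enorm (inversion l y) < 4 * rho.
    by rewrite (le_lt_trans (enorm_inversion_le l0 (ltW ly')))// (lt_trans ly').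
  have c1 : (fun t : 'rV[R]_n * R => kelvin m t.2 u t.1) @ (nbhs y, nbhs l) --> kelvin m l u y.
    apply: (cvg_kelvin l0 y0 (uc i4)); [exact: cvg_snd|exact: cvg_fst].
  have c2 : (fun t : 'rV[R]_n * R => u t.1) @ (nbhs y, nbhs l) --> u y.
    exact: (@cvg_comp _ _ _ fst u _ _ _ (@cvg_fst _ _ (nbhs y) (nbhs l) _) (uc y4)).
  have FF : Filter (filter_prod (nbhs y) (nbhs l)) by exact: filter_prod_filter.
  have c3 := cvgB c2 c1.
  have : \forall t \near (nbhs y, nbhs l), 0 < u t.1 - kelvin m t.2 u t.1.
    by apply: (cvgr_gt _ (c3 FF)); rewrite subr_gt0.
  by apply: filterS => -[y' l'] /=; rewrite subr_gt0.
have /nbhs_ballP[e' /= e'0 He'] := nC.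
pose t := Num.min e (Num.min (L - l) (e' / 2)).
have t0 : 0 < t by rewrite !lt_min e0 subr_gt0 lL divr_gt0.
have te : t <= e by rewrite ge_min lexx.
have tL : t <= L - l by rewrite !ge_min lexx orbT.
have te' : t <= e' / 2 by rewrite !ge_min lexx !orbT.
have lt0 : 0 < l + t by lra.
have ltL : l + t <= L by lra.
exists (l + t); first by rewrite ltrDl t0.
apply: (@narrow_region (l + t) N) => //; first exact: H.
move=> z lz zr Nz; apply/ltW/He'.
  by rewrite /ball/= opprD addrA subrr sub0r normrN gtr0_norm//; lra.
split => /=; last by rewrite subr0.
rewrite leNgt; apply/negP => zl; apply: Nz; split => /=; rewrite subr0//.
by apply/negP; rewrite -leNgt; lra.
Qed.

(** Continuation in the radius: the supremum of the good radii is good, and [good_step] would pass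
    beyond it if it were less than [L]. *)
Theorem moving_sphere : good L.
Proof.
pose G := [set l : R | 0 < l <= L /\ good l].
have [l1 /andP[l10 l1L] gl1] := good_start.
have G1 : G l1 by split => //; rewrite l10.
have ubG : ubound G L by move=> l [/andP[]].
have hG : has_sup G by split; [exists l1|exists L].
pose s := sup G.
have s1 : l1 <= s by apply: ub_le_sup G1; exists L.
have s0 : 0 < s by apply: lt_le_trans s1.
have sL : s <= L by apply: ge_sup => //; exists l1.
(* A strict failure at [s] would persist for all radii near [s], among them good ones. *)
have gs : good s.
  move=> y; rewrite le_eqVlt => /predU1P[yl|sy] yr; first by rewrite (good_sphere s0).
  rewrite leNgt; apply/negP => uk.
  have y0 : y != 0 by rewrite -enorm_gt0 (lt_trans s0).
  have i4 : enorm (inversion s y) < 4 * rho.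
    move: (rho0) => r0.
    by rewrite (le_lt_trans (enorm_inversion_le s0 (ltW sy)))// (lt_le_trans sy)//; lra.
  have c1 : (fun t : R => kelvin m t u y) @ s --> kelvin m s u y.
    exact: (cvg_kelvin s0 y0 (uc i4) cvg_id (cvg_cst _)).
  have /nbhs_ballP[e /= e0 He] : \forall t \near s, u y < kelvin m t u y by apply: (cvgr_gt _ c1).
  have [l Gl sl] := sup_adherent e0 hG.
  have ls : l <= s by apply: ub_le_sup Gl; exists L.
  have := He l; rewrite /ball/= ger0_norm ?subr_ge0// ltrBlDr -ltrBlDl => /(_ sl).
  by rewrite ltNge Gl.2// (le_trans ls)// ltW.
move: sL; rewrite le_eqVlt => /predU1P[<-//|sL].
have [l' /andP[sl' l'L] gl'] := good_step s0 sL gs.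
have : l' <= s.
  apply: ub_le_sup; first by exists L.
  by split => //; rewrite l'L (lt_trans s0).
by rewrite leNgt sl'.
Qed.

End moving_spheres.

(** * From doubling points to the Harnack inequality *)

Lemma powR_half_sqr {R : realType} (x m : R) : (x `^ (m / 2)) ^+ 2 = x `^ m.
Proof. by rewrite -powR_mulrn ?powR_ge0// -powRrM divfK. Qed.

(** With [s = l / |y|] the point and its reflection are [(1 - s^2) |y|] apart, so [ln h] gains at
    most [2 K rho (1 - s) <= m (1 - s) <= - m ln s], which the Kelvin weight takes away. This
    dictates [2 * K * rho <= m]. *)
Lemma kelvin_lipschitz_ln {R : realType} {n : nat} (h : 'rV[R]_n -> R) (m K rho l : R)
    (y : 'rV[R]_n) :
  0 <= m -> 0 <= K -> 2 * K * rho <= m ->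
  0 < h y -> 0 < h (inversion l y) ->
  ln (h (inversion l y)) - ln (h y) <= K * enorm (inversion l y - y) ->
  0 < l -> l <= enorm y -> enorm y <= rho -> kelvin m l h y <= h y.
Proof.
move=> m0 K0 Km hy hl hln l0 ly yr.
have y0 : 0 < enorm y by apply: lt_le_trans ly.
set s := l / enorm y.
have s0 : 0 < s by rewrite divr_gt0.
have s1 : s <= 1 by rewrite ler_pdivrMr// mul1r.
have e1 : enorm (inversion l y - y) = (1 - s ^+ 2) * enorm y.
  rewrite enormBC -[X in X - _]scale1r /inversion -scalerBl enormZ ger0_norm// subr_ge0.
  by rewrite exprn_ile1// ltW.
rewrite /kelvin -/s -ler_ln ?posrE ?mulr_gt0 ?powR_gt0//.
rewrite lnM ?posrE ?powR_gt0// ln_powR.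
have lns : ln s <= s - 1.
  by have := @le_ln1Dx R (s - 1); rewrite addrCA subrr addr0; apply; lra.
have h1 : m * ln s <= m * (s - 1) by rewrite ler_wpM2l.
have h2 : K * enorm (inversion l y - y) <= (2 * K * rho) * (1 - s).
  have -> : 2 * K * rho * (1 - s) = K * (2 * (1 - s) * rho) by ring.
  rewrite e1 ler_wpM2l//.
  have : (1 - s ^+ 2) * enorm y <= (1 - s ^+ 2) * rho.
    by rewrite ler_wpM2l// subr_ge0 exprn_ile1// ltW.
  have : (1 - s ^+ 2) * rho <= 2 * (1 - s) * rho.
    have r0 : 0 <= rho by rewrite (le_trans (ltW y0)).
    by rewrite ler_wpM2r//; nra.
  lra.
have h3 : (2 * K * rho) * (1 - s) <= m * (1 - s) by rewrite ler_wpM2r// subr_ge0.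
lra.
Qed.

(* The doubling point: maximize [(rho - |x - x0|)^q u x] over the ball. *)
Lemma doubling_point {R : realType} {n : nat} (u : 'rV[R]_n -> R) (q rho : R) (x0 : 'rV[R]_n) :
  0 < q -> 0 < rho ->
  (forall x, enorm (x - x0) <= rho -> 0 < u x) ->
  (forall x, enorm (x - x0) <= rho -> {for x, continuous u}) ->
  exists x1 d, [/\ 0 < d, enorm (x1 - x0) + 2 * d = rho, u x0 <= u x1,
    rho `^ q * u x0 <= (2 * d) `^ q * u x1 &
    forall y, enorm (y - x1) <= d -> u y <= 2 `^ q * u x1].
Proof.
move=> q0 r0 up uc.
pose B := [set x : 'rV[R]_n | enorm (x - x0) <= rho].
(* The [1/q]-th power of the quantity to maximize: only the positive [u] is raised to a real power,
   so continuity also holds on the boundary, where the first factor vanishes. *)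
pose w (x : 'rV[R]_n) := (rho - enorm (x - x0)) * u x `^ q^-1.
have B0 : B x0 by rewrite /B/= subrr enorm0 ltW.
have cB : compact B by exact: compact_enorm_ball.
have Bn : B !=set0 by exists x0.
have cw : {within B, continuous w}.
  apply: continuous_in_subspaceT => x; rewrite inE => Bx.
  have FF : Filter (nbhs x) := @nbhs_filter 'rV[R]_n x.
  have c1 := cvg_comp _ _ (@continuous_subv R n x0 x) (@continuous_enorm R n (x - x0)).
  have c2 := cvg_comp u (fun t : R => t `^ q^-1) (uc _ Bx) (continuous_powR (up _ Bx)).
  exact: (@cvgM _ _ _ FF _ _ _ _ (@cvgB _ _ _ _ FF _ _ _ _ (cvg_cst rho) c1) c2).
have [x1 /set_mem Bx1 Hw] := compact_EVT_max Bn cB cw.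
have Hx1 z : z \in B ->
    (rho - enorm (z - x0)) `^ q * u z <= (rho - enorm (x1 - x0)) `^ q * u x1.
  move=> /[dup] /set_mem Bz /Hw.
  have wE x : B x -> (rho - enorm (x - x0)) `^ q * u x = w x `^ q.
    move=> Bx; rewrite powRM ?subr_ge0 ?powR_ge0// -powRrM mulVf ?gt_eqF//.
    by rewrite powRr1// ltW// up.
  rewrite (wE z Bz) (wE x1 Bx1) => ww; apply: powR_le ww; first exact: ltW.
  by rewrite mulr_ge0 ?powR_ge0// subr_ge0.
have w0 : rho `^ q * u x0 <= (rho - enorm (x1 - x0)) `^ q * u x1.
  by have := Hx1 x0 (mem_set B0); rewrite subrr enorm0 subr0.
have u0 := up _ B0.
have u1 := up _ Bx1.
have D0 : 0 < rho - enorm (x1 - x0).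
  rewrite lt_neqAle subr_ge0 Bx1 andbT; apply: contraTneq w0 => <-.
  by rewrite powR0 ?gt_eqF// mul0r -ltNge mulr_gt0// powR_gt0.
have Dr : rho - enorm (x1 - x0) <= rho by rewrite gerBl enorm_ge0.
exists x1, ((rho - enorm (x1 - x0)) / 2); split.
- by rewrite divr_gt0.
- by rewrite mulrC divfK// addrC subrK.
- have rq : 0 < rho `^ q by rewrite powR_gt0.
  rewrite -(ler_pM2l rq) (le_trans w0)// ler_pM2r//.
  by apply: powR_le => //; exact: ltW.
- by rewrite mulrCA mulfV// mulr1.
move=> y yd.
set d := (rho - enorm (x1 - x0)) / 2 in yd *.
have d0 : 0 < d by rewrite divr_gt0.
have Dd : rho - enorm (x1 - x0) = 2 * d by rewrite mulrCA mulfV// mulr1.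
(* Here the weight is still at least [d], half its value at [x1]; hence the factor [2^q]. *)
have yx : enorm (y - x0) <= rho - d.
  have := enormD (y - x1) (x1 - x0); rewrite addrA subrK; lra.
have By : B y by rewrite /B/=; lra.
have := Hx1 y (mem_set By); rewrite Dd => h1.
have dq : 0 < d `^ q by rewrite powR_gt0.
rewrite -(ler_pM2l dq) mulrA -powRM ?(ltW d0)// [d * 2]mulrC.
apply: le_trans h1; rewrite ler_pM2r ?up//; apply: powR_le; [exact: ltW|exact: ltW|lra].
Qed.

Lemma potential_translate {R : realType} {n : nat} (m : R) (f : 'rV[R]_n -> R) (c y : 'rV[R]_n) :
  (forall z, 0 <= f z) -> measurable_fun setT f ->
  (\int[lebesgue_rV n]_z (f z * ker1 m (y + c) z)%:E =
   \int[lebesgue_rV n]_z (f (z + c)%R * ker1 m y z)%:E)%E.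
Proof.
move=> f0 mf.
apply: etrans (esym (@lebesgue_rV_translate R n c (fun z => (f z * ker1 m (y + c) z)%:E) _ _)) _.
- apply/measurable_EFinP; apply: measurable_funM => //; exact: measurable_ker1.
- by move=> z; rewrite lee_fin mulr_ge0// ker1_ge0.
- by apply: eq_integral => z _; rewrite /ker1 opprD addrACA subrr addr0.
Qed.

Section core.
Context {R : realType} {n : nat}.
Hypothesis n0 : (0 < n)%N.
Local Notation mu := (@lebesgue_rV R n).
Variables (m p : R).
Hypothesis m0 : 0 < m.
Hypothesis p1 : 1 < p.
Hypothesis mp : critical_exponents n m p.

Section reflection.
Variables (f u h : 'rV[R]_n -> R) (rho a K : R) (x0 : 'rV[R]_n).
Hypothesis f0 : forall z, 0 <= f z.
Hypothesis mf : measurable_fun setT f.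
Hypothesis rho0 : 0 < rho.
Hypothesis a0 : 0 < a.
Hypothesis K0 : 0 <= K.
Hypothesis Krho : 2 * K * rho <= m.
Hypothesis fu : forall z, enorm (z - x0) < 6 * rho -> f z = u z `^ p.
Hypothesis ua : forall z, enorm (z - x0) < 6 * rho -> a <= u z.
Hypothesis equ : forall y, enorm (y - x0) < 6 * rho ->
  ((u y)%:E = \int[mu]_z (f z * ker1 m y z)%:E + (h y)%:E)%E.
Hypothesis h0 : forall z, enorm (z - x0) < 6 * rho -> 0 < h z.
Hypothesis lnh : forall y z, enorm (y - x0) < 6 * rho -> enorm (z - x0) < 6 * rho ->
  ln (h y) - ln (h z) <= K * enorm (y - z).
Hypothesis uc : forall z, enorm (z - x0) < 6 * rho -> {for z, continuous u}.

(** Translation by [c] brings the sphere to the origin. Centres lie up to [2 * rho] from [x0] and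
    each needs a ball of radius [4 * rho], whence [6 * rho]. *)
Lemma moving_sphere_at (c : 'rV[R]_n) (L M : R) :
  enorm (c - x0) <= 2 * rho -> 0 < L -> L <= rho ->
  (forall z, enorm (z - c) < L -> u z <= M) ->
  (L / rho) `^ m * M <= sphere_eps m * a ->
  forall y, L <= enorm y -> enorm y <= rho ->
  (L / enorm y) `^ m * u (inversion L y + c) <= u (y + c).
Proof.
move=> cx L0 Lr uM small.
have B6 z : enorm z < 4 * rho -> enorm (z + c - x0) < 6 * rho.
  by move=> zr; have := enormD z (c - x0); rewrite addrA; lra.
apply: (@moving_sphere R n n0 m p m0 p1 mp (fun z => f (z + c)) (fun z => u (z + c))
  (fun z => h (z + c)) rho a M L) => //.
- under eq_fun do rewrite addrC; exact: (measurableT_comp mf (measurable_addv n c)).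
- by move=> z zr; apply: fu; exact: B6.
- by move=> z zr; apply: ua; exact: B6.
- by move=> z zL; apply: uM; rewrite addrK.
- move=> y yr; rewrite equ; last exact: B6.
  exact: (f_equal (fun t => t + _)%E (potential_translate m c y f0 mf)).
- move=> l y l0 lL ly yr.
  have y4 : enorm y < 4 * rho by move: (rho0) => r0; lra.
  have i4 : enorm (inversion l y) < 4 * rho.
    by rewrite (le_lt_trans (enorm_inversion_le l0 ly))//; lra.
  apply: (@kelvin_lipschitz_ln _ _ _ m K rho) => //.
  + exact: ltW.
  + by apply: h0; exact: B6.
  + by apply: h0; exact: B6.
  + have := lnh (B6 _ i4) (B6 _ y4).
    by rewrite opprD addrACA subrr addr0.
- move=> y yr.
  have cadd : (fun z => z + c) @ y --> y + c.
    have := @continuous_subv R n (- c) y; rewrite /continuous_at opprK; exact.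
  exact: (@cvg_comp _ _ _ (fun z => z + c) u _ _ _ cadd (uc (B6 _ yr))).
Qed.

(** With [t = |y - x1|] the centre is [2 x1 - y]: it has [x1] at distance [t] and [y] at distance
    [2 t] on the same ray, so radius [sqrt 2 * t] exchanges them, with a weight independent of [t].
    The reflecting ball lies within [3 t] of [x1], where the doubling bound holds. *)
Lemma lower_bound_near (x1 : 'rV[R]_n) (s : R) :
  enorm (x1 - x0) <= rho -> 0 < s -> 2 * s <= rho ->
  (forall z, enorm (z - x1) <= 4 * s -> u z <= 2 `^ (m / 2) * u x1) ->
  (2 * s / rho) `^ m * (2 `^ (m / 2) * u x1) <= sphere_eps m * a ->
  forall y, enorm (y - x1) <= s -> (Num.sqrt 2 / 2) `^ m * u x1 <= u y.
Proof.
move=> xr s0 sr uM small y ys.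
have r0 := rho0.
have u1 : 0 < u x1 by apply: lt_le_trans a0 (ua _); lra.
have q0 : 0 <= Num.sqrt 2 :> R by exact: sqrtr_ge0.
have q2 : Num.sqrt 2 * Num.sqrt 2 = 2 :> R by rewrite -expr2 sqr_sqrtr.
have q1 : Num.sqrt 2 <= 2 :> R by nra.
have q1' : 1 <= Num.sqrt 2 :> R by nra.
have [->|yx] := eqVneq y x1.
  rewrite ler_piMl ?(ltW u1)//; apply: powR_le1; [exact: ltW|lra|lra].
set t := enorm (y - x1) in ys *.
have t0 : 0 < t by rewrite enorm_gt0 subr_eq0.
pose c := x1 - (y - x1).
have ec : enorm (c - x0) <= 2 * rho.
  have := enormB_leD (x1 - x0) (y - x1).
  by rewrite (_ : _ - (y - x1) = c - x0) -/t; [lra|rewrite /c addrAC].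
pose L := Num.sqrt 2 * t.
have L0 : 0 < L by rewrite mulr_gt0//; lra.
have L2 : L <= 2 * t by rewrite ler_wpM2r// ltW.
have := @moving_sphere_at c L (2 `^ (m / 2) * u x1) ec L0.
have -> : L <= rho by lra.
have uM' z : enorm (z - c) < L -> u z <= 2 `^ (m / 2) * u x1.
  move=> zc; apply: uM.
  have := enormB_leD (z - c) (y - x1).
  rewrite (_ : z - c - (y - x1) = z - x1) -/t; last first.
    by apply/rowP => i; rewrite !mxE; ring.
  lra.
move=> /(_ isT uM'); have sm : (L / rho) `^ m * (2 `^ (m / 2) * u x1) <= sphere_eps m * a.
  apply: le_trans small; apply: ler_wpM2r; first by rewrite mulr_ge0 ?powR_ge0// ltW.
  apply: powR_le; [exact: ltW|by rewrite divr_ge0// ltW|].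
  by rewrite ler_pM2r ?invr_gt0//; lra.
have e2 : enorm ((2 : R) *: (y - x1)) = 2 * t by rewrite enormZ ger0_norm.
move=> /(_ sm (2 *: (y - x1))); rewrite e2 => /(_ L2).
have -> : 2 * t <= rho by lra.
move=> /(_ isT).
have -> : L / (2 * t) = Num.sqrt 2 / 2.
  by rewrite /L; field; rewrite gt_eqF.
have -> : inversion L (2 *: (y - x1)) = y - x1.
  rewrite /inversion e2 scalerA (_ : _ * _ = 1) ?scale1r//.
  rewrite /L expr_div_n exprMn sqr_sqrtr//.
  by field; rewrite gt_eqF.
rewrite /c addrC subrK.
suff -> : 2 *: (y - x1) + (x1 - (y - x1)) = y by [].
by rewrite scaler_nat mulr2n addrCA addrK addrC subrK.
Qed.

Let V := @ball_vol R n 1.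
Let e := (n%:R - m) / m.

(** On the ball of radius [s] the density is at least [(th * u x1)^p] and the kernel at least
    [s^-m], so the equation gives [th^p V u(x1)^p s^(n-m) <= u(x1)]. Since [p = 1 + 2 e] and
    [n - m = m e] by criticality, this bounds [(u(x1)^2 s^m)^e]. *)
Lemma mass_bound (x1 : 'rV[R]_n) (s th : R) :
  enorm (x1 - x0) <= rho -> 0 < s -> 2 * s <= rho -> 0 < th ->
  (forall y, enorm (y - x1) <= s -> th * u x1 <= u y) ->
  u x1 ^+ 2 * s `^ m <= (th `^ p * V)^-1 `^ e^-1.
Proof.
move=> xr s0 sr th0 low.
have r0 := rho0.
have u1 : 0 < u x1 by apply: lt_le_trans a0 (ua _); lra.
have V0 : 0 < V by exact: ball_vol_gt0.
have mn : m < n%:R.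
  have H : m * 1 < m * p by rewrite ltr_pM2l.
  have : m + m < (2 * n)%:R by rewrite -(mp : _ + _ = _) ltrD2r -{1}[m]mulr1.
  by rewrite natrM -mulr2n -[m *+ 2]mulr_natl ltr_pM2l.
have e0 : 0 < e by rewrite divr_gt0// subr_gt0.
(* The centre is removed because [ker1 x1 x1] is [0] by convention, which breaks the lower bound on
   the kernel. *)
pose B := [set z : 'rV[R]_n | enorm (z - x1) < s] `\ x1.
have mx1 : measurable [set x1] by exact: measurable_set1_rV.
have mB : measurable B by apply: measurableD => //; exact: measurable_enorm_ball.
have muB : mu B = (@ball_vol R n s)%:E.
  rewrite -(lebesgue_ball x1 s0).
  have -> : [set z | enorm (z - x1) < s] = B `|` [set x1].
    by rewrite setUC setD1K//= subrr enorm0.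
  by rewrite measureU0//; exact: lebesgue_rV_set1.
have mk1 := measurable_ker1 (n := n) m x1.
have mfk : measurable_fun setT (fun z => f z * ker1 m x1 z) by exact: measurable_funM.
pose k := (th * u x1) `^ p * (s `^ m)^-1.
have k0 : 0 <= k by rewrite mulr_ge0 ?invr_ge0 ?powR_ge0.
have H : k * (s ^+ n * V) <= u x1.
  have vE : @ball_vol R n s = s ^+ n * V by rewrite /V /ball_vol expr1n mul1r.
  have x6 : enorm (x1 - x0) < 6 * rho by lra.
  have := equ x6; rewrite -lee_fin => ->.
  apply: (@le_trans _ _ (\int[mu]_z (f z * ker1 m x1 z)%:E)%E); last first.
    by rewrite leeDl// lee_fin ltW// h0.
  apply: (@le_trans _ _ (\int[mu]_(z in B) (f z * ker1 m x1 z)%:E)%E); last first.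
    by apply: subset_integral_real => // z; rewrite mulr_ge0 ?ker1_ge0.
  rewrite -vE EFinM -muB -integral_cst//.
  apply: (@le_integral_real _ _ _ (fun=> k)) => //.
  move=> z [/= Bz zx].
  have z6 : enorm (z - x0) < 6 * rho.
    by have := enormD (z - x1) (x1 - x0); rewrite addrA subrK; lra.
  rewrite fu//; apply: ler_pM.
  - exact: powR_ge0.
  - by rewrite invr_ge0 powR_ge0.
  - apply: powR_le; [by rewrite ltW// (lt_trans _ p1)|by rewrite mulr_ge0// ltW|].
    by apply: low; exact: ltW.
  have zx0 : 0 < enorm (x1 - z) by rewrite enorm_gt0 subr_eq0 eq_sym; apply/eqP.
  rewrite /ker1 lef_pV2 ?posrE ?powR_gt0//; apply: powR_le; [exact: ltW|exact: ltW|].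
  by rewrite enormBC ltW.
have Q0 : 0 <= u x1 ^+ 2 * s `^ m by rewrite mulr_ge0 ?powR_ge0 ?exprn_ge0// ltW.
have pe : p = 1 + 2 * e.
  rewrite /e; apply: (mulfI (lt0r_neq0 m0)); rewrite mulrDr mulr1 mulrCA (mulrC m (_ / m)) divfK ?gt_eqF//.
  by have := (mp : _ + _ = _); rewrite natrM; lra.
have Qe : (u x1 ^+ 2 * s `^ m) `^ e <= (th `^ p * V)^-1.
  rewrite -[leRHS]mul1r ler_pdivlMr; last by rewrite (mulr_gt0 _ V0)// powR_gt0.
  rewrite -(ler_pM2l u1) mulr1; apply: le_trans H.
  rewrite le_eqVlt; apply/orP; left; apply/eqP.
  have -> : u x1 * ((u x1 ^+ 2 * s `^ m) `^ e * (th `^ p * V)) =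
      th `^ p * u x1 `^ (1 + 2 * e) * (s `^ (m * e) * V).
    rewrite powRM ?powR_ge0 ?exprn_ge0 ?(ltW u1)// -powRrM.
    rewrite powRD; last by rewrite (gt_eqF u1) implybT.
    rewrite powRr1 ?(ltW u1)// [_ `^ (2 * e)]powRrM powR_mulrn ?(ltW u1)//; ring.
  rewrite /k -pe powRM ?(ltW th0) ?(ltW u1)//.
  have -> : m * e = n%:R - m by rewrite /e mulrC divfK ?gt_eqF.
  rewrite powRB ?gt_eqF ?implybT// powR_mulrn ?(ltW s0)//.
  by field; rewrite gt_eqF// powR_gt0.
rewrite -[leLHS](powRr1 Q0) -(mulfV (lt0r_neq0 e0)) powRrM.
apply: powR_le => //; [by rewrite invr_ge0 ltW|exact: powR_ge0].
Qed.

End reflection.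
Lemma core_bound : exists2 C : R, 0 < C &
  forall (f u h : 'rV[R]_n -> R) (rho a K : R) (x0 : 'rV[R]_n),
  (forall z, 0 <= f z) -> measurable_fun setT f ->
  0 < rho -> 0 < a -> 0 <= K -> 2 * K * rho <= m ->
  (forall z, enorm (z - x0) < 6 * rho -> f z = u z `^ p) ->
  (forall z, enorm (z - x0) < 6 * rho -> a <= u z) ->
  (forall y, enorm (y - x0) < 6 * rho ->
    ((u y)%:E = \int[mu]_z (f z * ker1 m y z)%:E + (h y)%:E)%E) ->
  (forall z, enorm (z - x0) < 6 * rho -> 0 < h z) ->
  (forall y z, enorm (y - x0) < 6 * rho -> enorm (z - x0) < 6 * rho ->
    ln (h y) - ln (h z) <= K * enorm (y - z)) ->
  (forall z, enorm (z - x0) < 6 * rho -> {for z, continuous u}) ->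
  u x0 * a <= C * rho `^ (- m).
Proof.
pose th : R := (Num.sqrt 2 / 2) `^ m.
have th0 : 0 < th by rewrite powR_gt0// divr_gt0// sqrtr_gt0.
have V0 : 0 < @ball_vol R n 1 by exact: ball_vol_gt0.
pose Q := (th `^ p * @ball_vol R n 1)^-1 `^ ((n%:R - m) / m)^-1.
have Q0 : 0 < Q by rewrite powR_gt0// invr_gt0 mulr_gt0// powR_gt0.
have e0 : 0 < sphere_eps m := sphere_eps_gt0 m0.
have q0 : 0 < (2 : R) `^ (m / 2) by rewrite powR_gt0.
(* Solves [(2 kap)^m * 2^(m/2) = sphere_eps m], which turns the smallness condition of
   [lower_bound_near] into [s <= kap * rho * (a / u x1)^(1/m)]. *)
pose kap := (sphere_eps m / 2 `^ (m / 2)) `^ m^-1 / 2.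
have kap0 : 0 < kap by rewrite divr_gt0// powR_gt0// divr_gt0.
have kapE : (2 * kap) `^ m * 2 `^ (m / 2) = sphere_eps m.
  have -> : 2 * kap = (sphere_eps m / 2 `^ (m / 2)) `^ m^-1 by rewrite mulrC divfK.
  rewrite -powRrM mulVf ?gt_eqF// powRr1 ?divfK ?gt_eqF//.
  by rewrite divr_ge0// ltW.
have km0 : 0 < kap `^ m by rewrite powR_gt0.
exists (8 `^ m * Q + Q / kap `^ m).
  by rewrite addr_gt0// ?divr_gt0// mulr_gt0// powR_gt0.
move=> f u h rho a K x0 f0 mf rho0 a0 K0 Krho fu ua equ h0 lnh uc.
have B6 x : enorm (x - x0) <= rho -> enorm (x - x0) < 6 * rho by lra.
have [x1 [d [d0 xd u01 w01 ud]]] := doubling_point (divr_gt0 m0 (ltr0n R 2)) rho0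
  (fun x xr => lt_le_trans a0 (ua x (B6 x xr))) (fun x xr => uc x (B6 x xr)).
have xr : enorm (x1 - x0) <= rho by lra.
have dr : 2 * d <= rho by have := enorm_ge0 (x1 - x0); lra.
have u0a : a <= u x0 by apply: ua; rewrite subrr enorm0 mulr_gt0.
have u00 : 0 < u x0 by exact: lt_le_trans u0a.
have u10 : 0 < u x1 by exact: lt_le_trans u01.
have rm0 : 0 < rho `^ m by rewrite powR_gt0.
pose g := a / u x1.
have g0 : 0 < g by rewrite divr_gt0.
have gm : (g `^ m^-1) `^ m = g by rewrite -powRrM mulVf ?gt_eqF// powRr1// ltW.
(* The first bound keeps the radius [4 * s] within the doubling radius [d]; the second is the
   smallness condition. *)
pose s := Num.min (d / 4) (kap * rho * g `^ m^-1).
have s0 : 0 < s by rewrite lt_min divr_gt0//= mulr_gt0 ?powR_gt0// mulr_gt0.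
have s1 : s <= d / 4 by rewrite ge_min lexx.
have s2 : s <= kap * rho * g `^ m^-1 by rewrite ge_min lexx orbT.
have sr : 2 * s <= rho by lra.
have low : forall y, enorm (y - x1) <= s -> th * u x1 <= u y.
  apply: (lower_bound_near f0 mf rho0 a0 K0 Krho fu ua equ h0 lnh uc xr s0 sr).
    by move=> z zs; apply: ud; lra.
  have h1 : (2 * s / rho) `^ m <= (2 * kap) `^ m * g.
    have -> : (2 * kap) `^ m * g = (2 * kap * g `^ m^-1) `^ m.
      have k2 : 0 <= 2 * kap by lra.
      by rewrite [RHS](powRM _ k2 (powR_ge0 _ _)) gm.
    apply: powR_le; [exact: ltW|by rewrite divr_ge0 ?mulr_ge0 ?ltW|].
    by rewrite ler_pdivrMr//; lra.
  have -> : sphere_eps m * a = (2 * kap) `^ m * g * (2 `^ (m / 2) * u x1).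
    by rewrite -kapE /g; field; rewrite gt_eqF.
  by apply: ler_wpM2r => //; rewrite mulr_ge0// ltW.
have HQ : u x1 ^+ 2 * s `^ m <= Q.
  exact: (mass_bound f0 mf rho0 a0 fu ua equ h0 xr s0 sr th0 low).
rewrite powRN ler_pdivlMr//.
(* If the doubling radius decides, squaring the doubling inequality gives [rho^m u(x0)^2 <= (2 d)^m
   u(x1)^2 = 8^m s^m u(x1)^2], and [a <= u x0]. *)
have [ds|kd] := leP (d / 4) (kap * rho * g `^ m^-1).
  have sE : s = d / 4 by apply/min_idPl.
  have : rho `^ m * u x0 ^+ 2 <= (2 * d) `^ m * u x1 ^+ 2.
    rewrite -(powR_half_sqr rho) -(powR_half_sqr (2 * d)) -!exprMn.
    by rewrite ler_pXn2r// nnegrE mulr_ge0 ?powR_ge0// ltW.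
  have -> : (2 * d) `^ m = 8 `^ m * s `^ m.
    by rewrite -powRM ?(ltW s0)// sE; congr (_ `^ _); field.
  have h8 : 8 `^ m * (u x1 ^+ 2 * s `^ m) <= 8 `^ m * Q by rewrite ler_wpM2l ?powR_ge0.
  have hk : 0 <= Q / kap `^ m by rewrite divr_ge0 ?ltW.
  have hu : rho `^ m * (u x0 * a) <= rho `^ m * u x0 ^+ 2.
    by rewrite expr2 ler_pM2l// ler_pM2l.
  lra.
(* Otherwise [s^m] contains the factor [a / u x1], so the mass bound is already a bound on
   [u x1 * a], and [u x0 <= u x1]. *)
have sE : s = kap * rho * g `^ m^-1 by apply/min_idPr/ltW.
have kr0 : 0 <= kap * rho by rewrite ltW// mulr_gt0.
move: HQ; rewrite sE (powRM _ kr0 (powR_ge0 _ _)) gm (powRM _ (ltW kap0) (ltW rho0)).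
have -> : u x1 ^+ 2 * (kap `^ m * rho `^ m * g) = u x1 * a * rho `^ m * kap `^ m.
  by rewrite /g; field; rewrite gt_eqF.
move=> h1.
have h4 : u x1 * a * rho `^ m <= Q / kap `^ m by rewrite ler_pdivlMr.
have h2 : u x0 * a * rho `^ m <= u x1 * a * rho `^ m by rewrite ler_pM2r// ler_pM2r.
have h3 : 0 <= 8 `^ m * Q by rewrite mulr_ge0 ?powR_ge0// ltW.
lra.
Qed.

End core.

(** * From essential to pointwise bounds on the gradient of ln h *)

Section log_gradient.
Context {R : realType} {n : nat}.
Implicit Types (h g : 'rV[R]_n -> R) (x y v : 'rV[R]_n).

Lemma differentiable_ln_comp h x : differentiable h x -> 0 < h x ->
  differentiable (fun y => ln (h y)) x.
Proof.
move=> dh h0; apply: (@differentiable_comp _ _ _ _ h (@ln R)) => //.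
by apply/derivable1_diffP; have [] := is_derive1_ln h0.
Qed.

Lemma derive_ln_comp h x v : differentiable h x -> 0 < h x ->
  'D_v (fun y => ln (h y)) x = 'D_v h x / h x.
Proof.
move=> dh h0.
have dl : differentiable (@ln R : R^o -> R^o) (h x).
  by apply/derivable1_diffP; have [] := is_derive1_ln h0.
rewrite deriveE; last exact: differentiable_ln_comp.
rewrite (@diff_comp _ _ _ _ h (@ln R))// (deriveE v dh)/= diff1E//.
by rewrite derive1E; have [_ ->] := is_derive1_ln h0.
Qed.

Lemma derive_dotv g x v : differentiable g x -> 'D_v g x = dotv v (grad g x).
Proof.
move=> dg; rewrite deriveE// {1}(row_sum_delta v) linear_sum /dotv.
by apply: eq_bigr => i _; rewrite linearZ/= !mxE /partial deriveE.
Qed.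

Lemma mean_value_bound g (r K : R) : 0 <= K ->
  (forall x, eball r x -> differentiable g x) ->
  (forall x, eball r x -> enorm (grad g x) <= K) ->
  forall x y, eball r x -> eball r y -> g y - g x <= K * enorm (y - x).
Proof.
move=> K0 dg gK x y xr yr.
set v := y - x.
pose phi (t : R) := g (x + t *: v).
have seg (t : R) : 0 <= t -> t <= 1 -> eball r (x + t *: v).
  move=> t0 t1; rewrite /eball/=.
  have -> : x + t *: v = (1 - t) *: x + t *: y by apply/rowP => i; rewrite !mxE; ring.
  apply: le_lt_trans (enormD _ _) _; rewrite !enormZ !ger0_norm ?subr_ge0//.
  rewrite /eball/= in xr yr.
  have [->|tn] := eqVneq t 0; first by rewrite subr0 mul1r mul0r addr0.
  have tp : 0 < t by rewrite lt_neqAle eq_sym tn.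
  have h1 : t * enorm y < t * r by rewrite ltr_pM2l.
  have h2 : (1 - t) * enorm x <= (1 - t) * r by rewrite ler_wpM2l ?subr_ge0// ltW.
  lra.
have dphi (t : R) : 0 <= t -> t <= 1 -> is_derive t 1 phi ('D_v g (x + t *: v)).
  move=> t0 t1.
  have E : (fun k : R => k^-1 *: ((phi \o shift t) (k *: 1) - phi t)) =
           (fun k : R => k^-1 *: ((g \o shift (x + t *: v)) (k *: v) - g (x + t *: v))).
    apply/funext => k; congr (_ *: (g _ - _)); rewrite /shift/=.
    by rewrite [k *: 1]mulr1 scalerDl addrCA.
  have dv := diff_derivable (dg _ (seg _ t0 t1)) (v := v).
  by apply: DeriveDef; rewrite /derivable /derive E.
have cphi : {within `[0, 1], continuous phi}.
  apply: continuous_in_subspaceT => t; rewrite inE/= in_itv/= => /andP[t0 t1].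
  apply: differentiable_continuous; apply/derivable1_diffP.
  by have [] := dphi t t0 t1.
have [|c] := MVT ltr01 _ cphi (df := fun t => 'D_v g (x + t *: v)).
  by move=> t; rewrite in_itv/= => /andP[/ltW t0 /ltW t1]; exact: dphi.
rewrite in_itv/= => /andP[/ltW c0 /ltW c1].
rewrite /phi scale1r scale0r addr0 subr0 mulr1 /v subrKC => ->.
rewrite derive_dotv; last exact/dg/seg.
apply: le_trans (cauchy_schwarz _ _) _.
by rewrite mulrC ler_wpM2r ?enorm_ge0//; exact/gK/seg.
Qed.

(** A continuous [g] above [c] at a point of the open set is above [c] on a whole ball, which has
    positive measure. *)
Lemma Linfty_pointwise (n0 : (0 < n)%N) (D : set 'rV[R]_n) g (c : R) :
  open D -> (forall x, D x -> 0 <= g x) -> (forall x, D x -> {for x, continuous g}) ->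
  (Linfty D g <= c%:E)%E -> forall x, D x -> g x <= c.
Proof.
move=> oD g0 gc; rewrite /Linfty unlock.
(* The norm with exponent [+oo] is defined by cases on whether the whole space has positive
   measure. *)
have muT : (0 < lebesgue_rV n [set: 'rV[R]_n])%E.
  apply: (@lt_le_trans _ _ (lebesgue_rV n [set x | enorm (x - 0) < 1])).
    by rewrite lebesgue_ball// lte_fin ball_vol_gt0.
  by apply: le_measure => //; rewrite inE//; exact: measurable_enorm_ball.
rewrite muT => /ess_supP H x Dx.
rewrite leNgt; apply/negP => cx.
have N : nbhs x (D `&` [set y | c < g y]).
  apply: filterI; first exact: open_nbhs_nbhs.
  exact: (cvgr_gt _ (gc _ Dx)).
move: N => /nbhs_ballP[e /= e0 eN].
have sub : [set y | enorm (y - x) < e] `<=` D `&` [set y | c < g y].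
  apply: subset_trans eN => y /= yx.
  split => // i j; rewrite ord1 /ball/=.
  have := normr_coor_le_enorm (x - y) j; rewrite !mxE enormBC => h.
  exact: le_lt_trans h yx.
have : (lebesgue_rV n).-negligible [set y | enorm (y - x) < e].
  apply: negligibleS H => y /sub[Dy /= cy] /=.
  by rewrite patchE mem_set//= lee_fin ger0_norm ?g0// leNgt cy.
move/negligibleP => /(_ (measurable_enorm_ball _ _)).
move=> /(etrans (esym (lebesgue_ball x e0)))[] /eqP.
by rewrite gt_eqF// ball_vol_gt0.
Qed.

(** Continuity is given for the partial derivatives of [h], so on [E] the gradient of [ln h] is
    first rewritten through the quotients of these derivatives by [h]. *)
Lemma grad_ln_pointwise (n0 : (0 < n)%N) h (D E : set 'rV[R]_n) (c : R) :
  open D -> open E -> E `<=` D -> C1on D h -> (forall x, D x -> 0 < h x) ->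
  (Linfty E (fun x => enorm (grad (fun y => ln (h y)) x)) <= c%:E)%E ->
  forall x, E x -> enorm (grad (fun y => ln (h y)) x) <= c.
Proof.
move=> oD oE ED [dh ch] h0 H.
pose F x := Num.sqrt (\sum_i ('D_('e_i) h x / h x) ^+ 2).
have FE x : E x -> enorm (grad (fun y => ln (h y)) x) = F x.
  move=> /ED Dx; rewrite /enorm /F; congr Num.sqrt; apply: eq_bigr => i _.
  by rewrite mxE /partial derive_ln_comp//; [exact: dh|exact: h0].
have : (Linfty E F <= c%:E)%E.
  rewrite (_ : Linfty E F = Linfty E (fun x => enorm (grad (fun y => ln (h y)) x)))//.
  rewrite /Linfty; congr (Lnorm _ _ (_ \o _)); apply/funext => x; rewrite !patchE.
  by case: ifPn => // /set_mem /FE.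
move=> /(Linfty_pointwise n0 oE (fun x _ => sqrtr_ge0 _)) H' x Ex.
rewrite FE//; apply: H' Ex => {}x /ED Dx.
have FF : Filter (nbhs x) := @nbhs_filter 'rV[R]_n x.
have c1 : \sum_i ('D_('e_i) h y / h y) ^+ 2 @[y --> x] --> \sum_i ('D_('e_i) h x / h x) ^+ 2.
  apply: cvg_big => [|i _]; first exact: add_continuous.
  have c2 : 'D_('e_i) h y / h y @[y --> x] --> 'D_('e_i) h x / h x.
    apply: (@cvgM _ _ _ FF).
      by have := ch i; rewrite continuous_open_subspace// => /(_ x (mem_set Dx)).
    apply: (@cvgV _ _ _ FF); first by rewrite gt_eqF// h0.
    exact: differentiable_continuous (dh _ Dx).
  rewrite expr2; exact: (@cvgM _ _ _ FF _ _ _ _ c2 c2).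
exact: (cvg_comp _ _ c1 (@sqrt_continuous R _)).
Qed.

End log_gradient.

Lemma open_eball {R : realType} {n : nat} (r : R) : open (@eball R n r).
Proof.
rewrite (_ : eball r = [set x | enorm (x - 0) < r]); last first.
  by apply/seteqP; split => x; rewrite /eball/= subr0.
exact: open_enorm_ball.
Qed.

(** The supremum may be [+oo] a priori. The infimum is finite because [E] is inhabited; if it is [0]
    the product is [0] whatever the supremum, and otherwise one divides by it. *)
Lemma mule_inf_le {R : realType} {T : Type} (D E : set T) (u : T -> R) (B : R) :
  0 <= B -> D !=set0 -> E !=set0 -> (forall x, E x -> 0 <= u x) ->
  (forall x a, D x -> 0 < a -> (forall y, E y -> a <= u y) -> u x * a <= B) ->
  (ereal_sup [set (u x)%:E | x in D] * ereal_inf [set (u x)%:E | x in E] <= B%:E)%E.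
Proof.
move=> B0 D0 [y0 Ey0] u0 H.
set I := ereal_inf _.
have I0 : (0 <= I)%E.
  by apply: le_ereal_inf_tmp => _ [y Ey <-]; rewrite lee_fin u0.
have Iu y : E y -> (I <= (u y)%:E)%E.
  by move=> Ey; apply: ereal_inf_lbound; exists y.
case EI : I I0 Iu => [a| |] I0 Iu; last 2 first.
- by have := Iu _ Ey0.
- by [].
move: I0; rewrite lee_fin le_eqVlt => /predU1P[<-|a0]; first by rewrite mule0 lee_fin.
rewrite -lee_pdivlMr//; apply: ge_ereal_sup => _ [x Dx <-].
rewrite -EFinM lee_fin ler_pdivlMr//; exact: H.
Qed.

Unset Implicit Arguments.

Theorem theorem1p5 (R : realType) (n : nat) (sigma A : R) (hn : (1 <= n)%N)
    (hsigma : 0 < sigma < n%:R / 2) (hA : 0 < A) :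
  exists C : R, 0 < C /\
    forall (r : R) (h u : 'rV[R]_n -> R),
      0 < r ->
      C1on (eball (3 * r)) h ->
      (forall x, eball (3 * r) x -> 0 < h x) ->
      ((r `^ ((n%:R - 2 * sigma) / 2))%:E * Linfty (eball (5 * r / 2)) h +
       r%:E * Linfty (eball (5 * r / 2))
                (fun x => enorm (grad (fun y => ln (h y)) x))
       <= A%:E)%E ->
      {within eball (3 * r), continuous u} ->
      (forall x, eball (3 * r) x -> 0 < u x) ->
      (forall x, eball (3 * r) x ->
        ((u x)%:E =
         \int[lebesgue_rV n]_(y in eball (3 * r))
            (u y `^ ((n%:R + 2 * sigma) / (n%:R - 2 * sigma)) /
             enorm (x - y) `^ (n%:R - 2 * sigma))%:E
         + (h x)%:E)%E) ->
      (ereal_sup [set (u x)%:E | x in eball r] *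
       ereal_inf [set (u x)%:E | x in eball (2 * r)]
       <= (C * r `^ (2 * sigma - n%:R))%:E)%E.
Proof.
have /andP[s0 sn] := hsigma.
rewrite -(opprB n%:R (2 * sigma)).
set m : R := n%:R - 2 * sigma; set p : R := (n%:R + 2 * sigma) / m.
have m0 : 0 < m by move: sn; rewrite /m ltr_pdivlMr// subr_gt0 mulrC.
have p1 : 1 < p.
  by rewrite ltr_pdivlMr// mul1r /m; move: (n%:R : R) => N; lra.
have mp : critical_exponents n m p.
  rewrite /critical_exponents /p mulrC divfK ?gt_eqF// natrM /m.
  by move: (n%:R : R) => N; lra.
have [C0 C00 core] := core_bound hn m0 p1 mp.
(* The bound [1/6] keeps the ball of radius [6 * rho] about a point of norm below [r] inside radius
   [2 * r], where [a] bounds [u] from below; the other one, with [K = A / r], gives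
   [2 * K * rho <= m]. *)
pose kap := Num.min (1 / 6) (m / (2 * A)).
have kap0 : 0 < kap by rewrite lt_min !divr_gt0 ?mulr_gt0.
have kap6 : kap <= 1 / 6 by rewrite ge_min lexx.
have kapA : kap * (2 * A) <= m by rewrite -ler_pdivlMr ?mulr_gt0// ge_min lexx orbT.
exists (C0 * kap `^ (- m)); split; first by rewrite mulr_gt0// powR_gt0.
move=> r h u r0 Ch h0 hL uc u0 equ.
pose rho := kap * r.
have rho0 : 0 < rho by rewrite mulr_gt0.
have rho6 : 6 * rho <= r by have := ler_wpM2r (ltW r0) kap6; rewrite /rho; lra.
have B23 (x : 'rV[R]_n) : eball (2 * r) x -> eball (3 * r) x by rewrite /eball/=; lra.
have B25 (x : 'rV[R]_n) : eball (2 * r) x -> eball (5 * r / 2) x by rewrite /eball/=; lra.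
have B53 : eball (5 * r / 2) `<=` @eball R n (3 * r) by move=> x; rewrite /eball/=; lra.
have K0 : 0 <= A / r by rewrite divr_ge0 ?ltW.
have gradK : forall x, eball (5 * r / 2) x -> enorm (grad (fun y => ln (h y)) x) <= A / r.
  have oD := @open_eball R n (3 * r); have oE := @open_eball R n (5 * r / 2).
  apply: (grad_ln_pointwise hn oD oE B53 Ch h0).
  rewrite (mulrC A) EFinM lee_pdivlMl//; apply: le_trans hL.
  by rewrite leeDr// mule_ge0 ?lee_fin ?powR_ge0//; exact: Lnorm_ge0.
have lnh : forall x y, eball (5 * r / 2) x -> eball (5 * r / 2) y ->
    ln (h y) - ln (h x) <= A / r * enorm (y - x).
  apply: mean_value_bound K0 _ gradK => x /B53 xr.
  by apply: differentiable_ln_comp; [exact: Ch.1|exact: h0].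
have uc' x : eball (3 * r) x -> {for x, continuous u}.
  move=> xr; move: uc; rewrite continuous_open_subspace; last exact: open_eball.
  by apply; exact: mem_set.
(* Extension by zero makes the potential an integral over the whole space, as the inversion formulas
   require; far away only nonnegativity of the density is asked for. *)
pose f := (fun z => u z `^ p) \_ (eball (3 * r)).
have f0 z : 0 <= f z by rewrite /f patchE; case: ifPn => // _; exact: powR_ge0.
have mf : measurable_fun setT f.
  apply/(measurable_restrictT _ _).1.
    by apply: open_measurable_rV; exact: open_eball.
  apply: (measurableT_comp (measurable_powR p)).
  by apply: continuous_measurable_rV uc; exact: open_eball.
have fu z : eball (3 * r) z -> f z = u z `^ p by move=> zr; rewrite /f patchE mem_set.
have equ' x : eball (3 * r) x ->
    ((u x)%:E = \int[lebesgue_rV n]_z (f z * ker1 m x z)%:E + (h x)%:E)%E.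
  move=> xr; rewrite (equ x xr) integral_mkcond; congr (_ + _)%E.
  apply: eq_integral => z _; rewrite /f !patchE /ker1.
  by case: ifPn => // _; rewrite mul0r.
have rm : kap `^ (- m) * r `^ (- m) = rho `^ (- m) by rewrite powRM ?ltW.
rewrite -mulrA rm; apply: mule_inf_le.
- by rewrite mulr_ge0 ?powR_ge0// ltW.
- by exists 0; rewrite /eball/= enorm0.
- by exists 0; rewrite /eball/= enorm0 mulr_gt0.
- by move=> x /B23/u0/ltW.
move=> x0 a x0r a0 ua.
have B6 z : enorm (z - x0) < 6 * rho -> eball (2 * r) z.
  by move: x0r; rewrite /eball/= => x0r zx; have := enormD (z - x0) x0; rewrite subrK; lra.
apply: (core f u h rho a (A / r) x0) => //.
- by rewrite (_ : 2 * (A / r) * rho = kap * (2 * A))// /rho; field; rewrite gt_eqF.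
- by move=> z /B6/B23; exact: fu.
- by move=> z /B6; exact: ua.
- by move=> z /B6/B23; exact: equ'.
- by move=> z /B6/B23; exact: h0.
- by move=> y z /B6/B25 yr /B6/B25 zr; exact: lnh.
- by move=> z /B6/B23; exact: uc'.
Qed.
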